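(* (i) Nonnegativity: $\mathrm D_{\mathrm{TKL}}(p\|q)\ge0$ for all admissible $p,q$, and $\mathrm D_{\mathrm{TKL}}(p\|q)=0$ if and only if there is $c\in\mathbb R^d$ with $p(x+c)=q(x)$ for all $x\in\mathbb R^d$. (ii) Separability: if $p_1,q_1$ are admissible densities on $\mathbb R^{d_1}$, $p_2,q_2$ admissible densities on $\mathbb R^{d_2}$, and $p(x,y)=p_1(x)p_2(y)$, $q(x,y)=q_1(x)q_2(y)$ on $\mathbb R^{d_1+d_2}$, then $\mathrm D_{\mathrm{TKL}}(p\|q)=\mathrm D_{\mathrm{TKL}}(p_1\|q_1)+\mathrm D_{\mathrm{TKL}}(p_2\|q_2)$. (iii) Hessian metric: for admissible $q$, $\Phi\in C_c^\infty(\mathbb R^d)$ and $q_\epsilon=(\mathrm{id}+\epsilon\nabla\Phi)_\#q$ ($|\epsilon|$ small), as $\epsilon\to0$, $$\mathrm D_{\mathrm{TKL}}(q_\epsilon\|q)=\frac{\epsilon^2}{2}\int_{\mathbb R^d}\mathrm{tr}\big(\nabla^2\Phi(x)\nabla^2\Phi(x)\big)q(x)\,dx+o(\epsilon^2).$$ (iv) Transport convexity: let $q$ be admissible, $p_1=(\nabla\Phi_{p_1})_\#q$, $p_2=(\nabla\Phi_{p_2})_\#q$ with $\nabla\Phi_{p_i}$ the Brenier maps, and for $\lambda\in[0,1]$ let $p_\lambda=(\lambda\nabla\Phi_{p_1}+(1-\lambda)\nabla\Phi_{p_2})_\#q$, assumed admissible. Then $\mathrm D_{\mathrm{TKL}}(p_\lambda\|q)\le\lambda\mathrm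 D_{\mathrm{TKL}}(p_1\|q)+(1-\lambda)\mathrm D_{\mathrm{TKL}}(p_2\|q)$.
   Context: Densities are smooth strictly positive probability densities on $\mathbb R^d$. For such $p,q$, $\nabla\Phi_p$ denotes the Brenier map from $q$ to $p$ (the gradient of a convex function pushing $q$ to $p$, unique $q$-a.e.); the pair is admissible if $\Phi_p\in C^\infty$ with $\nabla^2\Phi_p$ positive definite everywhere, $\nabla\Phi_p$ is a diffeomorphism of $\mathbb R^d$ with $p(\nabla\Phi_p(x))\det\nabla^2\Phi_p(x)=q(x)$, and $q\Delta\Phi_p$, $q\log\det\nabla^2\Phi_p$ are integrable. The transport KL divergence is $\mathrm D_{\mathrm{TKL}}(p\|q)=\int_{\mathbb R^d}\big(\Delta\Phi_p(x)-\log\det\nabla^2\Phi_p(x)-d\big)q(x)\,dx$. *)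

(* Defs.v *)
From HB Require Import structures.
From mathcomp Require Import all_boot all_order all_algebra.
From mathcomp Require Import all_classical all_reals all_analysis.
Set Implicit Arguments. Unset Strict Implicit. Unset Printing Implicit Defensive.
Import Order.TTheory GRing.Theory Num.Theory.
Import numFieldNormedType.Exports.
Local Open Scope classical_set_scope.
Local Open Scope ring_scope.

Section TKL.
Variable R : realType.

Definition ebasis d (i : 'I_d) : 'rV[R]_d := delta_mx 0 i.

Fixpoint iderive d (vs : seq 'rV[R]_d) (f : 'rV[R]_d -> R) : 'rV[R]_d -> R :=
  match vs with
  | [::] => f
  | v :: vs' => fun x => derive (iderive vs' f) x v
  end.

Definition smooth d (f : 'rV[R]_d -> R) : Prop :=
  forall vs : seq 'rV[R]_d,
    continuous (iderive vs f) /\ forall x v, derivable (iderive vs f) x v.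

Definition smooth_map d (T : 'rV[R]_d -> 'rV[R]_d) : Prop :=
  forall i : 'I_d, smooth (fun x => T x 0 i).

Definition diffeo d (T : 'rV[R]_d -> 'rV[R]_d) : Prop :=
  exists S : 'rV[R]_d -> 'rV[R]_d,
    cancel T S /\ cancel S T /\ smooth_map T /\ smooth_map S.

Definition grad d (f : 'rV[R]_d -> R) (x : 'rV[R]_d) : 'rV[R]_d :=
  \row_i derive f x (ebasis i).

Definition hess d (f : 'rV[R]_d -> R) (x : 'rV[R]_d) : 'M[R]_d :=
  \matrix_(i, j) derive (fun y => derive f y (ebasis j)) x (ebasis i).

Definition lap d (f : 'rV[R]_d -> R) (x : 'rV[R]_d) : R := \tr (hess f x).

Definition posdef d (M : 'M[R]_d) : Prop :=
  forall v : 'rV[R]_d, v != 0 -> 0 < (v *m M *m v^T) 0 0.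

(* Lebesgue integral over R^d of a nonnegative extended-real function,
   as the iterated one-dimensional Lebesgue integral (Tonelli). *)
Fixpoint iint d : ('rV[R]_d -> \bar R) -> \bar R :=
  match d with
  | 0 => fun f => f 0
  | d'.+1 => fun f =>
      (\int[@lebesgue_measure R]_t
          iint (fun y : 'rV[R]_d' => f (row_mx (\row_(_ < 1) t) y)))%E
  end.

Definition integrable d (f : 'rV[R]_d -> R) : Prop :=
  (iint (fun x => (`|f x|)%:E) < +oo)%E.

Definition integral_Rd d (f : 'rV[R]_d -> R) : R :=
  fine (iint (fun x => (Num.max (f x) 0)%:E))
  - fine (iint (fun x => (Num.max (- f x) 0)%:E)).

Definition density d (p : 'rV[R]_d -> R) : Prop :=
  smooth p /\ (forall x, 0 < p x) /\ iint (fun x => (p x)%:E) = 1%E.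

(* (p, q) is admissible, with Brenier potential Phi (grad Phi pushes q to p) *)
Definition admissible d (p q : 'rV[R]_d -> R) (Phi : 'rV[R]_d -> R) : Prop :=
  density p /\ density q /\ smooth Phi /\
  (forall x, posdef (hess Phi x)) /\
  diffeo (grad Phi) /\
  (forall x, p (grad Phi x) * \det (hess Phi x) = q x) /\
  integrable (fun x => q x * lap Phi x) /\
  integrable (fun x => q x * ln (\det (hess Phi x))).

(* transport KL divergence D_TKL(p || q), computed from the potential Phi = Phi_p *)
Definition DTKL d (q : 'rV[R]_d -> R) (Phi : 'rV[R]_d -> R) : R :=
  integral_Rd (fun x => (lap Phi x - ln (\det (hess Phi x)) - d%:R) * q x).

Definition compact_support d (f : 'rV[R]_d -> R) : Prop :=
  exists M : R, forall x, M < `|x| -> f x = 0.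

End TKL.

(* Main.v *)
Require Import Defs.
From HB Require Import structures.
From mathcomp Require Import all_boot all_order all_algebra.
From mathcomp Require Import all_classical all_reals all_analysis.
From mathcomp Require Import measurable_realfun ring lra.
Set Implicit Arguments.
Unset Strict Implicit.
Unset Printing Implicit Defensive.
Import Order.TTheory GRing.Theory Num.Theory.
Import numFieldNormedType.Exports.
Local Open Scope classical_set_scope.
Local Open Scope ring_scope.

(** For a symmetric positive definite [A], [ln (\det A) <= \tr A - d] with
equality only at the identity (by induction on the dimension, splitting off
a Schur complement), so the integrand of [DTKL] is nonnegative and [DTKL]
vanishes exactly when [grad Phi] is a translation. The gradient of an
admissible potential is determined by [p] and [q]; this allows a translation,
or the sum of potentials of two factors, to be compared with an arbitrary
potential. Convexity is the concavity of [ln \det]. For small [e] the map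
[id + e grad Phi] is strongly monotone, hence a diffeomorphism to which the
change of variables formula applies, and
[\tr B - ln (\det (1 + B)) = \tr (B B) / 2 + O(|B|^3)] at [B = e hess Phi]
gives the second-order expansion.

Integrals over R^d being iterated one-dimensional ones, the change of
variables is done one coordinate at a time: a strongly monotone map is solved
for its first coordinate, and what remains is a strongly monotone map in one
dimension less whose Jacobian is the Schur complement. *)

(** * Positive definite matrices *)

(** Admissibility gives a positive definite Hessian at each point but no uniform lower bound, so an
    admissible Brenier map is not strongly monotone in general and the change of variables does not
    apply to it directly. Regularising by [e id] and passing to the limit leaves an inequality;
    since [p] and [q] both have mass 1, it becomes an equality for test functions with values in
    [[0, 1]], which is all that uniqueness of the gradient requires. Strong monotonicity suits the
    induction on the dimension: solving for one coordinate preserves it with the same constant, and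
    it makes inverses continuous, so that no local inversion theorem is called upon. [DTKL] takes
    [fine] of extended integrals, under which an infinite integral would read as 0. Estimates are
    therefore made in [\bar R], on nonnegative continuous integrands, and only then brought back to
    real numbers. *)

Section PositiveDefinite.
Context {R : realType}.

Definition dotv d (u v : 'rV[R]_d) : R := (u *m v^T) 0 0.

Lemma dotvE d (u v : 'rV[R]_d) : dotv u v = \sum_i u 0 i * v 0 i.
Proof. by rewrite /dotv mxE; apply: eq_bigr => i _; rewrite mxE. Qed.

Definition schur d (H : 'M[R]_(1 + d)) : 'M[R]_d :=
  drsubmx H - (H 0 0)^-1 *: (dlsubmx H *m ursubmx H).

Lemma ulsubmx_scalar d (H : 'M[R]_(1 + d)) : ulsubmx H = (H 0 0)%:M.
Proof.
apply/matrixP => i j; rewrite !ord1 !mxE eqxx mulr1n.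
by congr (H _ _); apply/val_inj.
Qed.

(** One step of Gaussian elimination: a unipotent lower triangular factor clears the first column
    below the pivot [H 0 0]. *)
Lemma block_schur d (H : 'M[R]_(1 + d)) : H 0 0 != 0 ->
  block_mx 1%:M 0 (- (H 0 0)^-1 *: dlsubmx H) 1%:M *m H =
  block_mx (H 0 0)%:M (ursubmx H) 0 (schur H).
Proof.
move=> h0; rewrite -[in X in _ *m X](submxK H) mulmx_block.
rewrite !mul1mx !mul0mx !addr0 ulsubmx_scalar mul_mx_scalar scalerA mulrN.
rewrite divff// scaleN1r addNr; congr block_mx.
by rewrite -scalemxAl scaleNr addrC.
Qed.

Lemma det_schur d (H : 'M[R]_(1 + d)) : H 0 0 != 0 ->
  \det H = H 0 0 * \det (schur H).
Proof.
move=> h0; have := congr1 determinant (block_schur h0).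
by rewrite det_mulmx det_lblock !det1 !mul1r det_ublock det_scalar1.
Qed.

(** The added first entry is the one that makes the first coordinate of the product vanish. This
    yields test vectors for quadratic forms, and later the derivative of a map solved for its first
    coordinate. *)
Lemma mulmx_schur m d (H : 'M[R]_(1 + d)) (l : 'M[R]_(m, d)) : H 0 0 != 0 ->
  row_mx (- (H 0 0)^-1 *: (l *m dlsubmx H)) l *m H = row_mx 0 (l *m schur H).
Proof.
move=> h0.
have -> : row_mx (- (H 0 0)^-1 *: (l *m dlsubmx H)) l =
   row_mx 0 l *m block_mx 1%:M 0 (- (H 0 0)^-1 *: dlsubmx H) 1%:M.
  by rewrite mul_row_block !mul0mx !add0r mulmx1 scalemxAr.
by rewrite -mulmxA block_schur// mul_row_block !mul0mx mulmx0 !add0r.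
Qed.

Lemma posdef00 d (H : 'M[R]_(1 + d)) : posdef H -> 0 < H 0 0.
Proof.
move=> /(_ (delta_mx 0 0)); rewrite -rowE trmx_delta -colE !mxE; apply.
by apply/eqP => /matrixP/(_ 0 0); rewrite !mxE !eqxx/= => /eqP; rewrite oner_eq0.
Qed.

(** On the extension of [v] given by [mulmx_schur], the form of [H] takes the value of the form of
    [schur H] at [v]. *)
Lemma posdef_schur d (H : 'M[R]_(1 + d)) : posdef H -> posdef (schur H).
Proof.
move=> pH v v0; have h0 := posdef00 pH.
have := pH (row_mx (- (H 0 0)^-1 *: (v *m dlsubmx H)) v).
rewrite mulmx_schur ?gt_eqF// tr_row_mx mul_row_col mul0mx add0r; apply.
by apply: contra v0 => /eqP/(congr1 rsubmx); rewrite row_mxKr linear0 => ->.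
Qed.

Lemma posdef_det_gt0 d (H : 'M[R]_d) : posdef H -> 0 < \det H.
Proof.
elim: d H => [H _|d IH H pH]; first by rewrite det_mx00.
have h0 := posdef00 pH.
by rewrite (@det_schur d H) ?gt_eqF// mulr_gt0// IH//; exact: posdef_schur.
Qed.

Lemma ln_le_subr1 (x : R) : 0 < x -> ln x <= x - 1.
Proof. by move=> x0; rewrite -[in leLHS](subrK 1 x) addrC le_ln1Dx// ltrBrDl subrr. Qed.

(** With [y] the square root of [x], the hypothesis reads [2 ln y = y^2 - 1], while [ln y <= y - 1];
    hence [(y - 1)^2 <= 0]. The inequality taken at the square root gives its own equality case. *)
Lemma ln_eq_subr1 (x : R) : 0 < x -> ln x = x - 1 -> x = 1.
Proof.
move=> x0 lx; have := ln_le_subr1 x0.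
pose y := Num.sqrt x; have y0 : 0 < y by rewrite sqrtr_gt0.
have xE : x = y * y by rewrite -expr2 sqr_sqrtr// ltW.
move=> _; have := ln_le_subr1 y0; move: lx; rewrite xE lnM// => lx ly.
have y1 : (y - 1) ^+ 2 <= 0 by rewrite expr2; nra.
have /eqP : (y - 1) ^+ 2 == 0 by rewrite eq_le y1 sqr_ge0.
by move/eqP; rewrite sqrf_eq0 subr_eq0 => /eqP ->; rewrite mulr1.
Qed.

Lemma mulmx_tr_ge0 d (v : 'rV[R]_d) : 0 <= (v *m v^T) 0 0.
Proof.
rewrite mxE; apply: sumr_ge0 => i _; rewrite mxE -expr2; exact: sqr_ge0.
Qed.

Lemma mulmx_tr_eq0 d (v : 'rV[R]_d) : (v *m v^T) 0 0 = 0 -> v = 0.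
Proof.
rewrite mxE => /eqP; rewrite psumr_eq0; last first.
  by move=> i _; rewrite mxE -expr2 sqr_ge0.
move=> /allP h; apply/rowP => i; rewrite mxE.
by have := h i (mem_index_enum _); rewrite mxE -expr2 sqrf_eq0 => /eqP.
Qed.

Lemma mulmx_tr_gt0 d (v : 'rV[R]_d) : v != 0 -> 0 < (v *m v^T) 0 0.
Proof.
move=> v0; rewrite lt_neqAle mulmx_tr_ge0 andbT; apply: contra v0 => /eqP h.
by rewrite (mulmx_tr_eq0 (esym h)).
Qed.

Lemma sym_dlsubmx d (H : 'M[R]_(1 + d)) : H^T = H -> dlsubmx H = (ursubmx H)^T.
Proof. by move=> HT; rewrite trmx_ursub HT. Qed.

Lemma sym_schur d (H : 'M[R]_(1 + d)) : H^T = H -> (schur H)^T = schur H.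
Proof.
move=> HT; rewrite /schur linearB linearZ /= trmx_mul trmx_drsub HT.
by rewrite (sym_dlsubmx HT) trmxK.
Qed.

Lemma mxtrace_schur d (H : 'M[R]_(1 + d)) : H^T = H ->
  \tr H = H 0 0 + \tr (schur H) +
          (H 0 0)^-1 * (ursubmx H *m (ursubmx H)^T) 0 0.
Proof.
move=> HT; rewrite -{1}(submxK H) mxtrace_block ulsubmx_scalar mxtrace_scalar.
rewrite /schur linearB linearZ/= mulr1n sym_dlsubmx// mxtrace_mulC trace_mx11.
by rewrite addrA subrK.
Qed.

(** With pivot [a] and off-diagonal row [u], [tr A - d - ln det A] is the sum of [a - 1 - ln a], of
    the same quantity for the Schur complement, and of [|u|^2 / a]. All three are nonnegative; in
    the equality case the last one forces [u = 0], so that the Schur complement is the lower right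
    block itself. *)
Lemma mxtrace_ln_det d (A : 'M[R]_d) : A^T = A -> posdef A ->
  ln (\det A) <= \tr A - d%:R /\ (\tr A - d%:R = ln (\det A) -> A = 1%:M).
Proof.
elim: d A => [A _ _|d IH]; [|rewrite -[d.+1]/(1 + d)%N => A AT pA].
  rewrite det_mx00 ln1 /mxtrace big_ord0 subrr; split => // _.
  by apply/matrixP => -[].
have a0 := posdef00 pA; have pS := posdef_schur pA.
have [h1 h2] := IH _ (sym_schur AT) pS.
have la := ln_le_subr1 a0.
have ab0 : 0 <= (A 0 0)^-1 * (ursubmx A *m (ursubmx A)^T) 0 0.
  by rewrite mulr_ge0 ?mulmx_tr_ge0// invr_ge0 ltW.
rewrite det_schur ?gt_eqF// lnM ?posrE ?posdef_det_gt0//.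
rewrite mxtrace_schur// natrD.
split; first by lra.
move=> e.
have e1 : ln (A 0 0) = A 0 0 - 1 by lra.
have e2 : \tr (schur A) - d%:R = ln (\det (schur A)) by lra.
have e3 : (A 0 0)^-1 * (ursubmx A *m (ursubmx A)^T) 0 0 = 0 by lra.
have a1 := ln_eq_subr1 a0 e1.
have /mulmx_tr_eq0 u0 : (ursubmx A *m (ursubmx A)^T) 0 0 = 0.
  by move: e3; rewrite a1 invr1 mul1r.
have := h2 e2; rewrite /schur u0 mulmx0 scaler0 subr0 => d1.
rewrite -[LHS]submxK ulsubmx_scalar a1 u0 d1 (sym_dlsubmx AT) u0 trmx0.
by rewrite -scalar_mx_block.
Qed.

Lemma posdef_congr d (A P : 'M[R]_d) : posdef A -> P \in unitmx ->
  posdef (P *m A *m P^T).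
Proof.
move=> pA uP v v0; have := pA (v *m P).
rewrite trmx_mul !mulmxA; apply; apply: contra v0 => /eqP h.
by rewrite -(mulmxK uP v) h mul0mx.
Qed.

Lemma cholesky d (A : 'M[R]_d) : A^T = A -> posdef A ->
  exists2 P : 'M[R]_d, P \in unitmx & P *m A *m P^T = 1%:M.
Proof.
elim: d A => [A _ _|d IH]; [|rewrite -[d.+1]/(1 + d)%N => A AT pA].
  by exists 1%:M; [exact: unitmx1|apply/matrixP => -[]].
have a0 := posdef00 pA; have pS := posdef_schur pA.
have an0 : A 0 0 != 0 by rewrite gt_eqF.
have [P uP PE] := IH _ (sym_schur AT) pS.
(* [L] clears the first row and column of [A]; [Q] then normalises the pivot by its square root and
   the Schur complement by the induction hypothesis. *)
pose L : 'M[R]_(1 + d) := block_mx 1%:M 0 (- (A 0 0)^-1 *: dlsubmx A) 1%:M.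
have LE : L *m A *m L^T = block_mx (A 0 0)%:M 0 0 (schur A).
  rewrite block_schur// tr_block_mx !trmx1 trmx0 linearZ/= mulmx_block.
  rewrite !mulmx0 !mulmx1 !mul0mx !addr0 !add0r; congr block_mx.
  rewrite -scalemxAr mul_scalar_mx scalerA mulNr mulVf// scaleN1r.
  by rewrite (sym_dlsubmx AT) trmxK addNr.
pose Q : 'M[R]_(1 + d) := block_mx (Num.sqrt (A 0 0))^-1%:M 0 0 P.
exists (Q *m L).
  rewrite unitmx_mul /Q /L !unitmxE !det_lblock !det1 mulr1 unitr1 andbT.
  rewrite unitrM -!unitmxE uP andbT unitmxE det_scalar1 unitrV unitfE.
  by rewrite gt_eqF// sqrtr_gt0.
rewrite trmx_mul !mulmxA -(mulmxA Q) -(mulmxA Q) LE.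
rewrite /Q tr_block_mx !mulmx_block !trmx0 tr_scalar_mx.
rewrite !(mulmx0,mul0mx,addr0,add0r) PE [RHS](@scalar_mx_block _ 1 d).
congr block_mx; rewrite -!scalar_mxM; congr (_%:M).
have s0 : Num.sqrt (A 0 0) != 0 by rewrite gt_eqF// sqrtr_gt0.
by rewrite -[X in _ * X * _]sqr_sqrtr ?ltW// expr2 mulrA mulVf// mul1r divff.
Qed.

(** A congruence turns the combination [C] into the identity, where [tr M - d] bounds [ln det M]
    from above. The weighted traces of the two transformed matrices add up to exactly [d], so the
    weighted sum of [ln det A - ln det C] and [ln det B - ln det C] is at most 0. *)
Lemma ln_det_concave d (A B : 'M[R]_d) (l : R) : A^T = A -> B^T = B ->
  posdef A -> posdef B -> 0 <= l <= 1 -> posdef (l *: A + (1 - l) *: B) ->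
  l * ln (\det A) + (1 - l) * ln (\det B) <= ln (\det (l *: A + (1 - l) *: B)).
Proof.
move=> AT BT pA pB /andP[l0 l1] pC; set C := l *: A + (1 - l) *: B.
have CT : C^T = C by rewrite /C linearD !linearZ/= AT BT.
have [P uP PE] := cholesky CT pC.
have h M : M^T = M -> posdef M -> ln (\det M) - ln (\det C) <= \tr (P *m M *m P^T) - d%:R.
  move=> MT pM.
  have ST : (P *m M *m P^T)^T = P *m M *m P^T by rewrite !trmx_mul trmxK MT mulmxA.
  have [+ _] := mxtrace_ln_det ST (posdef_congr pM uP).
  apply: le_trans.
  have := congr1 determinant PE; rewrite !det_mulmx det_tr det1 => dP.
  have dC : 0 < \det C := posdef_det_gt0 pC; have dM := posdef_det_gt0 pM.
  have -> : \det P * \det M * \det P = \det M * (\det C)^-1.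
    apply: (mulIf (lt0r_neq0 dC)); rewrite mulfVK ?gt_eqF//.
    by transitivity (\det M * (\det P * \det C * \det P)); [ring|rewrite dP mulr1].
  by rewrite lnM ?posrE ?invr_gt0// lnV ?posrE.
have hA := h _ AT pA; have hB := h _ BT pB.
have tr1 : l * \tr (P *m A *m P^T) + (1 - l) * \tr (P *m B *m P^T) = d%:R.
  rewrite -!mxtraceZ -mxtraceD -[RHS](mxtrace1 R d) -PE; congr (\tr _).
  by rewrite /C mulmxDr mulmxDl -!scalemxAr -!scalemxAl.
have l1' : 0 <= 1 - l by rewrite subr_ge0.
by have := ler_wpM2l l0 hA; have := ler_wpM2l l1' hB; nra.
Qed.

(** * Second-order expansion of [ln det] at the identity, with cubic remainder *)

Lemma MVT01 (f df : R -> R) :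
  (forall t : R, 0 <= t <= 1 -> is_derive t (1 : R) f (df t)) ->
  exists2 c, 0 < c < 1 & f 1 - f 0 = df c.
Proof.
move=> dfE.
have h1 (x : R) : x \in `]0, 1[%R -> is_derive x (1 : R) f (df x).
  by rewrite in_itv/= => /andP[x0 x1]; apply: dfE; rewrite !ltW.
have h2 : {within `[0, 1], continuous f}.
  apply: derivable_within_continuous => x; rewrite in_itv/= => x01.
  by have [] := dfE _ x01.
have [c c01 h] := MVT ltr01 h1 h2.
by exists c; [move: c01; rewrite in_itv|rewrite h subr0 mulr1].
Qed.

(** Mean value theorem for the remainder along [t b]: its derivative simplifies to
    [- b^3 t^2 / (1 + t b)], whose denominator is at least 1/2. *)
Lemma ln1D_expand (b : R) : `|b| <= 1 / 2 ->
  `|b - ln (1 + b) - b ^+ 2 / 2| <= 2 * `|b| ^+ 3.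
Proof.
move=> b2.
pose g := fun t : R => t * b - ln (1 + t * b) - (t * b) ^+ 2 / 2.
pose dg := fun t : R => b - b * (1 + t * b)^-1 - b ^+ 2 * t.
have tb (t : R) : 0 <= t <= 1 -> `|t * b| <= 1 / 2 /\ 1 / 2 <= 1 + t * b.
  move=> /andP[t0 t1]; have h : `|t * b| <= 1 / 2.
    by rewrite normrM (ger0_norm t0); apply: le_trans b2; exact: ler_piMl.
  by split=> //; move: h; rewrite ler_norml; lra.
have dgE (t : R) : 0 <= t <= 1 -> is_derive t (1 : R) g (dg t).
  move=> /tb[_ h].
  have t0 : 0 < 1 + t * b by lra.
  have d1 : is_derive t (1 : R) (fun s : R => s * b) b.
    by apply: is_derive_eq; rewrite scaler0 add0r scaler1.
  have d2 : is_derive t (1 : R) (fun s : R => ln (1 + s * b)) ((1 + t * b)^-1 * b).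
    apply: (@is_derive1_comp R (@ln R) (fun s => 1 + s * b)).
      exact: is_derive1_ln.
    by have := is_deriveD (is_derive_cst (1 : R) t (1 : R)) d1; rewrite add0r.
  have := is_deriveB (is_deriveB d1 d2) (is_deriveZ (2^-1 : R) (is_deriveM d1 d1)).
  set F := (X in is_derive _ _ X _ -> _); set D := (X in is_derive _ _ _ X -> _).
  have -> : F = g.
    by apply/funext => s; rewrite /g -[LHS]/(s * b - ln (1 + s * b) - 2^-1 * ((s * b) * (s * b))); field.
  have -> // : D = dg t.
  by rewrite /D /dg /GRing.scale/=; field; rewrite gt_eqF.
have [c /andP[c0 c1]] := MVT01 dgE.
have c01 : 0 <= c <= 1 by rewrite !ltW.
have [h1 h2] := tb _ c01.
rewrite /g !mul1r !mul0r addr0 ln1 expr0n/= mul0r !subr0 => ->.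
have cb0 : 1 + c * b != 0 by rewrite gt_eqF//; lra.
have -> : dg c = - (b ^+ 3 * c ^+ 2 / (1 + c * b)) by rewrite /dg; field.
rewrite normrN normrM normfV normrM !normrX (ger0_norm (ltW c0)).
rewrite (@ger0_norm _ (1 + c * b)); last lra.
rewrite ler_pdivrMr; last lra.
have : 0 <= `|b| ^+ 3 by rewrite exprn_ge0.
have : c ^+ 2 <= 1 by rewrite exprn_ile1// ltW.
by nra.
Qed.

Lemma normr_sum_le n (F : 'I_n -> R) (M : R) :
  (forall i, `|F i| <= M) -> `|\sum_i F i| <= n%:R * M.
Proof.
move=> h; apply: le_trans (ler_norm_sum _ _ _) _.
apply: le_trans (ler_sum _ (fun i _ => h i)) _.
by rewrite sumr_const card_ord mulr_natl.
Qed.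

Lemma mulmx_entries_le m n p (A : 'M[R]_(m, n)) (B : 'M[R]_(n, p)) (a b : R) :
  (forall i j, `|A i j| <= a) -> (forall i j, `|B i j| <= b) ->
  forall i j, `|(A *m B) i j| <= n%:R * (a * b).
Proof.
move=> hA hB i j; rewrite mxE; apply: normr_sum_le => k.
by rewrite normrM ler_pM.
Qed.

Lemma mxtrace_entries_le d (B : 'M[R]_d) (b : R) :
  (forall i j, `|B i j| <= b) -> `|\tr B| <= d%:R * b.
Proof. by move=> h; apply: normr_sum_le => i; apply: h. Qed.

Lemma mxtrace_sqr_block d (B : 'M[R]_(1 + d)) : B^T = B ->
  \tr (B *m B) = (B 0 0) ^+ 2 + 2 * (ursubmx B *m (ursubmx B)^T) 0 0 +
    \tr (drsubmx B *m drsubmx B).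
Proof.
move=> BT; rewrite -{1 2}(submxK B) mulmx_block mxtrace_block !mxtraceD.
rewrite ulsubmx_scalar (sym_dlsubmx BT) (mxtrace_mulC _^T).
rewrite -scalar_mxM mxtrace_scalar mulr1n trace_mx11; ring.
Qed.

Lemma schur1D d (B : 'M[R]_(1 + d)) : B^T = B ->
  schur (1%:M + B) =
  1%:M + (drsubmx B - (1 + B 0 0)^-1 *: ((ursubmx B)^T *m ursubmx B)).
Proof.
move=> BT; rewrite /schur !mxE eqxx/= scalar_mx_block -{1 3 4}(submxK B).
rewrite add_block_mx block_mxKdr block_mxKdl block_mxKur !add0r -addrA.
by rewrite (sym_dlsubmx BT).
Qed.

Lemma mxtrace_sqr_subZ d (D W : 'M[R]_d) (s : R) :
  \tr ((D - s *: W) *m (D - s *: W)) =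
  \tr (D *m D) - 2 * s * \tr (D *m W) + s ^+ 2 * \tr (W *m W).
Proof.
rewrite mulmxBl !mulmxBr -!scalemxAl -!scalemxAr !raddfB/= !mxtraceZ.
by rewrite (mxtrace_mulC W D); ring.
Qed.

(** With [v] the off-diagonal row and [D] the lower block, [schur (1 + B) = 1 + E] for
    [E = D - s v^T v] and [s = 1 / (1 + B 0 0)], and the induction hypothesis applies to [E]. Up to
    third order, the [|v|^2] lost in the trace of [E] is the off-diagonal contribution to
    [tr (B B) / 2]. *)
Lemma mxtrace_ln_det_expand d : exists C b0 : R, [/\ 0 <= C, 0 < b0 &
  forall (B : 'M[R]_d) (b : R), B^T = B -> (forall i j, `|B i j| <= b) -> 0 <= b <= b0 ->
  0 < \det (1%:M + B) /\
  `|\tr B - ln (\det (1%:M + B)) - \tr (B *m B) / 2| <= C * b ^+ 3].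
Proof.
elim: d => [|d [C [b0 [C0 b00 IH]]]].
  exists 0, 1; split=> // B b _ _ _; rewrite det_mx00 ltr01; split=> //.
  by rewrite /mxtrace !big_ord0 ln1 mul0r !subr0 normr0 mul0r.
rewrite -[d.+1]/(1 + d)%N.
(* The bound 1/4 keeps the pivot away from 0 and [s] below 2; [b0 / 2] is there because the entries
   of [E] are only bounded by [2 b]. *)
pose m := Num.min (1 / 4) (b0 / 2) : R.
have m0 : 0 < m by rewrite lt_min; apply/andP; split; lra.
have d0 : (0 : R) <= d%:R by [].
(* The 2 comes from [ln1D_expand], [8 C] from the induction hypothesis at [2 b], and the terms in
   [d] dominate the cross terms in [v] and [D]. *)
exists (2 + 8 * C + 8 * (d%:R) ^+ 2 + 2 * d%:R), m; split=> //.
  by have := mulr_ge0 d0 d0; rewrite -expr2; lra.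
move=> B b BT Bb /andP[bge0 bm].
have [b4 b2] : b <= 1 / 4 /\ b <= b0 / 2.
  by move: bm; rewrite le_min => /andP[].
set a := B 0 0; have ab : `|a| <= b by exact: Bb.
have a4 : `|a| <= 1 / 4 by apply: le_trans b4.
have a1 : 3 / 4 <= 1 + a by move: a4; rewrite ler_norml; lra.
have a10 : 1 + a != 0 by rewrite gt_eqF//; lra.
set s := (1 + a)^-1.
have s0 : 0 < s by rewrite invr_gt0; lra.
have s2 : s <= 2 by rewrite /s -[leRHS]invrK lef_pV2 ?posrE; lra.
set v := ursubmx B; set D := drsubmx B.
have vb i j : `|v i j| <= b by rewrite /v !mxE.
have vTb i j : `|v^T i j| <= b by rewrite mxE.
have Db i j : `|D i j| <= b by rewrite /D !mxE.
have DT : D^T = D by rewrite /D trmx_drsub BT.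
set W := v^T *m v.
have WT : W^T = W by rewrite /W trmx_mul trmxK.
have Wb i j : `|W i j| <= b ^+ 2.
  by apply: le_trans (mulmx_entries_le vTb vb i j) _; rewrite mul1r expr2.
have bb : b ^+ 2 <= b / 4 by rewrite expr2; nra.
have b20 : 0 <= b ^+ 2 by rewrite sqr_ge0.
set E := D - s *: W.
have ET : E^T = E by rewrite /E linearB linearZ/= WT DT.
have Eb i j : `|E i j| <= 2 * b.
  have -> (X Y : 'M[R]_d) : (X - s *: Y) i j = X i j - s * Y i j by rewrite !mxE.
  apply: le_trans (ler_normB _ _) _; rewrite normrM (gtr0_norm s0).
  have h : s * `|W i j| <= 2 * b ^+ 2 by rewrite ler_pM// ltW.
  by have := Db i j; lra.
have [|dE hE] := IH E (2 * b) ET Eb.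
  by rewrite mulr_ge0//=; lra.
have A00 : (1%:M + B) 0 0 = 1 + a by rewrite !mxE eqxx.
have dB : \det (1%:M + B) = (1 + a) * \det (1%:M + E).
  by rewrite det_schur A00// (schur1D BT).
have a1p : 0 < 1 + a by lra.
split; first by rewrite dB mulr_gt0.
have trB : \tr B = a + \tr D.
  by rewrite -{1}(submxK B) mxtrace_block ulsubmx_scalar mxtrace_scalar mulr1n.
set q := (v *m v^T) 0 0.
have q0 : 0 <= q by exact: mulmx_tr_ge0.
have qb : q <= d%:R * b ^+ 2.
  by have := mulmx_entries_le vb vTb 0 0; rewrite -/q ger0_norm// expr2.
have trW : \tr W = q by rewrite /W mxtrace_mulC trace_mx11.
have trE : \tr E = \tr D - s * q by rewrite /E linearB linearZ/= trW.
have trDW : `|\tr (D *m W)| <= d%:R ^+ 2 * b ^+ 3.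
  have := mxtrace_entries_le (mulmx_entries_le Db Wb).
  by rewrite mulrA -expr2 -exprS.
have trWW : `|\tr (W *m W)| <= d%:R ^+ 2 * b ^+ 4.
  have := mxtrace_entries_le (mulmx_entries_le Wb Wb).
  by rewrite mulrA -expr2 -exprD.
have trEE : \tr (E *m E) = \tr (D *m D) - 2 * s * \tr (D *m W) + s ^+ 2 * \tr (W *m W).
  exact: mxtrace_sqr_subZ.
rewrite (mxtrace_sqr_block BT) -/v -/D -/q -/a dB lnM ?posrE// trB.
have ha := ln1D_expand (le_trans a4 _).
have {}ha : `|a - ln (1 + a) - a ^+ 2 / 2| <= 2 * b ^+ 3.
  apply: le_trans (ha _) _; first lra.
  by rewrite ler_pM2l// lerXn2r ?nnegrE.
set L := ln _ in ha *; set M := ln _ in hE *.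
(* Remainder of the pivot, remainder of [E], and a leftover that is of third order because
   [|s - 1| <= 2 b]. *)
have -> : a + \tr D - (L + M) - (a ^+ 2 + 2 * q + \tr (D *m D)) / 2 =
  (a - L - a ^+ 2 / 2) + (\tr E - M - \tr (E *m E) / 2) +
  ((s - 1) * q - s * \tr (D *m W) + s ^+ 2 / 2 * \tr (W *m W)).
  by rewrite trE trEE; field.
have hs : `|s - 1| <= 2 * b.
  have -> : s - 1 = - (s * a) by rewrite /s; field.
  by rewrite normrN normrM (gtr0_norm s0) ler_pM// ltW.
apply: le_trans (ler_normD _ _) _; apply: le_trans (lerD (ler_normD _ _) (ler_normD _ _)) _.
have h1 : `|(s - 1) * q - s * \tr (D *m W)| <= 2 * d%:R * b ^+ 3 + 2 * (d%:R ^+ 2 * b ^+ 3).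
  apply: le_trans (ler_normB _ _) _; apply: lerD.
    rewrite normrM (ger0_norm q0); apply: le_trans (ler_pM _ _ hs qb) _ => //.
    by rewrite le_eqVlt; apply/orP; left; apply/eqP; ring.
  by rewrite normrM (gtr0_norm s0) ler_pM// ltW.
have h2 : `|s ^+ 2 / 2 * \tr (W *m W)| <= 2 * (d%:R ^+ 2 * b ^+ 3).
  rewrite normrM ger0_norm; last by rewrite divr_ge0// sqr_ge0.
  apply: ler_pM => //; first by rewrite divr_ge0// sqr_ge0.
    by rewrite expr2; nra.
  apply: le_trans trWW _; rewrite ler_wpM2l ?sqr_ge0//.
  by rewrite exprSr -[leRHS]mulr1 ler_wpM2l ?exprn_ge0//; lra.
have hE' : (2 * b) ^+ 3 = 8 * b ^+ 3 by ring.
rewrite hE' in hE.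
have := mulr_ge0 (sqr_ge0 (d%:R : R)) (exprn_ge0 3 bge0).
by nra.
Qed.

End PositiveDefinite.

(** * Iterated integrals *)

Section IteratedIntegral.
Context {R : realType}.
Notation mu := (@lebesgue_measure R).

(** Written exactly as the argument inside [iint], so that [iintS] holds by conversion. *)
Definition consrV d (t : R) (y : 'rV[R]_d) : 'rV[R]_(1 + d) :=
  row_mx (\row_(_ < 1) t) y.

Lemma consrV0 d (t : R) (y : 'rV[R]_d) : consrV t y 0 0 = t.
Proof.
have -> : (0 : 'I_(1 + d)) = lshift d 0 by apply/val_inj.
by rewrite /consrV row_mxEl mxE.
Qed.

Lemma consrVl d (t : R) (y : 'rV[R]_d) j : consrV t y 0 (lshift d j) = t.
Proof. by rewrite /consrV row_mxEl mxE. Qed.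

Lemma consrVS d (t : R) (y : 'rV[R]_d) i : consrV t y 0 (rshift 1 i) = y 0 i.
Proof. by rewrite /consrV row_mxEr. Qed.

Lemma rsubmx_consrV d (t : R) (y : 'rV[R]_d) : rsubmx (consrV t y) = y.
Proof. by rewrite /consrV row_mxKr. Qed.

Lemma consrV_eta d (z : 'rV[R]_(1 + d)) : consrV (z 0 0) (rsubmx z) = z.
Proof.
rewrite -[RHS]hsubmxK /consrV; congr row_mx.
by apply/matrixP => i j; rewrite !ord1 !mxE; congr (z _ _); apply/val_inj.
Qed.

Lemma iintS d (f : 'rV[R]_(1 + d) -> \bar R) :
  iint f = (\int[mu]_t iint (fun y => f (consrV t y)))%E.
Proof. by []. Qed.

(* Measurability of functions on ['rV[R]_d], tested by composition with maps
   whose coordinates are measurable: no sigma-algebra on ['rV[R]_d] is needed. *)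
Definition pmeas dP (P : measurableType dP) d (f : P -> 'rV[R]_d -> \bar R) :=
  forall (dT : measure_display) (T : measurableType dT) (p : T -> P) (c : T -> 'rV[R]_d),
    measurable_fun [set: T] p ->
    (forall i, measurable_fun [set: T] (fun t => c t 0 i)) ->
    measurable_fun [set: T] (fun t => f (p t) (c t) : \bar R).

Definition mrV d (f : 'rV[R]_d -> \bar R) :=
  forall (dT : measure_display) (T : measurableType dT) (c : T -> 'rV[R]_d),
    (forall i, measurable_fun [set: T] (fun t => c t 0 i)) ->
    measurable_fun [set: T] (fun t => f (c t) : \bar R).

Lemma pmeas_slice dP (P : measurableType dP) d (f : P -> 'rV[R]_d -> \bar R) :
  pmeas f -> forall p, mrV (f p).
Proof. by move=> mf p dT T c mc; apply: mf => //; exact: measurable_cst. Qed.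

Lemma measurable_consrV dT (T : measurableType dT) d (u : T -> R) (c : T -> 'rV[R]_d) :
  measurable_fun [set: T] u -> (forall i, measurable_fun [set: T] (fun t => c t 0 i)) ->
  forall i, measurable_fun [set: T] (fun t => consrV (u t) (c t) 0 i).
Proof.
move=> mu_ mc i; case: (split_ordP i) => j ->.
  rewrite (_ : (fun t => _) = u)//; apply/funext => t.
  by rewrite /consrV row_mxEl mxE.
rewrite (_ : (fun t => _) = fun t => c t 0 j)//; apply/funext => t.
by rewrite consrVS.
Qed.

Lemma mrV_pmeas d (f : 'rV[R]_(1 + d) -> \bar R) :
  mrV f -> pmeas (fun t : R => fun y => f (consrV t y)).
Proof. by move=> mf dT T p c mp mc; apply: mf; exact: measurable_consrV. Qed.

Lemma iint_ge0 d (f : 'rV[R]_d -> \bar R) :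
  (forall x, 0 <= f x)%E -> (0 <= iint f)%E.
Proof. by elim: d f => [|d IH] f f0 //=; apply: integral_ge0 => t _; apply: IH. Qed.

(** The parameter space makes the induction go through: the coordinate being integrated is moved
    into it, and Tonelli on the product of [P] with the line gives measurability in the remaining
    parameter. *)
Lemma measurable_iint dP (P : measurableType dP) d (f : P -> 'rV[R]_d -> \bar R) :
  (forall p x, 0 <= f p x)%E -> pmeas f ->
  measurable_fun [set: P] (fun p => iint (f p) : \bar R).
Proof.
elim: d dP P f => [|d IH] dP P f f0 mf /=.
  by apply: (mf _ P id (fun=> 0)) => // i; exact: measurable_cst.
have := @measurable_fun_fubini_tonelli_F _ _ P (measurableTypeR R) R mu
  (fun q => iint (fun y : 'rV_d => f q.1 (consrV q.2 y))).
apply; last by move=> q; exact: iint_ge0.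
apply: IH => [//|dT T q c mq mc].
have [m1 m2] := (measurable_fun_pairP q).1 mq.
by apply: mf => //; apply: measurable_consrV.
Qed.

Lemma measurable_iint_cons d (f : 'rV[R]_(1 + d) -> \bar R) :
  (forall x, 0 <= f x)%E -> mrV f ->
  measurable_fun [set: R] (fun t => iint (fun y => f (consrV t y)) : \bar R).
Proof. by move=> f0 mf; apply: measurable_iint => //; exact: mrV_pmeas. Qed.

Lemma mrV_cons d (f : 'rV[R]_(1 + d) -> \bar R) t :
  mrV f -> mrV (fun y => f (consrV t y)).
Proof. by move=> mf; exact: (pmeas_slice (mrV_pmeas mf) t). Qed.

Lemma le_iint d (f g : 'rV[R]_d -> \bar R) : mrV f -> mrV g ->
  (forall x, 0 <= f x)%E -> (forall x, f x <= g x)%E -> (iint f <= iint g)%E.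
Proof.
elim: d f g => [|d IH] f g mf mg f0 fg //=.
have g0 x : (0 <= g x)%E by exact: le_trans (fg x).
apply: ge0_le_integral => //.
- by move=> t _; exact: iint_ge0.
- exact: (@measurable_iint_cons d f).
- exact: (@measurable_iint_cons d g).
- by move=> t _; apply: IH => //; [exact: (@mrV_cons d f)|exact: (@mrV_cons d g)].
Qed.

Lemma iintD d (f g : 'rV[R]_d -> \bar R) : mrV f -> mrV g ->
  (forall x, 0 <= f x)%E -> (forall x, 0 <= g x)%E ->
  (iint (fun x => f x + g x) = iint f + iint g)%E.
Proof.
elim: d f g => [|d IH] f g mf mg f0 g0 //=.
rewrite -ge0_integralD//.
- by apply: eq_integral => t _; apply: IH => //; [exact: (@mrV_cons d f)|exact: (@mrV_cons d g)].
- by move=> t _; exact: iint_ge0.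
- exact: (@measurable_iint_cons d f).
- by move=> t _; exact: iint_ge0.
- exact: (@measurable_iint_cons d g).
Qed.

Lemma iintZl d (f : 'rV[R]_d -> \bar R) (k : R) : mrV f ->
  (forall x, 0 <= f x)%E -> 0 <= k ->
  (iint (fun x => k%:E * f x) = k%:E * iint f)%E.
Proof.
elim: d f => [|d IH] f mf f0 k0 //=.
rewrite -ge0_integralZl_EFin//.
- by apply: eq_integral => t _; apply: IH => //; exact: (@mrV_cons d f).
- by move=> t _; exact: iint_ge0.
- exact: (@measurable_iint_cons d f).
Qed.

Lemma measurable_fun_limn_einf dT (T : measurableType dT) (D : set T)
    (f : nat -> T -> \bar R) : (forall n, measurable_fun D (f n)) ->
  measurable_fun D (fun x => limn_einf (f ^~ x) : \bar R).
Proof.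
move=> mf; apply: measurableT_comp; first exact: oppe_measurable.
apply: measurable_fun_limn_esup => n.
by apply: measurableT_comp; [exact: oppe_measurable|exact: mf].
Qed.

Lemma limn_einf_ge0 (u : nat -> \bar R) : (forall n, 0 <= u n)%E ->
  (0 <= limn_einf u)%E.
Proof.
move=> u0; rewrite limn_einf_lim; apply: lime_ge; first exact: is_cvg_einfs.
by apply: nearW => n; apply: le_ereal_inf_tmp => _ [m _ <-].
Qed.

Lemma mrV_limn_einf d (f : nat -> 'rV[R]_d -> \bar R) :
  (forall n, mrV (f n)) -> mrV (fun x => limn_einf (f^~ x)).
Proof.
move=> mf dT T c mc.
apply: (@measurable_fun_limn_einf _ T setT (fun n t => f n (c t))) => n.
exact: mf.
Qed.

(** One-dimensional Fatou in the outer variable; the induction hypothesis handles each slice. *)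
Lemma fatou_iint d (f : nat -> 'rV[R]_d -> \bar R) :
  (forall n, mrV (f n)) -> (forall n x, 0 <= f n x)%E ->
  (iint (fun x => limn_einf (f^~ x)) <= limn_einf (fun n => iint (f n)))%E.
Proof.
elim: d f => [|d IH] f mf f0 //=.
have l0 x : (0 <= limn_einf (f^~ x))%E by apply: limn_einf_ge0.
apply: le_trans (fatou mu _ _ _) => //.
- apply: ge0_le_integral => //.
  + move=> t _; apply: iint_ge0 => y; exact: l0.
  + exact: (@measurable_iint_cons d (fun x => limn_einf (f^~ x)) l0 (mrV_limn_einf mf)).
  + apply: measurable_fun_limn_einf => n; exact: (@measurable_iint_cons d (f n)).
  + move=> t _; apply: (IH (fun n y => f n (consrV t y))) => // n.
    exact: (@mrV_cons d (f n)).
- by move=> n; exact: (@measurable_iint_cons d (f n)).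
- by move=> n t _; exact: iint_ge0.
Qed.

(** Tonelli applied one coordinate at a time. It serves to make the first coordinate the innermost
    one, where one-dimensional substitution applies. *)
Lemma iint_swap d (f : R -> 'rV[R]_d -> \bar R) : pmeas f ->
  (forall t x, 0 <= f t x)%E ->
  (\int[mu]_t iint (f t) = iint (fun y => \int[mu]_t f t y))%E.
Proof.
elim: d f => [|d IH] f mf f0 //=.
rewrite (@fubini_tonelli _ _ (measurableTypeR R) (measurableTypeR R) R mu mu
  (fun q => iint (fun y : 'rV_d => f q.1 (consrV q.2 y)))).
- apply: eq_integral => t _ /=; apply: (IH (fun s y => f s (consrV t y))) => //.
  move=> dT T p c mp mc; by apply: mf => //; apply: measurable_consrV.
- apply: measurable_iint => // dT T p c mp mc.
  have [m1 m2] := (measurable_fun_pairP p).1 mp.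
  by apply: mf => //; apply: measurable_consrV.
- by move=> q; exact: iint_ge0.
Qed.

Lemma ball_rVP d (x y : 'rV[R]_d) (e : R) : 0 < e ->
  ball x e y <-> forall i, `|x 0 i - y 0 i| < e.
Proof.
move=> e0; split=> [[_ h] i|h]; first exact: (h 0 i).
by split=> // i j; rewrite (ord1 i); exact: h.
Qed.

(** An open set is the union of the countably many sup-norm balls with rational centres and radii
    [1 / (n + 1)] that it contains, and membership in such a ball is a condition on each
    coordinate. *)
Lemma measurable_preimage_open d dT (T : measurableType dT) (c : T -> 'rV[R]_d)
    (O : set 'rV[R]_d) : (forall i, measurable_fun [set: T] (fun t => c t 0 i)) ->
  open O -> measurable (c @^-1` O).
Proof.
move=> mc oO.
pose B (k : {ffun 'I_d -> rat} * nat) : set 'rV[R]_d :=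
  ball (\row_i ratr (k.1 i) : 'rV[R]_d) (k.2.+1%:R^-1).
(* Balls not contained in [O] are replaced by the empty set, so that the union runs over all
   indices. *)
pose F k := if `[< B k `<=` O >] then c @^-1` B k else set0.
have -> : c @^-1` O = \bigcup_k F k.
  apply/seteqP; split=> [t Ot|t [k _]]; last first.
    by rewrite /F; case: asboolP => // h; exact: h.
  have /nbhs_ballP[e /= e0 eO] : nbhs (c t) O by exact: open_nbhs_nbhs.
  have [n ne] : exists n : nat, n.+1%:R^-1 < e / 2.
    by exists (Num.truncn (e / 2)^-1); rewrite invf_plt ?posrE ?divr_gt0// truncnS_gt.
  have n0 : 0 < n.+1%:R^-1 :> R by rewrite invr_gt0.
  have /choice[r hr] i : exists r : rat, `|ratr r - c t 0 i| < n.+1%:R^-1.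
    have /rat_in_itvoo[r] : c t 0 i - n.+1%:R^-1 < c t 0 i + n.+1%:R^-1.
      by rewrite ltrD2l; apply: lt_trans n0; rewrite oppr_lt0.
    by rewrite in_itv/= => h; exists r; rewrite distrC ltr_distlC.
  exists ([ffun i => r i], n) => //; rewrite /F.
  have ct : B ([ffun i => r i], n) (c t).
    by apply/ball_rVP => // i; rewrite mxE ffunE.
  case: asboolP => // -[] z Bz; apply: eO.
  apply: (@ball_splitr _ _ (\row_i ratr ([ffun i => r i] i) : 'rV[R]_d)).
    apply: le_ball ct; exact: ltW.
  by apply: le_ball Bz; exact: ltW.
apply: countable_bigcupT_measurable => // k.
rewrite /F; case: asboolP => // _.
have -> : c @^-1` B k = \bigcap_(i in [set: 'I_d])
    ((fun t => c t 0 i) @^-1` (ball (ratr (k.1 i) : R) (k.2.+1%:R^-1))).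
  have k0 : 0 < k.2.+1%:R^-1 :> R by rewrite invr_gt0.
  apply/seteqP; split=> t /=.
    by move=> /(ball_rVP _ _ k0) h i _; have := h i; rewrite mxE.
  by move=> h; apply/(ball_rVP _ _ k0) => i; rewrite mxE; exact: (h i I).
apply: fin_bigcap_measurable => // i _.
rewrite -[X in measurable X]setTI; apply: mc => //; exact: measurable_ball.
Qed.

Lemma continuous_mrV d (f : 'rV[R]_d -> R) : continuous f ->
  mrV (fun x => (f x)%:E).
Proof.
move=> /continuousP cf dT T c mc; apply/measurable_EFinP.
apply: (measurability _ (RGenOpens.measurableE R)).
move=> _ [_ [a [b ->] <-]]; rewrite setTI.
by apply: (@measurable_preimage_open _ _ _ c (f @^-1` `]a, b[%classic) mc); apply: cf; exact: interval_open.
Qed.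

Lemma continuous_rV (T : topologicalType) d (F : T -> 'rV[R]_d) (x : T) :
  (forall i, {for x, continuous (fun t => F t 0 i)}) -> {for x, continuous F}.
Proof.
move=> cF; apply/cvg_ballP => e e0.
suff : \forall t \near x, forall i, `|F x 0 i - F t 0 i| < e.
  by apply: filterS => t h; apply/ball_rVP.
apply: filter_forall => i.
by have /cvgrPdist_lt/(_ _ e0) := cF i.
Qed.

Lemma continuous_rV_coord (T : topologicalType) d (F : T -> 'rV[R]_d) i :
  continuous F -> continuous (fun t => F t 0 i).
Proof.
move=> cF x; apply: (@continuous_comp _ _ _ F (fun z : 'rV[R]_d => z 0 i)); first exact: cF.
exact: coord_continuous.
Qed.

Lemma continuous_consrV (T : topologicalType) d (u : T -> R) (c : T -> 'rV[R]_d) :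
  continuous u -> continuous c -> continuous (fun t => consrV (u t) (c t)).
Proof.
move=> cu cc x; apply: continuous_rV => i; case: (split_ordP i) => j ->.
  rewrite (_ : (fun t => _) = u); first exact: cu.
  by apply/funext => t; rewrite /consrV row_mxEl mxE.
rewrite (_ : (fun t => _) = (fun t => c t 0 j)); first exact: continuous_rV_coord.
by apply/funext => t; rewrite /consrV row_mxEr.
Qed.

Lemma continuous_consrV2 d (t : R) : continuous (@consrV d t).
Proof.
apply: (@continuous_consrV _ _ (cst t) id); first by move=> x; exact: cst_continuous.
by move=> x; exact: cvg_id.
Qed.

Lemma continuous_consrV1 d (y : 'rV[R]_d) : continuous (fun t => consrV t y).
Proof.
apply: (@continuous_consrV _ _ id (cst y)); first by move=> x; exact: cvg_id.
by move=> x; exact: cst_continuous.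
Qed.

Lemma lsubmx_consrV d1 d2 (t : R) (z : 'rV[R]_(d1 + d2)) :
  lsubmx (consrV t z : 'rV[R]_(d1.+1 + d2)) = consrV t (lsubmx z).
Proof.
apply/rowP => i; case: (split_ordP (i : 'I_(1 + d1))) => j ->; rewrite mxE.
  have -> : lshift d2 (lshift d1 j : 'I_d1.+1) = lshift (d1 + d2) j by apply/val_inj.
  exact: etrans (consrVl _ _ _) (esym (consrVl _ _ _)).
have -> : lshift d2 (rshift 1 j : 'I_d1.+1) = rshift 1 (lshift d2 j) by apply/val_inj.
apply: etrans (consrVS _ _ _) _.
by apply: etrans (esym (consrVS _ _ _)); rewrite mxE.
Qed.

Lemma rsubmx_consrVD d1 d2 (t : R) (z : 'rV[R]_(d1 + d2)) :
  rsubmx (consrV t z : 'rV[R]_(d1.+1 + d2)) = rsubmx z.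
Proof.
apply/rowP => i; rewrite mxE.
have -> : rshift d1.+1 i = rshift 1 (rshift d1 i) :> 'I_(1 + (d1 + d2)).
  by apply/val_inj.
by apply: etrans (consrVS _ _ _) _; rewrite mxE.
Qed.

(** The outer [d1] integrals all belong to [f]; once they are exhausted, the value of [f] is a
    constant factor. *)
Lemma iint_prod d1 d2 (f : 'rV[R]_d1 -> R) (g : 'rV[R]_d2 -> R) :
  continuous f -> continuous g -> (forall x, 0 <= f x) -> (forall x, 0 <= g x) ->
  iint (fun z : 'rV[R]_(d1 + d2) => (f (lsubmx z) * g (rsubmx z))%:E) =
  (iint (fun x => (f x)%:E) * iint (fun x => (g x)%:E))%E.
Proof.
move=> cf cg f0 g0; have mg := continuous_mrV cg.
elim: d1 f cf f0 => [|d1 IH] f cf f0.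
  rewrite /= -iintZl//.
  congr iint; apply/funext => z; rewrite EFinM; congr (_ * _)%E.
    by congr (f _)%:E; apply/rowP => -[].
  by congr (g _)%:E; apply/rowP => i; rewrite mxE; congr (z _ _); apply/val_inj.
have cft t : continuous (fun y => f (consrV t y)).
  move=> y; apply: (@continuous_comp _ _ _ (consrV t) f); last exact: cf.
  exact: continuous_consrV2.
have mf : mrV (fun x => (f x)%:E) := continuous_mrV cf.
rewrite /= -ge0_integralZr//; first last.
- by apply: iint_ge0 => x; rewrite lee_fin.
- by move=> t _; apply: iint_ge0 => x; rewrite lee_fin.
- by apply: (@measurable_iint_cons d1 (fun x => (f x)%:E)) => // x; rewrite lee_fin.
apply: eq_integral => t _ /=.
rewrite -(IH (fun y => f (consrV t y)))//; congr iint; apply/funext => z.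
by congr (f _ * g _)%:E; [exact: lsubmx_consrV|exact: rsubmx_consrVD].
Qed.

(** If [f z > 0], the slices at first coordinates near [z 0 0] are not identically zero, so by
    induction their integrals do not vanish; but these integrals vanish almost everywhere, and an
    interval is not negligible. *)
Lemma iint_eq0 d (f : 'rV[R]_d -> R) : continuous f -> (forall x, 0 <= f x) ->
  iint (fun x => (f x)%:E) = 0%E -> forall x, f x = 0.
Proof.
elim: d f => [|d IH] f cf f0 /=.
  by move=> [f00] x; rewrite -f00; congr f; apply/rowP => -[].
move=> If0; rewrite -[d.+1]/(1 + d)%N => z; apply/eqP; rewrite eq_le f0 andbT leNgt; apply/negP => fz.
have cft t : continuous (fun y => f (consrV t y)).
  move=> y; apply: (@continuous_comp _ _ _ (consrV t) f); last exact: cf.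
  exact: continuous_consrV2.
pose F t := iint (fun y => (f (consrV t y))%:E).
have F0 t : (0 <= F t)%E by apply: iint_ge0 => x; rewrite lee_fin.
have mF : measurable_fun [set: R] (F : R -> \bar R).
  apply: (@measurable_iint_cons d (fun x => (f x)%:E)); last exact: continuous_mrV.
  by move=> x; rewrite lee_fin.
have [N [mN muN sN]] : ae_eq mu setT F (cst 0%E).
  apply/(ae_eq_integral_abs mu _ _).1 => //.
  by under eq_integral do rewrite gee0_abs//.
have : \forall t \near (z 0 0), N t.
  have : \forall t \near (z 0 0), 0 < f (consrV t (rsubmx z)).
    have cc : {for z 0 0, continuous (fun t => f (consrV t (rsubmx z)))}.
      apply: (@continuous_comp _ _ _ (fun t => consrV t (rsubmx z)) f); last exact: cf.
      exact: continuous_consrV1.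
    have fz' : 0 < f (consrV (z 0 0) (rsubmx z)) by rewrite consrV_eta.
    exact: (cvgr_gt _ cc _ fz').
  apply: filterS => t ft; apply: sN => /= h.
  have := IH _ (cft t) (fun y => f0 _) (h I) (rsubmx z).
  by move=> ft0; rewrite ft0 ltxx in ft.
move=> /nbhs_ballP[e /= e0 eN].
have muB : mu (ball (z 0 0) e) = 0%E.
  by apply: (@subset_measure0 _ _ _ mu _ N) => //; exact: measurable_ball.
move: muB; rewrite lebesgue_measure_ball ?ltW// => -[/eqP].
by rewrite mulrn_eq0/= gt_eqF.
Qed.

End IteratedIntegral.

(** * Smooth maps and strongly monotone maps *)

Section Calculus.
Context {R : realType}.

Lemma is_diff_eps (V W : normedModType R) (f : V -> W) (L : {linear V -> W}) x :
  continuous L ->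
  (forall e : R, 0 < e -> \forall h \near (0 : V), `|f (h + x) - f x - L h| <= e * `|h|) ->
  is_diff x f L.
Proof.
move=> cL fL.
have E : f \o shift x = cst (f x) + L +o_ (0 : V) id.
  apply/eqaddoP => e e0; move: (fL e e0); apply: filterS => h /=.
  by rewrite /= !fctE/= opprD addrA.
have dE := diff_unique cL E.
split => //; apply/diff_locallyP; rewrite dE; split => //.
Qed.

Lemma is_diff_epsP (V W : normedModType R) (f : V -> W) (L : V -> W) x :
  is_diff x f L ->
  forall e : R, 0 < e -> \forall h \near (0 : V), `|f (h + x) - f x - L h| <= e * `|h|.
Proof.
move=> [df <-] e e0; have /eqaddoP/(_ e e0) := diff_locally df.
by apply: filterS => h; rewrite /= !fctE/= opprD addrA.
Qed.

Lemma normr_coord_le d (h : 'rV[R]_d) i : `|h 0 i| <= `|h|.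
Proof.
rewrite [leRHS]/Num.norm/= mx_normrE.
exact: (le_bigmax _ (fun ij : 'I_1 * 'I_d => `|h ij.1 ij.2|) (0, i)).
Qed.

Lemma normr_rV_le d (h : 'rV[R]_d) (M : R) : 0 <= M ->
  (forall i, `|h 0 i| <= M) -> `|h| <= M.
Proof.
move=> M0 hM; rewrite [leLHS]/Num.norm/= mx_normrE; apply/bigmax_leP; split=> //.
by move=> [i j] _ /=; rewrite (ord1 i).
Qed.

Lemma is_derive_line d (f : 'rV[R]_d -> R) x v (t : R) :
  derivable f (x + t *: v) v ->
  is_derive t (1 : R) (fun s => f (x + s *: v)) ('D_v f (x + t *: v)).
Proof.
have E : (fun h : R => h^-1 *: (f (x + (h *: 1 + t) *: v) - f (x + t *: v))) =
         (fun h : R => h^-1 *: (f (h *: v + (x + t *: v)) - f (x + t *: v))).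
  apply/funext => h; congr (_ *: (f _ - _)).
  by rewrite scaler1 scalerDl addrCA.
by move=> df; split; rewrite ?/derivable ?/derive /= E.
Qed.

Definition gradlin d (a : 'I_d -> R) (h : 'rV[R]_d) : R := \sum_i h 0 i * a i.

Fact gradlin_is_linear d (a : 'I_d -> R) : linear (gradlin a).
Proof.
move=> k u v; rewrite /gradlin scaler_sumr -big_split/=; apply: eq_bigr => i _.
by rewrite !mxE mulrDl -mulrA.
Qed.

HB.instance Definition _ d (a : 'I_d -> R) :=
  GRing.isLinear.Build R 'rV[R]_d R *:%R (gradlin a) (gradlin_is_linear a).

Lemma continuous_sumR (T : topologicalType) (I : Type) (r : seq I) (P : pred I) (F : I -> T -> R) :
  (forall i, continuous (F i)) -> continuous (fun t => \sum_(i <- r | P i) F i t).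
Proof.
move=> cF x; elim: r => [|i r IH].
  by under eq_fun do rewrite big_nil; exact: cst_continuous.
under eq_fun do rewrite big_cons; case: (P i) => //.
by apply: continuousD => //; exact: cF.
Qed.

Lemma continuous_prodR (T : topologicalType) (I : Type) (r : seq I) (P : pred I) (F : I -> T -> R) :
  (forall i, continuous (F i)) -> continuous (fun t => \prod_(i <- r | P i) F i t).
Proof.
move=> cF x; elim: r => [|i r IH].
  by under eq_fun do rewrite big_nil; exact: cst_continuous.
under eq_fun do rewrite big_cons; case: (P i) => //.
by apply: continuousM => //; exact: cF.
Qed.

Lemma continuous_det (T : topologicalType) d (M : T -> 'M[R]_d) :
  (forall i j, continuous (fun t => M t i j)) -> continuous (fun t => \det (M t)).
Proof.
move=> cM; apply: continuous_sumR => s x.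
apply: (@continuousM R T (fun=> (-1) ^+ perm.odd_perm s)); first exact: cst_continuous.
by apply: continuous_prodR => i; exact: cM.
Qed.

Lemma continuous_coord d (i : 'I_d) : continuous (fun z : 'rV[R]_d => z 0 i).
Proof. by move=> z; exact: coord_continuous. Qed.

Lemma continuous_gradlin d (a : 'I_d -> R) : continuous (gradlin a).
Proof.
apply: continuous_sumR => i x.
by apply: continuousM; [exact: continuous_coord|exact: cst_continuous].
Qed.

Lemma continuous_mulmxr m n (H : 'M[R]_(m, n)) : continuous (fun h : 'rV[R]_m => h *m H).
Proof.
move=> x; apply: continuous_rV => i.
rewrite (_ : (fun t => _) = gradlin (fun j => H j i)); first exact: continuous_gradlin.
by apply/funext => t; rewrite mxE.
Qed.

(** The vertices of the path from 0 to [h] along the axes, used to telescope an increment. *)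
Definition trunc_rV d (h : 'rV[R]_d) (k : nat) : 'rV[R]_d :=
  \row_i (if (i < k)%N then h 0 i else 0).

Lemma trunc_rVS d (h : 'rV[R]_d) (k : 'I_d) :
  trunc_rV h k.+1 = trunc_rV h k + h 0 k *: ebasis R k.
Proof.
apply/rowP => i; rewrite !mxE eqxx/= ltnS leq_eqVlt.
have [->|ik] := eqVneq i k; first by rewrite eqxx ltnn mulr1 add0r.
by move: ik; rewrite -val_eqE/= => /negbTE ->; rewrite mulr0 addr0.
Qed.

(** Telescoping along the axes, with the mean value theorem on each segment, compares every
    increment with a partial derivative at [x]. *)
Lemma is_diff_C1 d (f : 'rV[R]_d -> R) (x : 'rV[R]_d) :
  (forall i (y : 'rV[R]_d), derivable f y (ebasis R i)) ->
  (forall i, {for x, continuous ('D_(ebasis R i) f)}) ->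
  is_diff x f (gradlin (fun i => 'D_(ebasis R i) f x)).
Proof.
move=> df cdf; apply: is_diff_eps; first exact: continuous_gradlin.
(* There are [d] segments, each contributing at most [e' |h|]; [d.+1] keeps the quotient positive in
   dimension 0. *)
move=> e e0; pose e' := e / d.+1%:R.
have e'0 : 0 < e' by rewrite divr_gt0.
have : \forall y \near x, forall i, `|'D_(ebasis R i) f x - 'D_(ebasis R i) f y| < e'.
  apply: (filter_forall (nbhs_filter x)) => i.
  have /cvgrPdist_lt/(_ _ e'0) := cdf i; exact.
move=> /nbhs_ballP[r /= r0 hr].
apply/nbhs_ballP; exists r => //= h; rewrite -ball_normE /ball_/= sub0r normrN => hr'.
have fE : f (h + x) - f x = \sum_(k < d) (f (x + trunc_rV h k.+1) - f (x + trunc_rV h k)).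
  rewrite -(big_mkord xpredT (fun k => f (x + trunc_rV h k.+1) - f (x + trunc_rV h k))).
  rewrite telescope_sumr//; congr (f _ - f _).
    by rewrite addrC; congr (x + _); apply/rowP => i; rewrite mxE ltn_ord.
  by rewrite -[LHS]addr0; congr (x + _); apply/rowP => i; rewrite !mxE ltn0.
rewrite fE /gradlin -sumrB.
apply: le_trans (ler_norm_sum _ _ _) _.
have key (k : 'I_d) : `|f (x + trunc_rV h k.+1) - f (x + trunc_rV h k) - h 0 k * 'D_(ebasis R k) f x| <= e' * `|h|.
  set y := x + trunc_rV h k.
  have [t /andP[t0 t1] ft] : exists2 t : R, 0 < t < 1 &
     f (y + (1 * h 0 k) *: ebasis R k) - f (y + (0 * h 0 k) *: ebasis R k) =
     'D_(ebasis R k) f (y + (t * h 0 k) *: ebasis R k) * h 0 k.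
    apply: (@MVT01 _ (fun t => f (y + (t * h 0 k) *: ebasis R k)) (fun t => 'D_(ebasis R k) f (y + (t * h 0 k) *: ebasis R k) * h 0 k)) => t _.
    apply: (@is_derive1_comp _ (fun s => f (y + s *: ebasis R k)) (fun t => t * h 0 k)).
      exact: is_derive_line.
    by apply: is_derive_eq; rewrite scaler0 add0r scaler1.
  move: ft; rewrite mul1r mul0r scale0r addr0 trunc_rVS addrA => ->.
  rewrite mulrC -mulrBr normrM mulrC ler_pM ?normr_coord_le//.
  rewrite distrC; apply: ltW; apply: hr.
  rewrite -ball_normE /ball_/= -addrA opprD addNKr normrN.
  apply: le_lt_trans hr'; apply: normr_rV_le => // i.
  rewrite !mxE eqxx/=; have [->|ik] := eqVneq i k.
    rewrite ltnn add0r mulr1 normrM (gtr0_norm t0).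
    by apply: le_trans (normr_coord_le h k); exact: ler_piMl (normr_ge0 _) (ltW t1).
  by rewrite mulr0 addr0; case: ifP => _; rewrite ?normr0// normr_coord_le.
apply: le_trans (ler_sum _ (fun k _ => key k)) _.
rewrite sumr_const card_ord -[leLHS]mulr_natl mulrA ler_wpM2r//.
by rewrite /e' mulrCA ler_piMr ?ltW// ltr_pdivrMr// mul1r ltr_nat.
Qed.

(** [smooth] peels its list of directions from the outside, whereas [Ck] differentiates first and
    recurses on the derivative. In this form the product, quotient and chain rules become inductions
    on [k]; [smoothP] relates the two. *)
Fixpoint Ck (k : nat) d (f : 'rV[R]_d -> R) : Prop :=
  continuous f /\
  match k with
  | 0 => True
  | k'.+1 => forall v, (forall x, derivable f x v) /\ Ck k' ('D_v f)
  end.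

Lemma Ck_continuous k d (f : 'rV[R]_d -> R) : Ck k f -> continuous f.
Proof. by case: k => [|k] []. Qed.

Lemma Ck_derivable k d (f : 'rV[R]_d -> R) x v : Ck k.+1 f -> derivable f x v.
Proof. by case=> _ /(_ v)[]. Qed.

Lemma Ck_derive k d (f : 'rV[R]_d -> R) v : Ck k.+1 f -> Ck k ('D_v f).
Proof. by case=> _ /(_ v)[]. Qed.

Lemma CkW k d (f : 'rV[R]_d -> R) : Ck k.+1 f -> Ck k f.
Proof.
elim: k f => [|k IH] f [cf h]; split=> // v.
by have [df ck] := h v; split=> //; exact: IH.
Qed.

Lemma iderive_rcons d (vs : seq 'rV[R]_d) v (f : 'rV[R]_d -> R) :
  iderive (rcons vs v) f = iderive vs ('D_v f).
Proof. by elim: vs => //= w vs ->. Qed.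

Lemma smooth_derive d (f : 'rV[R]_d -> R) v : smooth f -> smooth ('D_v f).
Proof. by move=> sf vs; rewrite -iderive_rcons; exact: sf. Qed.

Lemma smoothP d (f : 'rV[R]_d -> R) : smooth f <-> forall k, Ck k f.
Proof.
split=> [sf k|].
  elim: k f sf => [|k IH] f sf; first by split=> //; exact: (sf [::]).1.
  split; first exact: (sf [::]).1.
  by move=> v; split; [move=> x; exact: (sf [::]).2|exact/IH/smooth_derive].
move=> + vs; elim/last_ind: vs f => [|vs v IH] f ckf.
  by split=> [|x v]; [exact: Ck_continuous (ckf 0%N)|exact: Ck_derivable (ckf 1%N)].
by rewrite iderive_rcons; apply: IH => k; exact: Ck_derive (ckf k.+1).
Qed.

Lemma smooth_Ck k d (f : 'rV[R]_d -> R) : smooth f -> Ck k f.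
Proof. by move/smoothP. Qed.

Lemma smooth_continuous d (f : 'rV[R]_d -> R) : smooth f -> continuous f.
Proof. by move=> sf; exact: (sf [::]).1. Qed.

Lemma smooth_derivable d (f : 'rV[R]_d -> R) x v : smooth f -> derivable f x v.
Proof. by move=> sf; exact: (sf [::]).2. Qed.

Lemma Ck_cst k d (c : R) : Ck k (fun _ : 'rV[R]_d => c).
Proof.
elim: k c => [|k IH] c; split=> //; try by move=> x; exact: cst_continuous.
move=> v; split; first by move=> x; exact: derivable_cst.
rewrite (_ : 'D_v _ = fun=> 0)//; apply/funext => x; exact: derive_cst.
Qed.

Lemma CkD k d (f g : 'rV[R]_d -> R) : Ck k f -> Ck k g -> Ck k (fun x => f x + g x).
Proof.
elim: k f g => [|k IH] f g [cf hf] [cg hg]; split=> //.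
- by move=> x; apply: continuousD; [exact: cf|exact: cg].
- by move=> x; apply: continuousD; [exact: cf|exact: cg].
move=> v; have [df hf'] := hf v; have [dg hg'] := hg v.
split; first by move=> x; exact: derivableD.
rewrite (_ : 'D_v _ = fun x => 'D_v f x + 'D_v g x); first exact: IH.
by apply/funext => x; rewrite -deriveD.
Qed.

Lemma CkM k d (f g : 'rV[R]_d -> R) : Ck k f -> Ck k g -> Ck k (fun x => f x * g x).
Proof.
elim: k f g => [|k IH] f g; first move=> [cf hf] [cg hg].
  by split=> // x; apply: continuousM; [exact: cf|exact: cg].
move=> kf kg; split.
  by move=> x; apply: continuousM; [exact: (Ck_continuous kf)|exact: (Ck_continuous kg)].
move=> v; have df x : derivable f x v by exact: Ck_derivable kf.
have dg x : derivable g x v by exact: Ck_derivable kg.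
split; first by move=> x; exact: derivableM.
rewrite (_ : 'D_v _ = fun x => f x * 'D_v g x + g x * 'D_v f x).
  apply: CkD.
    by apply: IH; [exact: (CkW kf)|exact: (Ck_derive v kg)].
  by apply: IH; [exact: (CkW kg)|exact: (Ck_derive v kf)].
by apply/funext => x; exact: deriveM.
Qed.

Lemma CkV k d (f : 'rV[R]_d -> R) : (forall x, f x != 0) -> Ck k f -> Ck k (fun x => (f x)^-1).
Proof.
move=> f0; elim: k => [|k IH] kf.
  by split=> // x; apply: continuousV => //; exact: (Ck_continuous kf).
split; first by move=> x; apply: continuousV => //; exact: (Ck_continuous kf).
move=> v; have df x : derivable f x v by exact: Ck_derivable kf.
split; first by move=> x; exact: derivableV.
rewrite (_ : 'D_v _ = fun x => -1 * ((f x)^-1 * ((f x)^-1 * 'D_v f x))).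
  apply: CkM; first exact: Ck_cst.
  have kV := IH (CkW kf).
  by apply: (CkM kV); apply: (CkM kV); exact: (Ck_derive v kf).
apply/funext => x; rewrite [LHS](deriveV (f0 x) (df x)).
by rewrite -[LHS]/(- (f x ^- 2) * 'D_v f x) mulN1r expr2 invfM mulNr mulrA.
Qed.

Lemma Ck_sum k d (I : Type) (r : seq I) (P : pred I) (F : I -> 'rV[R]_d -> R) :
  (forall i, Ck k (F i)) -> Ck k (fun x => \sum_(i <- r | P i) F i x).
Proof.
move=> kF; elim: r => [|i r IH].
  by under eq_fun do rewrite big_nil; exact: Ck_cst.
under eq_fun do rewrite big_cons; case: (P i) => //; exact: CkD.
Qed.

Lemma Ck_prod k d (I : Type) (r : seq I) (P : pred I) (F : I -> 'rV[R]_d -> R) :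
  (forall i, Ck k (F i)) -> Ck k (fun x => \prod_(i <- r | P i) F i x).
Proof.
move=> kF; elim: r => [|i r IH].
  by under eq_fun do rewrite big_nil; exact: Ck_cst.
under eq_fun do rewrite big_cons; case: (P i) => //; exact: CkM.
Qed.

Lemma Ck_det k d n (M : 'rV[R]_d -> 'M[R]_n) :
  (forall i j, Ck k (fun t => M t i j)) -> Ck k (fun t => \det (M t)).
Proof.
move=> cM; apply: Ck_sum => s; apply: CkM; first exact: Ck_cst.
by apply: Ck_prod => i; exact: cM.
Qed.

Lemma is_derive_gradlin d (a : 'I_d -> R) (x v : 'rV[R]_d) :
  is_derive x v (gradlin a) (gradlin a v).
Proof.
have da : is_diff x (gradlin a) (gradlin a).
  apply: is_diff_eps; first exact: continuous_gradlin.
  move=> e e0; apply: filterE => h.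
  by rewrite linearD addrK subrr normr0 mulr_ge0// ltW.
by split; [exact: diff_derivable|rewrite deriveE// diff_val].
Qed.

Lemma Ck_gradlin k d (a : 'I_d -> R) : Ck k (gradlin a).
Proof.
case: k => [|k]; split=> //; try exact: continuous_gradlin.
move=> v; split; first by move=> x; have [] := is_derive_gradlin a x v.
rewrite (_ : 'D_v _ = fun=> gradlin a v); first exact: Ck_cst.
by apply/funext => x; have [_ ->] := is_derive_gradlin a x v.
Qed.

Lemma Ck_coord k d (i : 'I_d) : Ck k (fun z : 'rV[R]_d => z 0 i).
Proof.
rewrite (_ : (fun z => _) = gradlin (fun j => (j == i)%:R)); first exact: Ck_gradlin.
apply/funext => z; rewrite /gradlin (bigD1 i)//= eqxx mulr1 big1 ?addr0// => j ji.
by rewrite (negbTE ji) mulr0.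
Qed.

Lemma Ck_is_diff k d (f : 'rV[R]_d -> R) (x : 'rV[R]_d) : Ck k.+1 f ->
  is_diff x f (gradlin (fun i => 'D_(ebasis R i) f x)).
Proof.
move=> kf; apply: is_diff_C1 => [i y|i]; first exact: Ck_derivable kf.
exact: (Ck_continuous (Ck_derive _ kf)).
Qed.

Lemma Ck_deriveE k d (f : 'rV[R]_d -> R) (x v : 'rV[R]_d) : Ck k.+1 f ->
  'D_v f x = \sum_i v 0 i * 'D_(ebasis R i) f x.
Proof.
by move=> kf; have [df dE] := Ck_is_diff x kf; rewrite deriveE// dE.
Qed.

Lemma differentiable_rV (V : normedModType R) d (T : V -> 'rV[R]_d) (x : V) :
  (forall i, differentiable (fun x => T x 0 i) x) -> differentiable T x.
Proof.
move=> dT.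
have -> : T = \sum_(i < d) (fun x => T x 0 i *: ebasis R i).
  apply/funext => y; rewrite fct_sumE [LHS]row_sum_delta; apply: eq_bigr => i _.
  by [].
by apply: differentiable_sum => i; apply: differentiableZl.
Qed.

Lemma derive_rV_coord (V : normedModType R) d (T : V -> 'rV[R]_d) (x v : V) i :
  differentiable T x -> ('D_v T x) 0 i = 'D_v (fun x => T x 0 i) x.
Proof.
by move=> dT; rewrite derive_mx ?mxE//; exact: diff_derivable.
Qed.

Lemma Ck_comp k m d (f : 'rV[R]_d -> R) (T : 'rV[R]_m -> 'rV[R]_d) :
  Ck k f -> (forall i, Ck k (fun x => T x 0 i)) -> Ck k (f \o T).
Proof.
have cT j : (forall i, Ck j (fun x => T x 0 i)) -> continuous T.
  by move=> kT x; apply: continuous_rV => i; exact: (Ck_continuous (kT i)).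
elim: k f => [|k IH] f kf kT.
  split=> // x; apply: continuous_comp; first exact: (cT _ kT).
  exact: (Ck_continuous kf).
split=> [x|v].
  by apply: continuous_comp; [exact: (cT _ kT)|exact: (Ck_continuous kf)].
have dT x : differentiable T x.
  by apply: differentiable_rV => i; have [] := Ck_is_diff x (kT i).
have df x : differentiable f x by have [] := Ck_is_diff x kf.
split; first by move=> x; apply: diff_derivable; exact: differentiable_comp.
rewrite (_ : 'D_v _ = fun x => \sum_i 'D_v (fun x => T x 0 i) x * ('D_(ebasis R i) f \o T) x).
  apply: Ck_sum => i; apply: CkM; first exact: (Ck_derive v (kT i)).
  by apply: IH; [exact: (Ck_derive _ kf)|move=> j; exact: (CkW (kT j))].
apply/funext => x; rewrite deriveE; last exact: differentiable_comp.
rewrite diff_comp//= -(deriveE _ (dT x)) -(deriveE _ (df (T x))) (Ck_deriveE _ _ kf).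
by apply: eq_bigr => i _; rewrite derive_rV_coord.
Qed.

(** For [h = S (k + y) - S y], differentiability of [T] and continuity of [S] give
    [|k H^-1 - h| <= C e1 |h|] for small [k]. With [C e1 <= 1/2] this first yields [|h| <= 2 C |k|],
    and then the required bound in [|k|]. *)
Lemma is_diff_inverse d (T S : 'rV[R]_d -> 'rV[R]_d) (H : 'M[R]_d) (y : 'rV[R]_d) :
  cancel S T -> {for y, continuous S} -> is_diff (S y) T (mulmxr H) ->
  H \in unitmx -> is_diff y S (mulmxr (invmx H)).
Proof.
move=> ST cS dT uH; apply: is_diff_eps; first exact: continuous_mulmxr.
move=> e e0.
have [C C0 hC] : exists2 k : R, 0 < k & forall x : 'rV[R]_d, `|x *m invmx H| <= k * `|x|.
  by apply: (@linear_lipschitz _ _ _ (mulmxr (invmx H))); exact: continuous_mulmxr.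
(* The first bound lets [|h|] be absorbed on the left; the second turns the final error into
   [e |k|]. *)
pose e1 := Num.min ((2 * C)^-1) (e / (2 * C * C)).
have e10 : 0 < e1 by rewrite lt_min invr_gt0 divr_gt0// !mulr_gt0.
have hT := is_diff_epsP dT e10.
have /nbhs_ballP[r /= r0 hr] := hT.
move/cvgrPdist_lt : cS => /(_ _ r0) /nbhs_ballP[s /= s0 hs].
apply/nbhs_ballP; exists s => //= k; rewrite -ball_normE /ball_/= sub0r normrN => ks.
have /hr : ball 0 r (S (k + y) - S y).
  rewrite -ball_normE /ball_/= sub0r opprB; apply: hs.
  by rewrite -ball_normE /ball_/= opprD addrCA subrr addr0 normrN.
rewrite /= subrK !ST addrK.
set h := S (k + y) - S y => hk.
have hB : `|k *m invmx H - h| <= C * (e1 * `|h|).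
  have -> : k *m invmx H - h = (k - h *m H) *m invmx H.
    by rewrite mulmxBl mulmxK.
  by apply: le_trans (hC _) _; rewrite ler_pM2l.
have hCe : C * e1 <= 1 / 2.
  have : e1 <= (2 * C)^-1 by rewrite ge_min lexx.
  rewrite invfM => /(ler_wpM2l (ltW C0)); rewrite mulrCA divff ?gt_eqF//.
  by rewrite mulr1 mul1r.
have h2 : `|h| <= 2 * C * `|k|.
  have h3 : `|h| <= `|k *m invmx H| + `|k *m invmx H - h|.
    by rewrite -[X in `|X| <= _](subKr (k *m invmx H)); exact: ler_normB.
  have h4 := hC k.
  have h5 : C * (e1 * `|h|) <= `|h| / 2.
    by rewrite mulrA mulrC ler_wpM2l//; move: hCe; rewrite mul1r.
  by rewrite /= in h4; lra.
rewrite distrC; apply: le_trans hB _.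
have h6 : C * (e1 * `|h|) <= C * (e1 * (2 * C * `|k|)).
  by rewrite ler_pM2l// ler_pM2l.
apply: le_trans h6 _.
have -> : C * (e1 * (2 * C * `|k|)) = e1 * (2 * C * C) * `|k| by ring.
rewrite ler_wpM2r// -ler_pdivlMr ?mulr_gt0//.
by rewrite ge_min lexx orbT.
Qed.

(** Points are row vectors: the Jacobian multiplies them on the right and is the transpose of the
    usual one. *)
Definition jac m d (T : 'rV[R]_m -> 'rV[R]_d) (x : 'rV[R]_m) : 'M[R]_(m, d) :=
  \matrix_(i, j) 'D_(ebasis R i) (fun y => T y 0 j) x.

Lemma is_diff_jac k m d (T : 'rV[R]_m -> 'rV[R]_d) (x : 'rV[R]_m) :
  (forall j, Ck k.+1 (fun y => T y 0 j)) -> is_diff x T (mulmxr (jac T x)).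
Proof.
move=> kT; have dT : differentiable T x.
  by apply: differentiable_rV => j; have [] := Ck_is_diff x (kT j).
split=> //; apply/funext => h; rewrite -deriveE//; apply/rowP => j.
rewrite derive_rV_coord// (Ck_deriveE _ _ (kT j)) mxE.
by apply: eq_bigr => i _; rewrite mxE.
Qed.

Lemma Ck_invmx k d n (M : 'rV[R]_d -> 'M[R]_n) :
  (forall i j, Ck k (fun t => M t i j)) -> (forall t, \det (M t) != 0) ->
  forall i j, Ck k (fun t => invmx (M t) i j).
Proof.
move=> kM dM i j.
have -> : (fun t => invmx (M t) i j) = (fun t => (\det (M t))^-1 * (\adj (M t)) i j).
  by apply/funext => t; rewrite /invmx unitmxE unitfE dM mxE.
apply: CkM; first by apply: CkV => //; exact: Ck_det.
rewrite (_ : (fun t => _) = (fun t => (-1) ^+ (j + i) * \det (row' j (col' i (M t))))).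
  apply: CkM; first exact: Ck_cst.
  apply: Ck_det => a b; rewrite (_ : (fun t => _) = fun t => M t (lift j a) (lift i b))//.
  by apply/funext => t; rewrite !mxE.
by apply/funext => t; rewrite mxE.
Qed.

(** Bootstrap: the derivative of [S] is the inverse Jacobian of [T] composed with [S], so [S] of
    class [C^k] has derivatives of class [C^k]. *)
Lemma smooth_inverse d (T S : 'rV[R]_d -> 'rV[R]_d) :
  smooth_map T -> (forall x, \det (jac T x) != 0) ->
  cancel S T -> continuous S -> smooth_map S.
Proof.
move=> sT dT ST cS.
have kT k i : Ck k (fun x => T x 0 i) by exact/smooth_Ck/sT.
have kG k i j : Ck k (fun x => invmx (jac T x) i j).
  apply: Ck_invmx => // a b.
  rewrite (_ : (fun x => _) = 'D_(ebasis R a) (fun y => T y 0 b)).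
    exact: (Ck_derive _ (kT k.+1 b)).
  by apply/funext => x; rewrite mxE.
have dS y : is_diff y S (mulmxr (invmx (jac T (S y)))).
  apply: (is_diff_inverse (T := T)) => //; first exact: cS.
    by apply: (is_diff_jac (k := 0)) => j; exact: kT.
  by rewrite unitmxE unitfE.
suff kS k : forall j, Ck k (fun y => S y 0 j) by move=> j; apply/smoothP => k; exact: kS.
elim: k => [|k IH] j; first by split=> //; exact: continuous_rV_coord.
split; first exact: continuous_rV_coord.
move=> v; have dfS y : differentiable S y by have [] := dS y.
have dSj y : differentiable (fun y => S y 0 j) y.
  by apply: (@differentiable_comp _ _ _ _ S (fun z : 'rV[R]_d => z 0 j)) => //; exact: differentiable_coord.
split; first by move=> y; exact: diff_derivable.
rewrite (_ : 'D_v _ = fun y => \sum_i v 0 i * ((fun x => invmx (jac T x) i j) \o S) y).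
  by apply: Ck_sum => i; apply: CkM; [exact: Ck_cst|exact: Ck_comp].
apply/funext => y; rewrite -derive_rV_coord// deriveE//.
by have [_ ->] := dS y; rewrite mxE.
Qed.

(** * Strongly monotone maps and their inverses *)

Definition strongly_monotone d (e : R) (T : 'rV[R]_d -> 'rV[R]_d) :=
  forall x y, e * dotv (x - y) (x - y) <= dotv (T x - T y) (x - y).

Lemma dotv_consrV d (s t : R) (y z : 'rV[R]_d) :
  dotv (consrV s y) (consrV t z) = s * t + dotv y z.
Proof.
rewrite !dotvE big_split_ord big_ord1 !consrVl; congr (_ + _).
by apply: eq_bigr => i _; rewrite !consrVS.
Qed.

Lemma consrVB d (s t : R) (y z : 'rV[R]_d) :
  consrV s y - consrV t z = consrV (s - t) (y - z).
Proof.
rewrite /consrV opp_row_mx add_row_mx; congr row_mx.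
by apply/rowP => i; rewrite !mxE.
Qed.

Lemma dotv_consrVB d (T : 'rV[R]_(1 + d) -> 'rV[R]_(1 + d)) s t y z :
  dotv (T (consrV s y) - T (consrV t z)) (consrV s y - consrV t z) =
  (T (consrV s y) 0 0 - T (consrV t z) 0 0) * (s - t) +
  dotv (rsubmx (T (consrV s y)) - rsubmx (T (consrV t z))) (y - z).
Proof.
by rewrite consrVB -{1}(consrV_eta (T (consrV s y))) -{1}(consrV_eta (T (consrV t z))) consrVB dotv_consrV.
Qed.

Lemma dotv0r d (v : 'rV[R]_d) : dotv v 0 = 0.
Proof. by rewrite /dotv trmx0 mulmx0 mxE. Qed.

Lemma dotvv_ge0 d (v : 'rV[R]_d) : 0 <= dotv v v.
Proof. exact: mulmx_tr_ge0. Qed.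

Lemma normr_sqr_le_dotv d (v : 'rV[R]_d) : `|v| ^+ 2 <= dotv v v.
Proof.
have h : `|v| <= Num.sqrt (dotv v v).
  apply: normr_rV_le => [|i]; first exact: sqrtr_ge0.
  rewrite -sqrtr_sqr ler_sqrt ?dotvv_ge0// dotvE (bigD1 i)//= -expr2 lerDl.
  by apply: sumr_ge0 => j _; rewrite -expr2 sqr_ge0.
by rewrite -[leRHS]sqr_sqrtr ?dotvv_ge0// lerXn2r ?nnegrE// sqrtr_ge0.
Qed.

Lemma dotv_le d (u v : 'rV[R]_d) : dotv u v <= d%:R * (`|u| * `|v|).
Proof.
apply: le_trans (ler_norm _) _; rewrite dotvE; apply: normr_sum_le => i.
by rewrite normrM ler_pM// normr_coord_le.
Qed.

Lemma strongly_monotone_norm d e (T : 'rV[R]_d -> 'rV[R]_d) : 0 < e ->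
  strongly_monotone e T -> forall x y, `|x - y| <= d%:R / e * `|T x - T y|.
Proof.
move=> e0 mT x y; have := le_trans (mT x y) (dotv_le _ _).
have := normr_sqr_le_dotv (x - y); set n := `|x - y| => hn hT.
have [n0|n0] := eqVneq n 0; first by rewrite n0 mulr_ge0// divr_ge0// ltW.
have n1 : 0 < n by rewrite lt_neqAle eq_sym n0 normr_ge0.
have : n * (e * n) <= n * (d%:R * `|T x - T y|).
  by move: hT; rewrite -(ler_pM2l e0) in hn; rewrite expr2 in hn; lra.
by rewrite ler_pM2l// mulrAC ler_pdivlMr// mulrC.
Qed.

Lemma for_continuousP (T : topologicalType) (V : normedModType R) (f : T -> V) (x : T) :
  {for x, continuous f} <->
  (forall a : R, 0 < a -> \forall z \near x, `|f x - f z| <= a).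
Proof. exact: cvgrPdist_le. Qed.

Section PartialInverse.
Variables (d : nat) (T : 'rV[R]_(1 + d) -> 'rV[R]_(1 + d)) (e : R).
Hypothesis e0 : 0 < e.
Hypothesis cT : continuous T.
Hypothesis mT : strongly_monotone e T.

Let phi t y := T (consrV t y) 0 0.

Lemma phi_mono s t y : e * (s - t) ^+ 2 <= (phi s y - phi t y) * (s - t).
Proof.
have := mT (consrV s y) (consrV t y).
by rewrite dotv_consrVB consrVB dotv_consrV subrr !dotv0r !addr0 -expr2.
Qed.

Lemma phi_norm s t y : e * `|s - t| <= `|phi s y - phi t y|.
Proof.
have := phi_mono s t y; have [->|st] := eqVneq s t.
  by move=> _; rewrite !subrr normr0 mulr0.
rewrite -real_normK ?num_real// => h.
have n0 : 0 < `|s - t| by rewrite normr_gt0 subr_eq0.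
rewrite -(ler_pM2r n0) -normrM; apply: le_trans (ler_norm _).
by apply: le_trans h; rewrite expr2 mulrA.
Qed.

Lemma continuous_phi y : continuous (phi^~ y).
Proof.
move=> t; apply: (@continuous_comp _ _ _ (fun t => T (consrV t y)) (fun z : 'rV[R]_(1 + d) => z 0 0)).
  apply: (@continuous_comp _ _ _ (fun t => consrV t y) T); last exact: cT.
  exact: continuous_consrV1.
exact: continuous_coord.
Qed.

Lemma phi_surj u y : exists t, phi t y = u.
Proof.
(* [phi] increases at rate at least [e] in its first argument, so over a distance [M] it moves by at
   least the gap to be closed. *)
pose M := `|u - phi 0 y| / e.
have M0 : 0 <= M by rewrite divr_ge0// ltW.
have eM : e * M = `|u - phi 0 y| by rewrite /M mulrC divfK ?gt_eqF.
have h1 : phi 0 y + e * M <= phi M y.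
  have := phi_mono M 0 y; rewrite subr0 expr2 => h.
  have [M1|M1] := eqVneq M 0; first by rewrite M1 mulr0 addr0.
  have M2 : 0 < M by rewrite lt_neqAle eq_sym M1.
  by move: h; rewrite mulrA ler_pM2r//; lra.
have h2 : phi (- M) y <= phi 0 y - e * M.
  have := phi_mono 0 (- M) y; rewrite sub0r opprK expr2 => h.
  have [M1|M1] := eqVneq M 0; first by rewrite M1 mulr0 subr0 oppr0.
  have M2 : 0 < M by rewrite lt_neqAle eq_sym M1.
  by move: h; rewrite mulrA ler_pM2r//; lra.
have := ler_norm (u - phi 0 y); have := ler_norm (phi 0 y - u).
rewrite distrC -eM => h3 h4.
have [|||c _ cE] := @IVT R (phi^~ y) (- M) M u; last by exists c.
- lra.
- by apply: continuous_subspaceT; exact: continuous_phi.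
- by rewrite ge_min le_max; apply/andP; split; apply/orP; [left|right]; lra.
Qed.

(* [psolve u y] is the [t] such that [T] maps [(t, y)] to a point of first
   coordinate [u]. *)
Definition psolve u y := projT1 (cid (phi_surj u y)).

Lemma psolveK u y : T (consrV (psolve u y) y) 0 0 = u.
Proof. exact: projT2 (cid (phi_surj u y)). Qed.

Lemma phi_inj s t y : phi s y = phi t y -> s = t.
Proof.
move=> h; have := phi_norm s t y; rewrite h subrr normr0 pmulr_rle0//.
by rewrite normr_le0 subr_eq0 => /eqP.
Qed.

Lemma psolve_phi t y : psolve (T (consrV t y) 0 0) y = t.
Proof. by apply: (@phi_inj _ _ y); exact: psolveK. Qed.

(** With the other coordinates fixed, [e] times the distance between two first coordinates is at
    most the gap between their images. Comparing the solution with the constant guess [s0] bounds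
    its variation by a continuous function vanishing at [z0]. *)
Lemma continuous_psolve : continuous (fun z : 'rV[R]_(1 + d) => psolve (z 0 0) (rsubmx z)).
Proof.
suff main (z0 : 'rV[R]_(1 + d)) :
    {for z0, continuous (fun z : 'rV[R]_(1 + d) => psolve (z 0 0) (rsubmx z))}.
  by move=> z; exact: main.
pose s0 := psolve (z0 0 0) (rsubmx z0).
have cg : {for z0, continuous (fun z : 'rV[R]_(1 + d) => z 0 0 - phi s0 (rsubmx z))}.
  apply: continuousB; first exact: continuous_coord.
  apply: (@continuous_comp _ _ _ (fun z : 'rV[R]_(1 + d) => T (consrV s0 (rsubmx z))) (fun z : 'rV[R]_(1 + d) => z 0 0)); last exact: continuous_coord.
  apply: (@continuous_comp _ _ _ (fun z : 'rV[R]_(1 + d) => consrV s0 (rsubmx z)) T); last exact: cT.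
  apply: (@continuous_comp _ _ _ (fun z : 'rV[R]_(1 + d) => rsubmx z) (consrV s0)); last exact: continuous_consrV2.
  exact: continuous_rsubmx.
apply/for_continuousP => a a0.
have ea0 : 0 < e * a by rewrite mulr_gt0.
move/for_continuousP : cg => /(_ _ ea0); apply: filterS => z.
rewrite {1}/phi /s0 psolveK subrr sub0r normrN -/s0 => h.
have := phi_norm s0 (psolve (z 0 0) (rsubmx z)) (rsubmx z).
rewrite /phi psolveK => h2; rewrite -(ler_pM2l e0); apply: le_trans h2 _.
by rewrite distrC.
Qed.

(** Both images have first coordinate [u], so this coordinate adds nothing to the pairing, while the
    first coordinates of the arguments only increase the squared distance: the constant [e]
    survives. *)
Lemma strongly_monotone_psolve u :
  strongly_monotone e (fun y => rsubmx (T (consrV (psolve u y) y))).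
Proof.
move=> y z; have := mT (consrV (psolve u y) y) (consrV (psolve u z) z).
rewrite dotv_consrVB !psolveK subrr mul0r add0r; apply: le_trans.
by rewrite consrVB dotv_consrV ler_pM2l// lerDr -expr2 sqr_ge0.
Qed.

Lemma continuous_psolve2 u : continuous (psolve u).
Proof.
move=> y.
have h z : psolve u z = psolve ((consrV u z : 'rV[R]_(1 + d)) 0 0) (rsubmx (consrV u z)).
  by rewrite consrV0 rsubmx_consrV.
rewrite (funext h); apply: (@continuous_comp _ _ _ (consrV u) (fun z : 'rV[R]_(1 + d) => psolve (z 0 0) (rsubmx z))).
  exact: continuous_consrV2.
exact: continuous_psolve.
Qed.

Lemma continuous_rsubmx_psolve u :
  continuous (fun y => rsubmx (T (consrV (psolve u y) y))).
Proof.
move=> y; apply: (@continuous_comp _ _ _ (fun y => T (consrV (psolve u y) y)) (fun z : 'rV[R]_(1 + d) => rsubmx z)); last exact: continuous_rsubmx.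
apply: (@continuous_comp _ _ _ (fun y => consrV (psolve u y) y) T); last exact: cT.
apply: (@continuous_consrV _ _ _ (psolve u) id); first exact: continuous_psolve2.
by move=> x; exact: cvg_id.
Qed.

End PartialInverse.

Lemma strongly_monotone_surj d (T : 'rV[R]_d -> 'rV[R]_d) (e : R) : 0 < e ->
  continuous T -> strongly_monotone e T -> forall y, exists x, T x = y.
Proof.
move=> e0; elim: d T => [|d IH] T cT mT y; first by exists y; apply/rowP => -[].
have [z zE] := IH _ (@continuous_rsubmx_psolve d T e e0 cT mT (y 0 0))
  (@strongly_monotone_psolve d T e e0 cT mT (y 0 0)) (rsubmx (y : 'rV[R]_(1 + d))).
exists (consrV (@psolve d T e e0 cT mT (y 0 0) z) z).
rewrite -[LHS](@consrV_eta _ d) -[RHS](@consrV_eta _ d); congr consrV => //.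
exact: psolveK.
Qed.

(** The bound [|x - y| <= (d / e) |T x - T y|] makes any right inverse two-sided and Lipschitz. *)
Lemma strongly_monotone_bij d (T : 'rV[R]_d -> 'rV[R]_d) (e : R) : 0 < e ->
  continuous T -> strongly_monotone e T ->
  exists S : 'rV[R]_d -> 'rV[R]_d, [/\ cancel T S, cancel S T & continuous S].
Proof.
move=> e0 cT mT; have [S ST] := choice (strongly_monotone_surj e0 cT mT).
have nT := strongly_monotone_norm e0 mT.
exists S; split=> //; first move=> x.
  apply/eqP; rewrite -subr_eq0 -normr_le0; apply: le_trans (nT _ _) _.
  by rewrite ST subrr normr0 mulr0.
move=> x; apply/for_continuousP => a a0.
have c0 : 0 < d%:R / e + 1 by rewrite ltr_wpDl// divr_ge0// ltW.
have b0 : 0 < a / (d%:R / e + 1) by rewrite divr_gt0.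
have /for_continuousP/(_ _ b0) : {for x, continuous (@id 'rV[R]_d)} by exact: cvg_id.
apply: filterS => y; rewrite ler_pdivlMr//.
move=> h; apply: le_trans (nT _ _) _; rewrite !ST; apply: le_trans h.
by rewrite mulrDr mulr1 mulrC lerDl.
Qed.

End Calculus.

(** * Change of variables *)

Section ChangeOfVariables.
Context {R : realType}.
Notation mu := (@lebesgue_measure R).

Lemma MVT_mono_le (F F' : R -> R) (e : R) :
  (forall t : R, is_derive t (1 : R) F (F' t)) -> (forall t, e <= F' t) ->
  forall s t, s <= t -> e * (t - s) <= F t - F s.
Proof.
move=> dF eF s t st.
have cF : {within `[s, t], continuous F}.
  by apply: derivable_within_continuous => x _; have [] := dF x.
have [c _ ->] := MVT_segment st (fun x _ => dF x) cF.
by rewrite ler_wpM2r// subr_ge0.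
Qed.

Lemma integral_bigcup_itv (f : R -> R) (a b : nat -> R) :
  continuous f -> (forall x, 0 <= f x) ->
  (forall n, a n.+1 <= a n) -> (forall n, b n <= b n.+1) ->
  (forall x, exists n, a n <= x <= b n) ->
  (\int[mu]_(x in `[a n, b n]) (f x)%:E @[n --> \oo] --> \int[mu]_x (f x)%:E)%E.
Proof.
move=> cf f0 an bn abx.
have -> : [set: R] = \bigcup_n `[a n, b n]%classic.
  apply/seteqP; split=> [x _|//]; have [n h] := abx x.
  by exists n => //=; rewrite in_itv.
apply: ge0_nondecreasing_set_cvg_integral.
- apply/nondecreasing_seqP => n; apply/subsetPset => x /=.
  rewrite !in_itv/= => /andP[h1 h2]; apply/andP; split.
    exact: le_trans (an n) h1.
  exact: le_trans h2 (bn n).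
- by move=> n; exact: measurable_itv.
- move=> n; apply/measurable_EFinP; apply: measurable_funTS.
  exact: continuous_measurable_fun.
- by move=> n x _; rewrite lee_fin.
Qed.

(** The intervals [[-n, n]] exhaust the line, and so do their images because the slope is at least
    [e]; on each of them this is substitution on a segment. *)
Lemma integration_by_substitutionR (F F' G : R -> R) (e : R) : 0 < e ->
  (forall t : R, is_derive t (1 : R) F (F' t)) -> continuous F' ->
  (forall t, e <= F' t) -> continuous G -> (forall x, 0 <= G x) ->
  (\int[mu]_x (G (F x) * F' x)%:E = \int[mu]_x (G x)%:E)%E.
Proof.
move=> e0 dF cF' eF' cG G0.
have mono := MVT_mono_le dF eF'.
have cF : continuous F.
  by move=> x; apply/differentiable_continuous/derivable1_diffP; have [] := dF x.
have F'E : derive1 F = F' by apply/funext => x; rewrite derive1E; have [_ ->] := dF x.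
have h1 := @integral_bigcup_itv (fun x => G (F x) * F' x) (fun n => - n%:R) (fun n => n%:R).
have h2 := @integral_bigcup_itv G (fun n => F (- n%:R)) (fun n => F n%:R).
have {}h1 := cvg_lim (@ereal_hausdorff R) (h1 _ _ _ _ _).
have {}h2 := cvg_lim (@ereal_hausdorff R) (h2 _ _ _ _ _).
rewrite -h1; first rewrite -h2 //.
- congr (limn _); apply/funext => n.
  rewrite (@integration_by_substitution_increasing R F G (- n%:R) n%:R).
  + by rewrite F'E.
  + by rewrite lerNl (le_trans _ (ler0n _ n))// oppr_le0.
  + move=> x y _ _ xy; rewrite -subr_gt0.
    by apply: lt_le_trans (mono _ _ (ltW xy)); rewrite mulr_gt0 ?subr_gt0.
  + by move=> x _; rewrite F'E; exact: cF'.
  + by rewrite F'E; apply/cvg_ex; exists (F' (- n%:R)); apply: cvg_at_right_filter; exact: cF'.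
  + by rewrite F'E; apply/cvg_ex; exists (F' n%:R); apply: cvg_at_left_filter; exact: cF'.
  + split=> [x _||]; first by have [] := dF x.
      by apply: cvg_at_right_filter; exact: cF.
    by apply: cvg_at_left_filter; exact: cF.
  + exact: continuous_subspaceT.
- move=> n; rewrite -subr_ge0.
  have st : - n.+1%:R <= - n%:R :> R by rewrite lerN2 ler_nat.
  by apply: le_trans (mono _ _ st); rewrite mulr_ge0 ?(ltW e0)// subr_ge0.
- move=> n; rewrite -subr_ge0.
  have st : n%:R <= n.+1%:R :> R by rewrite ler_nat.
  by apply: le_trans (mono _ _ st); rewrite mulr_ge0 ?(ltW e0)// subr_ge0.
- move=> x; exists (Num.truncn (`|x - F 0| / e)).+1.
  set n := (X in X.+1).
  have n0 : 0 <= n.+1%:R :> R by [].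
  have hn : `|x - F 0| <= e * n.+1%:R.
    rewrite mulrC -ler_pdivrMr//; apply: ltW; exact: truncnS_gt.
  have k1 := mono 0 n.+1%:R n0.
  have k2 := mono (- n.+1%:R) 0 _; rewrite oppr_le0 in k2.
  move: k1 (k2 n0) hn; rewrite subr0 sub0r opprK ler_norml => k1 {}k2 /andP[k3 k4].
  by apply/andP; split; lra.
- move=> x; apply: continuousM; last exact: cF'.
  by apply: continuous_comp; [exact: cF|exact: cG].
- by move=> x; rewrite mulr_ge0//; apply: le_trans (eF' x); exact: ltW.
- by move=> n; rewrite lerN2 ler_nat.
- by move=> n; rewrite ler_nat.
- move=> x; exists (Num.truncn `|x|).+1; rewrite -ler_norml; apply: ltW; exact: truncnS_gt.
Qed.

(** Strong monotonicity at [x] and [x + s v], divided by [s^2], is the claim up to the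
    differentiability error, which can be made smaller than any [a > 0]. *)
Lemma strongly_monotone_coercive d (T : 'rV[R]_d -> 'rV[R]_d) (H : 'M[R]_d) (e : R) (x : 'rV[R]_d) :
  is_diff x T (mulmxr H) -> strongly_monotone e T ->
  forall v, e * dotv v v <= dotv (v *m H) v.
Proof.
move=> dT mT v.
have [->|v0] := eqVneq v 0; first by rewrite mul0mx !dotv0r mulr0.
have nv : 0 < `|v| by rewrite normr_gt0.
apply/ler_addgt0Pr => a a0.
(* Chosen so that the pairing of the error with [v] is at most [s a]; the dimension enters because
   [dotv] is bounded through sup norms. *)
pose b := a / (d.+1%:R * `|v| ^+ 2).
have b0 : 0 < b by rewrite divr_gt0// mulr_gt0// exprn_gt0.
have /nbhs_ballP[r /= r0 hr] := is_diff_epsP dT b0.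
pose s := r / (2 * `|v|).
have s0 : 0 < s by rewrite divr_gt0// mulr_gt0.
have : ball 0 r (s *: v).
  rewrite -ball_normE /ball_/= sub0r normrN normrZ (gtr0_norm s0) /s.
  by rewrite invfM mulrA mulfVK ?gt_eqF//; lra.
move=> /hr /=; rewrite normrZ (gtr0_norm s0); set w := _ - _ - _ => hw.
have := mT (s *: v + x) x; rewrite addrK.
have -> : T (s *: v + x) - T x = w + s *: (v *m H) by rewrite /w -scalemxAl subrK.
have dZ (y z : 'rV[R]_d) : dotv y (s *: z) = s * dotv y z.
  by rewrite /dotv linearZ/= -scalemxAr mxE.
have dZl (y z : 'rV[R]_d) : dotv (s *: y) z = s * dotv y z.
  by rewrite /dotv -scalemxAl mxE.
have dD (y y' z : 'rV[R]_d) : dotv (y + y') z = dotv y z + dotv y' z.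
  by rewrite /dotv mulmxDl mxE.
rewrite !dZ dD !dZl mulrCA ler_pM2l// mulrCA.
have hwv : dotv w v <= s * a.
  apply: le_trans (dotv_le _ _) _.
  have : d%:R * (`|w| * `|v|) <= d.+1%:R * (b * (s * `|v|) * `|v|).
    by rewrite ler_pM// ?mulr_ge0// ?ler_nat// ler_wpM2r.
  move/le_trans; apply; rewrite le_eqVlt; apply/orP; left; apply/eqP.
  by rewrite /b; field; rewrite ?gt_eqF//= pnatr_eq0.
move=> h; rewrite -(ler_pM2l s0); apply: le_trans h _.
by rewrite mulrDr addrC lerD2l.
Qed.

Lemma coercive_posdef d (H : 'M[R]_d) (e : R) : 0 < e ->
  (forall v, e * dotv v v <= dotv (v *m H) v) -> posdef H.
Proof.
move=> e0 h v v0; apply: lt_le_trans (h v).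
by rewrite mulr_gt0// mulmx_tr_gt0.
Qed.

Lemma is_diff_affine (V W : normedModType R) (f : V -> W) (L : {linear V -> W}) x :
  continuous L -> (forall h, f (h + x) - f x = L h) -> is_diff x f L.
Proof.
move=> cL fL; apply: is_diff_eps => // e e0; apply: filterE => h.
by rewrite fL subrr normr0 mulr_ge0// ltW.
Qed.

Lemma is_diff_mulmxr m n p (f : 'rV[R]_m -> 'rV[R]_n) (g : 'rV[R]_n -> 'rV[R]_p) A B x :
  is_diff x f (mulmxr A) -> is_diff (f x) g (mulmxr B) ->
  is_diff x (g \o f) (mulmxr (A *m B)).
Proof.
move=> df dg; have := is_diff_comp df dg; congr (is_diff _ _ _).
by apply/funext => h /=; rewrite mulmxA.
Qed.

Lemma mulmx00 d (h : 'rV[R]_(1 + d)) (A : 'M[R]_(1 + d)) :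
  (h *m A) 0 0 = (lsubmx h *m (A 0 0)%:M + rsubmx h *m dlsubmx A) 0 0.
Proof.
have row0 (X : 'M[R]_1) (Y : 'rV[R]_d) : row_mx X Y 0 0 = X 0 0.
  by rewrite -(row_mxEl X Y); congr (row_mx X Y 0 _); exact/val_inj.
by rewrite -[h in LHS]hsubmxK -[A in LHS]submxK mul_row_block row0 ulsubmx_scalar.
Qed.

(* [T] is the composition of [G : (t, y) |-> (T_0 (t, y), y)], with inverse [Sg],
   and of a map fixing the first coordinate; correspondingly
   [\det H = H 0 0 * \det (schur H)]. *)
Section Step.
Variables (d : nat) (T : 'rV[R]_(1 + d) -> 'rV[R]_(1 + d)) (H : 'rV[R]_(1 + d) -> 'M[R]_(1 + d)) (e : R).
Hypothesis e0 : 0 < e.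
Hypothesis cT : continuous T.
Hypothesis mT : strongly_monotone e T.
Hypothesis dT : forall x, is_diff x T (mulmxr (H x)).

Let sg := @psolve R d T e e0 cT mT.
Let Sg (z : 'rV[R]_(1 + d)) : 'rV[R]_(1 + d) := consrV (sg (z 0 0) (rsubmx z)) (rsubmx z).
Let G (z : 'rV[R]_(1 + d)) : 'rV[R]_(1 + d) := consrV (T z 0 0) (rsubmx z).

Lemma H00_ge x : e <= H x 0 0.
Proof.
have := strongly_monotone_coercive (dT x) mT (delta_mx 0 0).
have hd (v : 'rV[R]_(1 + d)) : dotv v (delta_mx 0 0) = v 0 0.
  by rewrite /dotv trmx_delta -colE mxE.
by rewrite !hd -rowE !mxE !eqxx mulr1.
Qed.

Lemma H00_neq0 x : H x 0 0 != 0.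
Proof. by rewrite gt_eqF//; apply: lt_le_trans (H00_ge x). Qed.

(** The Jacobian of [G], lower triangular in the row-vector convention. *)
Definition Gmx x : 'M[R]_(1 + d) := block_mx (H x 0 0)%:M 0 (dlsubmx (H x)) 1%:M.

Lemma is_diff_G x : is_diff x G (mulmxr (Gmx x)).
Proof.
apply: is_diff_eps; first exact: continuous_mulmxr.
move=> a a0; have := is_diff_epsP (dT x) a0; apply: filterS => h /= hT.
apply: le_trans hT; set w := T (h + x) - T x - h *m H x.
have -> : G (h + x) - G x - h *m Gmx x = consrV (w 0 0) 0.
  rewrite /G consrVB linearD/= addrK.
  have -> : h *m Gmx x = consrV ((h *m H x) 0 0) (rsubmx h).
    rewrite -{1}(hsubmxK h) /Gmx mul_row_block mulmx0 add0r mulmx1.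
    rewrite -[X in _ = consrV X _]/((h *m H x) 0 0) /consrV; congr row_mx.
    apply/matrixP => i j; rewrite !ord1 [RHS]mxE.
    by rewrite mulmx00.
  by rewrite consrVB subrr /w; congr consrV; rewrite !mxE.
apply: normr_rV_le => // i; case: (split_ordP i) => j ->.
  by rewrite consrVl; exact: normr_coord_le.
by rewrite consrVS mxE normr0.
Qed.

Lemma Gmx_unit x : Gmx x \in unitmx.
Proof. by rewrite unitmxE det_lblock det1 mulr1 det_scalar1 unitfE H00_neq0. Qed.

Lemma SgK : cancel Sg G.
Proof.
by move=> z; rewrite /G /Sg psolveK rsubmx_consrV consrV_eta.
Qed.

Lemma continuous_Sg : continuous Sg.
Proof.
apply: continuous_consrV; first exact: continuous_psolve.
exact: continuous_rsubmx.
Qed.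

(** Chain rule through [y], [(u, y)], [Sg], [T] and the projection. The first two Jacobians multiply
    to the row matrix of [mulmx_schur], so that projecting its product with [H] leaves the Schur
    complement. *)
Lemma is_diff_Tu u y :
  is_diff y (fun y => rsubmx (T (consrV (sg u y) y))) (mulmxr (schur (H (consrV (sg u y) y)))).
Proof.
have SgE z : Sg (consrV u z) = consrV (sg u z) z.
  by rewrite /Sg consrV0 rsubmx_consrV.
have d1 : is_diff y (consrV u) (mulmxr (row_mx 0 1%:M : 'M[R]_(d, 1 + d))).
  apply: is_diff_affine; first exact: continuous_mulmxr.
  move=> h; rewrite consrVB subrr addrK/= mul_mx_row mulmx0 mulmx1.
  by rewrite /consrV; congr row_mx; apply/rowP => i; rewrite !mxE.
have d2 : is_diff (consrV u y) Sg (mulmxr (invmx (Gmx (consrV (sg u y) y)))).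
  apply: (is_diff_inverse (T := G) SgK); first exact: continuous_Sg.
    by rewrite SgE; exact: is_diff_G.
  exact: Gmx_unit.
have d3 := is_diff_mulmxr d1 d2.
have d4 : is_diff ((Sg \o consrV u) y) T (mulmxr (H (consrV (sg u y) y))).
  by rewrite /= SgE; exact: dT.
have d5 := is_diff_mulmxr d3 d4.
have d6 : is_diff ((T \o (Sg \o consrV u)) y) (fun z : 'rV[R]_(1 + d) => rsubmx z)
    (mulmxr (col_mx 0 1%:M : 'M[R]_(1 + d, d))).
  apply: is_diff_affine; first exact: continuous_mulmxr.
  move=> h; rewrite linearD/= addrK -[in RHS](hsubmxK h) mul_row_col mulmx0 add0r.
  by rewrite mulmx1.
have := is_diff_mulmxr d5 d6; set x := consrV (sg u y) y.
have -> : (fun z : 'rV[R]_(1 + d) => rsubmx z) \o (T \o (Sg \o consrV u)) =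
  fun y => rsubmx (T (consrV (sg u y) y)).
  by apply/funext => z /=; rewrite SgE.
congr (is_diff _ _ _); congr (mulmxr _); rewrite -!mulmxA.
have -> : row_mx 0 1%:M *m (invmx (Gmx x) *m (H x *m col_mx 0 1%:M)) =
  row_mx (- (H x 0 0)^-1 *: (1%:M *m dlsubmx (H x))) 1%:M *m H x *m (col_mx 0 1%:M : 'M[R]_(1 + d, d)).
  rewrite !mulmxA; congr (_ *m _ *m _); rewrite -[RHS](mulmxK (Gmx_unit x)).
  congr (_ *m _); rewrite /Gmx mul_row_block mul_mx_scalar mulmx0 !mul1mx add0r.
  by rewrite scalerA mulrN divff ?H00_neq0// scaleN1r addNr.
rewrite (mulmx_schur _ (H00_neq0 x)) mul_row_col mulmx0 add0r mulmx1.
by rewrite mul1mx.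
Qed.

End Step.

Lemma continuous_mulR (X : topologicalType) (f g : X -> R) :
  continuous f -> continuous g -> continuous (fun x => f x * g x).
Proof. by move=> cf cg x; exact: (continuousM (cf x) (cg x)). Qed.

Lemma continuous_addR (X : topologicalType) (f g : X -> R) :
  continuous f -> continuous g -> continuous (fun x => f x + g x).
Proof. by move=> cf cg x; exact: (continuousD (cf x) (cg x)). Qed.

Lemma schurE d (A : 'M[R]_(1 + d)) i j :
  schur A i j = A (rshift 1 i) (rshift 1 j) - (A 0 0)^-1 * (A (rshift 1 i) 0 * A 0 (rshift 1 j)).
Proof.
rewrite /schur !mxE big_ord1 !mxE; congr (_ - _ * (A _ _ * A _ _)); exact/val_inj.
Qed.

Lemma continuous_schur (X : topologicalType) d (H : X -> 'M[R]_(1 + d)) :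
  (forall i j, continuous (fun x => H x i j)) -> (forall x, H x 0 0 != 0) ->
  forall i j, continuous (fun x => schur (H x) i j).
Proof.
move=> cH H0 i j x; rewrite (funext (fun x => schurE (H x) i j)).
pose f1 (x : X) : R := H x (rshift 1 i) (rshift 1 j).
pose f2 (x : X) : R := (H x 0 0)^-1.
pose f3 (x : X) : R := H x (rshift 1 i) 0.
pose f4 (x : X) : R := H x 0 (rshift 1 j).
have c2 : {for x, continuous f2} by apply: continuousV; [exact: H0|exact: cH].
have c34 : {for x, continuous (fun x => f3 x * f4 x)} by apply: continuousM; exact: cH.
have c1 : {for x, continuous f1} by exact: cH.
exact: (continuousB c1 (continuousM c2 c34)).
Qed.

Lemma is_diff_continuous (V W : normedModType R) (f : V -> W) (df : V -> V -> W) :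
  (forall x, is_diff x f (df x)) -> continuous f.
Proof. by move=> h x; apply: differentiable_continuous; have [] := h x. Qed.

Theorem change_of_variables d (T : 'rV[R]_d -> 'rV[R]_d) (H : 'rV[R]_d -> 'M[R]_d)
    (g : 'rV[R]_d -> R) (e : R) : 0 < e ->
  (forall x, is_diff x T (mulmxr (H x))) ->
  (forall i j, continuous (fun x => H x i j)) ->
  strongly_monotone e T -> continuous g -> (forall x, 0 <= g x) ->
  iint (fun x => (g (T x) * \det (H x))%:E) = iint (fun x => (g x)%:E).
Proof.
move=> e0; elim: d T H g => [|d IH]; [|rewrite -[d.+1]/(1 + d)%N] => T H g dT cH mT cg g0.
  by rewrite /= det_mx00 mulr1; congr (g _)%:E; apply/rowP => -[].
have cT : continuous T by exact: (is_diff_continuous dT).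
have pH x : posdef (H x).
  exact: (coercive_posdef e0 (strongly_monotone_coercive (dT x) mT)).
have dH x : 0 <= \det (H x) by apply/ltW/posdef_det_gt0.
have H0 := H00_neq0 e0 mT dT.
pose sg := @psolve R d T e e0 cT mT.
pose F z := g (T z) * \det (H z).
have F0 z : 0 <= F z by rewrite mulr_ge0.
have cgT : continuous (g \o T) by move=> x; apply: continuous_comp; [exact: cT|exact: cg].
have cF : continuous F.
  by apply: continuous_mulR; [exact: cgT|exact: continuous_det].
pose K z := g (T z) * \det (schur (H z)).
have K0 z : 0 <= K z by rewrite mulr_ge0//; apply/ltW/posdef_det_gt0/posdef_schur.
have cK : continuous K.
  apply: continuous_mulR; first exact: cgT.
  by apply: continuous_det; apply: continuous_schur.
pose S (z : 'rV[R]_(1 + d)) : 'rV[R]_(1 + d) := consrV (sg (z 0 0) (rsubmx z)) (rsubmx z).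
have cS : continuous S by exact: continuous_Sg.
(* [L (u, y)] is what is left of the integrand once the pivot [H 0 0] has been absorbed by the
   substitution [u = T_0 (t, y)]. *)
pose L z := K (S z).
have cL : continuous L by move=> x; apply: (@continuous_comp _ _ _ S K); [exact: cS|exact: cK].
have L0 z : 0 <= L z by exact: K0.
have LE u y : L (consrV u y) = g (consrV u (rsubmx (T (consrV (sg u y) y)))) *
    \det (schur (H (consrV (sg u y) y))).
  rewrite /L /K /S consrV0 rsubmx_consrV; congr (g _ * _).
  by rewrite -[LHS]consrV_eta psolveK.
(* The first coordinate is moved innermost for the substitution, then back outermost so that the
   induction hypothesis treats [y] at fixed [u]. *)
transitivity (iint (fun y : 'rV[R]_d => \int[mu]_u (L (consrV u y))%:E))%E.
  rewrite iintS (iint_swap (f := fun t y => (F (consrV t y))%:E)).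
  - congr iint; apply/funext => y.
    have sub := @integration_by_substitutionR (fun t => T (consrV t y) 0 0)
      (fun t => H (consrV t y) 0 0) (fun u => L (consrV u y)) e e0.
    apply: etrans _ (sub _ _ _ _ _).
    + apply: eq_integral => t _; congr EFin; rewrite /F det_schur//.
      rewrite /L /S consrV0 rsubmx_consrV /sg psolve_phi /K; ring.
    + move=> t.
      pose T0 (z : 'rV[R]_(1 + d)) := T z 0 0.
      have dT0 z : differentiable T0 z.
        apply: (@differentiable_comp _ _ _ _ T (fun z : 'rV[R]_(1 + d) => z 0 0)).
          by have [] := dT z.
        exact: differentiable_coord.
      have E s : consrV s y = consrV 0 y + s *: (delta_mx 0 0 : 'rV[R]_(1 + d)).
        apply/rowP => i; rewrite [RHS]mxE; case: (split_ordP i) => j ->.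
          by rewrite !consrVl add0r !mxE eqxx (ord1 j) (_ : _ == _)// mulr1.
        by rewrite !consrVS !mxE mulr0 addr0.
      have dd : derivable T0 (consrV 0 y + t *: (delta_mx 0 0 : 'rV[R]_(1 + d))) (delta_mx 0 0).
        by apply: diff_derivable.
      have := is_derive_line dd.
      rewrite -E; congr (is_derive _ _ _ _); first by apply/funext => s; rewrite /T0 -E.
      rewrite -derive_rV_coord; last by have [] := dT (consrV t y).
      by have [? dE] := dT (consrV t y); rewrite deriveE// dE /= -rowE mxE.
    + by move=> t; apply: (@continuous_comp _ _ _ (fun t => consrV t y) (fun z => H z 0 0)); [exact: continuous_consrV1|exact: cH].
    + by move=> t; exact: (H00_ge mT dT).
    + by move=> t; apply: (@continuous_comp _ _ _ (fun t => consrV t y) L); [exact: continuous_consrV1|exact: cL].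
    + by move=> u; exact: L0.
  - by apply: (@mrV_pmeas R d (fun z => (F z)%:E)); exact: continuous_mrV.
  - by move=> t y; rewrite lee_fin.
rewrite -(iint_swap (f := fun u y => (L (consrV u y))%:E)).
- rewrite iintS; apply: eq_integral => u _.
  under [in LHS]eq_fun do rewrite LE.
  apply: (IH (fun y => rsubmx (T (consrV (sg u y) y))) (fun y => schur (H (consrV (sg u y) y)))
    (fun y => g (consrV u y))).
  + by move=> y; exact: is_diff_Tu.
  + move=> i j y; apply: (@continuous_comp _ _ _ (fun y => consrV (sg u y) y) (fun z => schur (H z) i j)).
      apply: (@continuous_consrV _ _ _ (sg u) id); first exact: continuous_psolve2.
      by move=> x; exact: cvg_id.
    exact: continuous_schur.
  + exact: strongly_monotone_psolve.
  + by move=> y; apply: (@continuous_comp _ _ _ (consrV u) g); [exact: continuous_consrV2|exact: cg].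
  + by move=> y.
- by apply: (@mrV_pmeas R d (fun z => (L z)%:E)); exact: continuous_mrV.
- by move=> u y; rewrite lee_fin.
Qed.

End ChangeOfVariables.

(** * Brenier maps *)

Section Convexity.
Context {R : realType}.

Lemma MVT_line d (f : 'rV[R]_d -> R) (x v : 'rV[R]_d) (s : R) :
  (forall y, derivable f y v) ->
  exists2 t : R, 0 < t < 1 & f (x + s *: v) - f x = s * 'D_v f (x + (t * s) *: v).
Proof.
move=> df.
have [t t01 ft] : exists2 t : R, 0 < t < 1 &
    f (x + (1 * s) *: v) - f (x + (0 * s) *: v) = 'D_v f (x + (t * s) *: v) * s.
  apply: (@MVT01 _ (fun t => f (x + (t * s) *: v)) (fun t => 'D_v f (x + (t * s) *: v) * s)) => t _.
  apply: (@is_derive1_comp _ (fun s => f (x + s *: v)) (fun t => t * s)).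
    exact: is_derive_line.
  by apply: is_derive_eq; rewrite scaler0 add0r scaler1.
by exists t => //; move: ft; rewrite mul1r mul0r scale0r addr0 mulrC.
Qed.

(** Mean value theorem for the first difference [g] in the direction [v], then for ['D_v f] in the
    direction [u]. *)
Lemma second_difference d (f : 'rV[R]_d -> R) (x u v : 'rV[R]_d) (s : R) :
  smooth f -> 0 < s ->
  exists2 z, `|z - x| <= s * (`|u| + `|v|) &
  f (x + s *: u + s *: v) - f (x + s *: u) - f (x + s *: v) + f x =
  s ^+ 2 * 'D_u ('D_v f) z.
Proof.
move=> sf s0; pose g y := f (s *: u + y) - f y.
have dg y : is_derive y v g ('D_v f (s *: u + y) - 'D_v f y).
  have dfs : is_derive y v (fun y => f (s *: u + y)) ('D_v f (s *: u + y)).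
    have E : (fun h : R => h^-1 *: (f (s *: u + (h *: v + y)) - f (s *: u + y))) =
             (fun h : R => h^-1 *: (f (h *: v + (s *: u + y)) - f (s *: u + y))).
      by apply/funext => h; rewrite addrCA.
    have dfy : derivable f (s *: u + y) v by exact: smooth_derivable.
    by split; rewrite ?/derivable ?/derive /= E.
  have df : is_derive y v f ('D_v f y) by apply/derivableP; exact: smooth_derivable.
  exact: is_deriveB.
have [t /andP[t0 t1] gE] := @MVT_line d g x v s (fun y => @ex_derive _ _ _ _ _ _ _ (dg y)).
have [t' /andP[t0' t1'] gE'] := @MVT_line d ('D_v f) (x + (t * s) *: v) u s
   (fun y => @smooth_derivable R d _ y u (smooth_derive v sf)).
exists (x + (t * s) *: v + (t' * s) *: u).
  have -> (a b : 'rV[R]_d) : x + a + b - x = b + a.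
    by rewrite addrAC [x + a]addrC addrK addrC.
  apply: le_trans (ler_normD _ _) _.
  rewrite !normrZ mulrDr !gtr0_norm ?mulr_gt0// lerD// ler_wpM2r// ler_piMl ?ltW//.
move: gE; have [_ ->] := dg (x + (t * s) *: v).
rewrite [s *: u + _]addrC gE' mulrA -expr2 => <-; rewrite /g.
by rewrite [s *: u + (_ + _)]addrCA addrA [s *: u + x]addrC opprB; ring.
Qed.

(** The second difference is symmetric in [u] and [v]; for small [s] it evaluates each mixed
    derivative at a point near [x], and continuity concludes. *)
Lemma smooth_derive_sym d (f : 'rV[R]_d -> R) (x u v : 'rV[R]_d) : smooth f ->
  'D_u ('D_v f) x = 'D_v ('D_u f) x.
Proof.
move=> sf; apply/eqP; rewrite -subr_eq0 -normr_le0; apply/ler_addgt0Pr => a a0.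
rewrite add0r.
have a20 : 0 < a / 2 by rewrite divr_gt0.
have c1 := smooth_continuous (smooth_derive u (smooth_derive v sf)).
have c2 := smooth_continuous (smooth_derive v (smooth_derive u sf)).
have /nbhs_ballP[r1 /= r10 h1] := (for_continuousP _ _).1 (c1 x) _ a20.
have /nbhs_ballP[r2 /= r20 h2] := (for_continuousP _ _).1 (c2 x) _ a20.
pose r := Num.min r1 r2; have r0 : 0 < r by rewrite lt_min r10.
have n0 : 0 < `|u| + `|v| + 1 by rewrite ltr_wpDl// addr_ge0.
have [s s0 sr] : exists2 s : R, 0 < s & s * (`|u| + `|v|) < r.
  pose s := r / (2 * (`|u| + `|v| + 1)).
  have s0 : 0 < s by rewrite divr_gt0// mulr_gt0.
  exists s => //; have h : s * (`|u| + `|v| + 1) = r / 2.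
    by rewrite /s; field; rewrite gt_eqF.
  apply: (@le_lt_trans _ _ (r / 2)); last by rewrite ltr_pdivrMr// ltr_pMr// ltr1n.
  by rewrite -h ler_wpM2l ?(ltW s0)// lerDl.
have [z1 z1x e1] := second_difference x u v sf s0.
have [z2 z2x e2] := second_difference x v u sf s0.
have e12 : 'D_u ('D_v f) z1 = 'D_v ('D_u f) z2.
  have s20 : s ^+ 2 != 0 by rewrite expf_neq0// gt_eqF.
  have E : f (x + s *: u + s *: v) - f (x + s *: u) - f (x + s *: v) + f x =
           f (x + s *: v + s *: u) - f (x + s *: v) - f (x + s *: u) + f x.
    by rewrite [x + s *: v + _]addrAC; congr (_ + _); exact: addrAC.
  exact: (mulfI s20 (etrans (esym e1) (etrans E e2))).
have b1 : ball x r1 z1.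
  rewrite -ball_normE /ball_/= distrC; apply: le_lt_trans z1x _.
  by apply: lt_le_trans sr _; rewrite ge_min lexx.
have b2 : ball x r2 z2.
  rewrite -ball_normE /ball_/= distrC; apply: le_lt_trans z2x _.
  by rewrite [_ + `|u|]addrC; apply: lt_le_trans sr _; rewrite ge_min lexx orbT.
have := h1 _ b1; have := h2 _ b2 => /= k2 k1.
rewrite e12 in k1; apply: le_trans (ler_distD ('D_v ('D_u f) z2) _ _) _.
rewrite (splitr a); apply: lerD; first exact: k1.
by rewrite distrC; exact: k2.
Qed.

Lemma grad_coord d (f : 'rV[R]_d -> R) i : (fun x => grad f x 0 i) = 'D_(ebasis R i) f.
Proof. by apply/funext => x; rewrite mxE. Qed.

Lemma smooth_grad d (f : 'rV[R]_d -> R) : smooth f -> smooth_map (grad f).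
Proof. by move=> sf i; rewrite grad_coord; exact: smooth_derive. Qed.

Lemma hessE d (f : 'rV[R]_d -> R) x : hess f x = jac (grad f) x.
Proof. by apply/matrixP => i j; rewrite !mxE grad_coord. Qed.

Lemma hess_coord d (f : 'rV[R]_d -> R) i j :
  (fun x => hess f x i j) = 'D_(ebasis R i) ('D_(ebasis R j) f).
Proof. by apply/funext => x; rewrite mxE. Qed.

Lemma smooth_hess d (f : 'rV[R]_d -> R) i j : smooth f -> smooth (fun x => hess f x i j).
Proof. by move=> sf; rewrite hess_coord; do 2!apply: smooth_derive. Qed.

Lemma hess_sym d (f : 'rV[R]_d -> R) x : smooth f -> (hess f x)^T = hess f x.
Proof.
by move=> sf; apply/matrixP => i j; rewrite !mxE; exact: smooth_derive_sym.
Qed.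

Lemma is_diff_grad d (f : 'rV[R]_d -> R) x : smooth f ->
  is_diff x (grad f) (mulmxr (hess f x)).
Proof.
move=> sf; rewrite hessE; apply: (is_diff_jac (k := 0)) => j.
exact/smooth_Ck/smooth_grad.
Qed.

Lemma continuous_hess d (f : 'rV[R]_d -> R) i j : smooth f ->
  continuous (fun x => hess f x i j).
Proof. by move=> sf; exact/smooth_continuous/smooth_hess. Qed.

Lemma smooth_map_continuous d (T : 'rV[R]_d -> 'rV[R]_d) : smooth_map T -> continuous T.
Proof. by move=> sT x; apply: continuous_rV => i; exact: (smooth_continuous (sT i)). Qed.

Lemma continuous_grad d (f : 'rV[R]_d -> R) : smooth f -> continuous (grad f).
Proof. by move=> sf; exact/smooth_map_continuous/smooth_grad. Qed.

Lemma dotvBl d (x y z : 'rV[R]_d) : dotv (x - y) z = dotv x z - dotv y z.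
Proof. by rewrite /dotv mulmxBl !mxE. Qed.

Lemma dotvDl d (x y z : 'rV[R]_d) : dotv (x + y) z = dotv x z + dotv y z.
Proof. by rewrite /dotv mulmxDl mxE. Qed.

Lemma dotvZl d (a : R) (y z : 'rV[R]_d) : dotv (a *: y) z = a * dotv y z.
Proof. by rewrite /dotv -scalemxAl mxE. Qed.

Lemma dotvZr d (a : R) (y z : 'rV[R]_d) : dotv y (a *: z) = a * dotv y z.
Proof. by rewrite /dotv linearZ/= -scalemxAr mxE. Qed.

Lemma derive_gradE d (f : 'rV[R]_d -> R) (x v : 'rV[R]_d) : smooth f ->
  'D_v f x = dotv (grad f x) v.
Proof.
move=> sf; rewrite (Ck_deriveE x v (smooth_Ck 1 sf)) dotvE; apply: eq_bigr => i _.
by rewrite mxE mulrC.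
Qed.

(** The mean value theorem fails for vector-valued maps; it is applied to the scalar function
    [dotv (T _) v]. *)
Lemma MVT_dotv d (T : 'rV[R]_d -> 'rV[R]_d) (H : 'rV[R]_d -> 'M[R]_d) (x v : 'rV[R]_d) :
  (forall x, is_diff x T (mulmxr (H x))) ->
  exists y, dotv (T (x + v) - T x) v = dotv (v *m H y) v.
Proof.
move=> dT; pose T0 := gradlin (fun i => v 0 i) \o T.
have gl z : gradlin (fun i => v 0 i) z = dotv z v by rewrite dotvE.
have dg z : is_diff z (gradlin (fun i => v 0 i)) (gradlin (fun i => v 0 i)).
  apply: is_diff_affine; first exact: continuous_gradlin.
  by move=> h; rewrite linearD/= addrK.
have dT0 z : is_diff z T0 (gradlin (fun i => v 0 i) \o mulmxr (H z)).
  exact: is_diff_comp.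
have dd z : derivable T0 z v by apply: diff_derivable; have [] := dT0 z.
have [t _ E] := @MVT_line d T0 x v 1 dd.
exists (x + (t * 1) *: v); move: E.
rewrite deriveE; last by have [] := dT0 (x + (t * 1) *: v).
by have [_ ->] := dT0 (x + (t * 1) *: v); rewrite /T0 /= !gl scale1r mul1r dotvBl.
Qed.

Lemma grad_strict_mono d (f : 'rV[R]_d -> R) (x v : 'rV[R]_d) : smooth f ->
  (forall x, posdef (hess f x)) -> v != 0 -> 0 < dotv (grad f (x + v) - grad f x) v.
Proof.
move=> sf pH v0; have [y ->] := @MVT_dotv d (grad f) (hess f) x v (fun x => is_diff_grad x sf).
exact: pH.
Qed.

Lemma strict_convex d (f : 'rV[R]_d -> R) (x v : 'rV[R]_d) : smooth f ->
  (forall x, posdef (hess f x)) -> v != 0 -> dotv (grad f x) v < f (x + v) - f x.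
Proof.
move=> sf pH v0.
have [t /andP[t0 t1]] := @MVT_line d f x v 1 (fun y => @smooth_derivable R d f y v sf).
rewrite scale1r mul1r mulr1 => ->; rewrite derive_gradE//.
have tv0 : t *: v != 0 by rewrite scaler_eq0 negb_or gt_eqF.
have := grad_strict_mono x sf pH tv0.
by rewrite dotvZr pmulr_rgt0// dotvBl subr_gt0.
Qed.

End Convexity.

(** * Transport of mass by gradients of convex functions *)

Section Brenier.
Context {R : realType}.

(** Converse of [strongly_monotone_coercive], by the mean value theorem along the segment. *)
Lemma monotone_le d (T : 'rV[R]_d -> 'rV[R]_d) (H : 'rV[R]_d -> 'M[R]_d) (e : R) :
  (forall x, is_diff x T (mulmxr (H x))) ->
  (forall x v, e * dotv v v <= dotv (v *m H x) v) -> strongly_monotone e T.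
Proof.
move=> dT hH x y; have [z] := MVT_dotv y (x - y) dT.
by rewrite [y + (x - y)]addrC subrK => ->; exact: hH.
Qed.

Lemma limn_einf_cvg (u : nat -> \bar R) (l : \bar R) :
  (u @ \oo --> l)%classic -> limn_einf u = l.
Proof.
by move=> ul; rewrite is_cvg_limn_einfE; [exact/cvg_lim|apply/cvg_ex; exists l].
Qed.

Lemma continuous_lnR (T : topologicalType) (f : T -> R) :
  continuous f -> (forall x, 0 < f x) -> continuous (fun x => ln (f x)).
Proof.
by move=> cf f0 x; apply: (@continuous_comp _ _ _ f (@ln R)); [exact: cf|exact: continuous_ln].
Qed.

(* [T + e id] is strongly monotone for every [e > 0]; Fatou's lemma as [e -> 0]
   leaves only an inequality. *)
Lemma change_of_variables_le d (T : 'rV[R]_d -> 'rV[R]_d) (H : 'rV[R]_d -> 'M[R]_d)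
    (g : 'rV[R]_d -> R) :
  (forall x, is_diff x T (mulmxr (H x))) ->
  (forall i j, continuous (fun x => H x i j)) ->
  (forall x, posdef (H x)) -> continuous g -> (forall x, 0 <= g x) ->
  (iint (fun x => (g (T x) * \det (H x))%:E) <= iint (fun x => (g x)%:E))%E.
Proof.
move=> dT cH pH cg g0; have cT := is_diff_continuous dT.
pose e n : R := n.+1%:R^-1.
have e0 n : 0 < e n by rewrite invr_gt0.
pose Tn n x := T x + e n *: x.
pose Hn n x := H x + (e n)%:M.
have dTn n x : is_diff x (Tn n) (mulmxr (Hn n x)).
  have d2 : is_diff x (fun x : 'rV[R]_d => e n *: x) (mulmxr (e n)%:M).
    apply: is_diff_affine; first exact: continuous_mulmxr.
    by move=> h; rewrite -scalerBr addrK /= mul_mx_scalar.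
  have := is_diffD (dT x) d2; congr (is_diff _ _ _).
  by apply/funext => h; rewrite /Hn /= mulmxDr.
have HnE n x i j : Hn n x i j = H x i j + e n *+ (i == j).
  by rewrite /Hn !mxE.
have cHn n i j : continuous (fun x => Hn n x i j).
  rewrite (funext (fun x => HnE n x i j)).
  by apply: continuous_addR; [exact: cH|move=> x; exact: cst_continuous].
have mTn n : strongly_monotone (e n) (Tn n).
  apply: (monotone_le (dTn n)) => x v.
  rewrite /Hn mulmxDr mul_mx_scalar dotvDl dotvZl lerDr.
  have [->|v0] := eqVneq v 0; first by rewrite mul0mx dotv0r.
  exact/ltW/pH.
have cv n := change_of_variables (e0 n) (dTn n) (cHn n) (mTn n) cg g0.
pose F n x := (g (Tn n x) * \det (Hn n x))%:E.
have en0 : (e n @[n --> \oo] --> (0 : R))%classic by exact: cvg_harmonic.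
(* Both factors are continuous in the regularisation parameter, so the lower limit is the value at
   parameter 0. *)
have lim x : limn_einf (F ^~ x) = (g (T x) * \det (H x))%:E.
  apply: limn_einf_cvg; apply: cvg_EFin; first exact: nearW.
  pose G (t : R) := g (T x + t *: x) * \det (H x + t%:M).
  have cG : {for 0, continuous G}.
    apply: (@continuous_mulR R R (fun t => g (T x + t *: x)) (fun t => \det (H x + t%:M))).
      move=> t; apply: (@continuous_comp _ _ _ (fun t : R => T x + t *: x) g); last exact: cg.
      apply: continuousD; first exact: cst_continuous.
      exact: scalel_continuous.
    apply: continuous_det => i j.
    rewrite (_ : (fun t => _) = (fun t => H x i j + t * (i == j)%:R)).
      apply: continuous_addR; first by move=> t; exact: cst_continuous.
      by move=> t; exact: mulrr_continuous.
    by apply/funext => t; rewrite !mxE mulr_natr.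
  have := cvg_comp _ _ en0 cG; rewrite /G /= scale0r addr0.
  by rewrite raddf0 addr0.
have cF n : continuous (fun x => g (Tn n x) * \det (Hn n x)).
  have cTn : continuous (Tn n) by exact: (is_diff_continuous (dTn n)).
  apply: continuous_mulR; last exact: continuous_det.
  by move=> x; apply: (@continuous_comp _ _ _ (Tn n) g); [exact: cTn|exact: cg].
have F0 n x : 0 <= g (Tn n x) * \det (Hn n x).
  rewrite mulr_ge0//; apply/ltW/posdef_det_gt0.
  exact: (coercive_posdef (e0 n) (strongly_monotone_coercive (dTn n x) (mTn n))).
have := @fatou_iint R d F (fun n => continuous_mrV (@cF n)) (fun n x => _).
under [X in iint X]eq_fun do rewrite lim.
move=> h; apply: le_trans (h _) _; first by move=> n x; rewrite lee_fin.
under eq_fun do rewrite cv.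
by rewrite (limn_einf_cvg (cvg_cst _)).
Qed.

Lemma continuous_det_hess d (Phi : 'rV[R]_d -> R) : smooth Phi ->
  continuous (fun x => \det (hess Phi x)).
Proof. by move=> sPhi; apply: continuous_det => i j; exact: continuous_hess. Qed.

Section MassTransport.
Variables (d : nat) (p q Phi : 'rV[R]_d -> R).
Hypothesis pq : admissible p q Phi.

Let sp : smooth p. Proof. by case: pq => -[]. Qed.
Let p0 x : 0 < p x. Proof. by case: pq => -[_ []]. Qed.
Let p1 : iint (fun x => (p x)%:E) = 1%E. Proof. by case: pq => -[_ []]. Qed.
Let sq : smooth q. Proof. by case: pq => _ [[]]. Qed.
Let q0 x : 0 < q x. Proof. by case: pq => _ [[_ []]]. Qed.
Let q1 : iint (fun x => (q x)%:E) = 1%E. Proof. by case: pq => _ [[_ []]]. Qed.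
Let sPhi : smooth Phi. Proof. by case: pq => _ [_ []]. Qed.
Let pH x : posdef (hess Phi x). Proof. by case: pq => _ [_ [_ []]]. Qed.
Let ma x : p (grad Phi x) * \det (hess Phi x) = q x.
Proof. by case: pq => _ [_ [_ [_ [_ []]]]]. Qed.

Lemma transport_le (h : 'rV[R]_d -> R) : continuous h -> (forall x, 0 <= h x) ->
  (iint (fun x => (h (grad Phi x) * q x)%:E) <= iint (fun x => (h x * p x)%:E))%E.
Proof.
move=> ch h0.
have := @change_of_variables_le d (grad Phi) (hess Phi) (fun x => h x * p x).
rewrite (_ : (fun x => (h (grad Phi x) * p (grad Phi x) * \det (hess Phi x))%:E) =
  (fun x => (h (grad Phi x) * q x)%:E)); last first.
  by apply/funext => x; rewrite -mulrA ma.
apply=> //.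
- by move=> x; exact: is_diff_grad.
- by move=> i j; exact: continuous_hess.
- by apply: continuous_mulR => //; exact: smooth_continuous.
- by move=> x; rewrite mulr_ge0// ltW.
Qed.

(* [transport_le] for [h] and for [1 - h], whose sums agree. *)
Lemma transport_eq (h : 'rV[R]_d -> R) : continuous h -> (forall x, 0 <= h x <= 1) ->
  iint (fun x => (h (grad Phi x) * q x)%:E) = iint (fun x => (h x * p x)%:E).
Proof.
move=> ch h01.
have cp := smooth_continuous sp; have cq := smooth_continuous sq.
pose h' x := 1 - h x.
have h0 x : 0 <= h x by have /andP[] := h01 x.
have h0' x : 0 <= h' x by rewrite subr_ge0; have /andP[] := h01 x.
have ch' : continuous h'.
  by move=> x; apply: continuousB; [exact: cst_continuous|exact: ch].
have cT := continuous_grad sPhi.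
have chT : continuous (fun x => h (grad Phi x)).
  by move=> x; apply: (@continuous_comp _ _ _ (grad Phi) h); [exact: cT|exact: ch].
have chT' : continuous (fun x => h' (grad Phi x)).
  by move=> x; apply: (@continuous_comp _ _ _ (grad Phi) h'); [exact: cT|exact: ch'].
have le1 := transport_le ch h0; have le2 := transport_le ch' h0'.
set A := iint _ in le1 *; set B := iint _ in le1 *.
set A' := iint _ in le2; set B' := iint _ in le2.
have AA' : (A + A' = 1)%E.
  rewrite -q1 /A /A' -iintD//; first last.
  - by move=> x; rewrite lee_fin mulr_ge0// ltW.
  - by move=> x; rewrite lee_fin mulr_ge0// ltW.
  - by apply: continuous_mrV; exact: continuous_mulR.
  - by apply: continuous_mrV; exact: continuous_mulR.
  congr iint; apply/funext => x; rewrite -EFinD -mulrDl /h'.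
  by rewrite addrC subrK mul1r.
have BB' : (B + B' = 1)%E.
  rewrite -p1 /B /B' -iintD//; first last.
  - by move=> x; rewrite lee_fin mulr_ge0// ltW.
  - by move=> x; rewrite lee_fin mulr_ge0// ltW.
  - by apply: continuous_mrV; exact: continuous_mulR.
  - by apply: continuous_mrV; exact: continuous_mulR.
  congr iint; apply/funext => x; rewrite -EFinD -mulrDl /h'.
  by rewrite addrC subrK mul1r.
have A0 : (0 <= A)%E by apply: iint_ge0 => x; rewrite lee_fin mulr_ge0// ltW.
have A0' : (0 <= A')%E by apply: iint_ge0 => x; rewrite lee_fin mulr_ge0// ltW.
move: A A' B B' le1 le2 AA' BB' A0 A0' => [a||] [a'||] [b||] [b'||] //=.
rewrite !lee_fin => h1 h2 [h3] [h4] _ _; congr EFin; lra.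
Qed.

End MassTransport.

End Brenier.

(** * The transport KL divergence *)

Section Divergence.
Context {R : realType}.

Lemma continuous_subR (X : topologicalType) (f g : X -> R) :
  continuous f -> continuous g -> continuous (fun x => f x - g x).
Proof. by move=> cf cg x; exact: (continuousB (cf x) (cg x)). Qed.

(** Phrased for nonnegative functions with values taken in [\bar R], so that the same comparison
    serves to prove integrability and to compare integrals. *)
Lemma le_iint_lincomb d (f g h : 'rV[R]_d -> R) (a b : R) :
  continuous f -> continuous g -> continuous h ->
  (forall x, 0 <= f x) -> (forall x, 0 <= g x) -> (forall x, 0 <= h x) ->
  0 <= a -> 0 <= b -> (forall x, f x <= a * g x + b * h x) ->
  (iint (fun x => (f x)%:E) <=
   a%:E * iint (fun x => (g x)%:E) + b%:E * iint (fun x => (h x)%:E))%E.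
Proof.
move=> cf cg ch f0 g0 h0 a0 b0 fgh.
have cZ k (u : 'rV[R]_d -> R) : continuous u -> continuous (fun x => k * u x).
  by move=> cu; apply: continuous_mulR => // x; exact: cst_continuous.
rewrite -!iintZl//; [|exact: continuous_mrV|exact: continuous_mrV].
have mg : mrV (fun x => a%:E * (g x)%:E)%E.
  by rewrite (funext (fun x => esym (EFinM a (g x)))); exact/continuous_mrV/cZ.
have mh : mrV (fun x => b%:E * (h x)%:E)%E.
  by rewrite (funext (fun x => esym (EFinM b (h x)))); exact/continuous_mrV/cZ.
rewrite -iintD//; [|by move=> x; rewrite -EFinM lee_fin mulr_ge0
  |by move=> x; rewrite -EFinM lee_fin mulr_ge0].
apply: le_iint => //; first exact: continuous_mrV.
apply: (@continuous_mrV R d (fun x => a * g x + b * h x)).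
by apply: continuous_addR; exact: cZ.
Qed.

Lemma admissible_smooth d (p q Phi : 'rV[R]_d -> R) : admissible p q Phi -> smooth Phi.
Proof. by case=> _ [_ []]. Qed.

Lemma admissible_posdef d (p q Phi : 'rV[R]_d -> R) : admissible p q Phi ->
  forall x, posdef (hess Phi x).
Proof. by case=> _ [_ [_ []]]. Qed.

(* Bounded and strictly increasing: potentials need not be integrable, their
   images under [logistic] are. *)
Definition logistic (s : R) : R := (1 + expR (- s))^-1.

Lemma logistic_lt : {homo logistic : s t / s < t}.
Proof.
move=> s t st; rewrite /logistic ltf_pV2 ?posrE ?addr_gt0 ?expR_gt0//.
by rewrite ltrD2l ltr_expR ltrN2.
Qed.

Lemma logistic01 s : 0 <= logistic s <= 1.
Proof.
rewrite invr_ge0 addr_ge0 ?expR_ge0//=.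
by rewrite invf_le1 ?lerDl ?expR_ge0// addr_gt0 ?expR_gt0.
Qed.

Lemma continuous_logistic : continuous logistic.
Proof.
have c1 : continuous (fun s : R => 1 + expR (- s)).
  apply: continuous_addR => s; first exact: cst_continuous.
  apply: (@continuous_comp _ _ _ (-%R) (@expR R)); last exact: continuous_expR.
  exact: opp_continuous.
move=> s; apply: (continuousV _ (c1 s)).
by rewrite gt_eqF// addr_gt0 ?expR_gt0.
Qed.

(* The map S sending x to the point where grad Psi takes the value grad Phi x
   preserves q, while Phi - Psi increases along S, strictly off its fixed points. *)
Lemma brenier_unique d (p q Phi Psi : 'rV[R]_d -> R) :
  admissible p q Phi -> admissible p q Psi -> grad Phi = grad Psi.
Proof.
move=> aPhi aPsi.
have sPhi := admissible_smooth aPhi; have sPsi := admissible_smooth aPsi.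
have hPhi := admissible_posdef aPhi; have hPsi := admissible_posdef aPsi.
have [[sq q01] [V [VK [KV [sT sV]]]]] : density q /\ diffeo (grad Psi).
  by case: aPsi => _ [? [_ [_ []]]].
have [q0 q1] := q01.
have cq := smooth_continuous sq.
have cV : continuous V by exact: smooth_map_continuous.
have cT := continuous_grad sPhi.
pose psi x := Phi x - Psi x.
have cpsi : continuous psi.
  by apply: continuous_subR; exact: smooth_continuous.
pose S x := V (grad Phi x).
have cS : continuous S.
  by move=> x; apply: (@continuous_comp _ _ _ (grad Phi) V); [exact: cT|exact: cV].
(* Strict convexity of [Phi] at [x] and of [Psi] at [S x]: since [grad Psi (S x) = grad Phi x], the
   linear terms cancel in the sum. *)
have psi_lt x : S x != x -> psi x < psi (S x).
  move=> Sx; have v0 : S x - x != 0 by rewrite subr_eq0.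
  have := strict_convex x sPhi hPhi v0; rewrite [x + _]addrC subrK => h1.
  have w0 : x - S x != 0 by rewrite subr_eq0 eq_sym.
  have := strict_convex (S x) sPsi hPsi w0; rewrite [S x + _]addrC subrK.
  rewrite {1}/S KV -opprB => h2.
  have h3 : dotv (grad Phi x) (- (S x - x)) = - dotv (grad Phi x) (S x - x).
    by rewrite -scaleN1r dotvZr mulN1r.
  by rewrite h3 in h2; rewrite /psi; lra.
have psi_le x : logistic (psi x) <= logistic (psi (S x)).
  have [->//|Sx] := eqVneq (S x) x; exact/ltW/logistic_lt/psi_lt.
(* Composed with [grad Psi], [h] is [logistic] of [psi]; composed with [grad Phi], it is the same
   function evaluated along [S]. Both integrals against [q] equal that of [h] against [p]. *)
pose h y := logistic (psi (V y)).
have clp : continuous (fun x => logistic (psi x)).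
  by move=> x; apply: (@continuous_comp _ _ _ psi logistic); [exact: cpsi|exact: continuous_logistic].
have ch : continuous h.
  by move=> y; apply: (@continuous_comp _ _ _ V (fun x => logistic (psi x))); [exact: cV|exact: clp].
have clS : continuous (fun x => logistic (psi (S x))).
  by move=> y; apply: (@continuous_comp _ _ _ S (fun x => logistic (psi x))); [exact: cS|exact: clp].
have e1 := transport_eq aPhi ch (fun y => logistic01 _).
have e2 := transport_eq aPsi ch (fun y => logistic01 _).
have {e1 e2} e1 : iint (fun x => (logistic (psi x) * q x)%:E) =
                  iint (fun x => (logistic (psi (S x)) * q x)%:E).
  apply: etrans (etrans e2 (esym e1)); congr iint; apply/funext => x.
  by congr (logistic (psi _) * _)%:E; exact: esym (VK x).
pose D x := (logistic (psi (S x)) - logistic (psi x)) * q x.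
have D0 x : 0 <= D x by rewrite mulr_ge0 ?subr_ge0// ltW.
have cD : continuous D.
  by apply: continuous_mulR => //; exact: continuous_subR clS clp.
have l0 s : 0 <= logistic s by have /andP[] := logistic01 s.
have ID : iint (fun x => (D x)%:E) = 0%E.
  pose A := iint (fun x => (logistic (psi x) * q x)%:E).
  have E : (iint (fun x => (D x)%:E) + A = A)%E.
    transitivity (iint (fun x => (logistic (psi (S x)) * q x)%:E)); last exact: esym e1.
    rewrite /A -iintD//.
    - by congr iint; apply/funext => x; rewrite -EFinD -mulrDl subrK.
    - exact: continuous_mrV.
    - by apply: continuous_mrV; exact: continuous_mulR.
    - by move=> x; rewrite lee_fin mulr_ge0// ltW.
  have A0 : (0 <= A)%E by apply: iint_ge0 => x; rewrite lee_fin mulr_ge0// ltW.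
  (* Finiteness of [A] is what allows it to be cancelled in [E]. *)
  have A1 : (A <= 1)%E.
    rewrite -q1; apply: le_iint.
    - by apply: continuous_mrV; exact: continuous_mulR.
    - exact: continuous_mrV.
    - by move=> x; rewrite lee_fin mulr_ge0// ltW.
    - move=> x; have /andP[_ l1] := logistic01 (psi x).
      by rewrite lee_fin ler_piMl// ltW.
  have I0 : (0 <= iint (fun x => (D x)%:E))%E by apply: iint_ge0.
  move: (iint _) A E A0 A1 I0 => [i||] [a||] //= [E] _ _ _.
  by congr EFin; lra.
have D1 := iint_eq0 cD D0 ID.
apply/funext => x; have /eqP := D1 x.
rewrite mulf_eq0 (gt_eqF (q0 x)) orbF subr_eq0 => /eqP hx.
have [Sx|Sx] := eqVneq (S x) x; first by rewrite -{2}Sx KV.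
by have := logistic_lt (psi_lt _ Sx); rewrite hx ltxx.
Qed.

(** The log-determinant Bregman divergence of [A] from the identity. *)
Definition tkl_mx d (A : 'M[R]_d) : R := \tr A - ln (\det A) - d%:R.

Lemma tkl_mx_convex d (A B : 'M[R]_d) (l : R) : A^T = A -> B^T = B ->
  posdef A -> posdef B -> 0 <= l <= 1 -> posdef (l *: A + (1 - l) *: B) ->
  tkl_mx (l *: A + (1 - l) *: B) <= l * tkl_mx A + (1 - l) * tkl_mx B.
Proof.
move=> AT BT pA pB l01 pC; have := ln_det_concave AT BT pA pB l01 pC.
by rewrite /tkl_mx mxtraceD !mxtraceZ; lra.
Qed.

Definition tkl_density d (Phi : 'rV[R]_d -> R) (x : 'rV[R]_d) : R :=
  tkl_mx (hess Phi x).

Lemma tkl_density_ge0 d (Phi : 'rV[R]_d -> R) x : smooth Phi -> posdef (hess Phi x) ->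
  0 <= tkl_density Phi x.
Proof.
move=> sPhi pH; have [h _] := mxtrace_ln_det (hess_sym x sPhi) pH.
by rewrite /tkl_density /tkl_mx; lra.
Qed.

Lemma continuous_lap d (Phi : 'rV[R]_d -> R) : smooth Phi -> continuous (lap Phi).
Proof.
by move=> sPhi; apply: continuous_sumR => i; exact: continuous_hess.
Qed.

Lemma continuous_tkl d (Phi : 'rV[R]_d -> R) : smooth Phi ->
  (forall x, posdef (hess Phi x)) -> continuous (tkl_density Phi).
Proof.
move=> sPhi pH; apply: continuous_subR; last by move=> x; exact: cst_continuous.
apply: continuous_subR; first exact: continuous_lap.
apply: (@continuous_lnR R _ (fun x => \det (hess Phi x))); first exact: continuous_det_hess.
by move=> y; exact: posdef_det_gt0.
Qed.

Lemma integral_Rd_ge0 d (f : 'rV[R]_d -> R) : (forall x, 0 <= f x) ->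
  integral_Rd f = fine (iint (fun x => (f x)%:E)).
Proof.
move=> f0; rewrite /integral_Rd.
under [X in iint X]eq_fun do rewrite max_l//.
have -> : (fun x => (Num.max (- f x) 0)%:E) = fun=> 0%:E.
  by apply/funext => x; rewrite max_r// oppr_le0.
have -> : iint (fun _ : 'rV[R]_d => 0%:E) = 0%E :> \bar R.
  have := @iintZl R d (fun=> 0%E) 0 (continuous_mrV (@cst_continuous _ _ (0 : R))).
  under eq_fun do rewrite mul0e.
  by move=> ->//; rewrite mul0e.
by rewrite /= subr0.
Qed.

Section Admissible.
Variables (d : nat) (p q Phi : 'rV[R]_d -> R).
Hypothesis pq : admissible p q Phi.

Let sPhi : smooth Phi := admissible_smooth pq.
Let pH : forall x, posdef (hess Phi x) := admissible_posdef pq.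
Let sq : smooth q. Proof. by case: pq => _ [[]]. Qed.
Let q0 x : 0 < q x. Proof. by case: pq => _ [[_ []]]. Qed.
Let q1 : iint (fun x => (q x)%:E) = 1%E. Proof. by case: pq => _ [[_ []]]. Qed.

Lemma tklq_ge0 x : 0 <= tkl_density Phi x * q x.
Proof. by rewrite mulr_ge0 ?(ltW (q0 x))// tkl_density_ge0. Qed.

Lemma continuous_tklq : continuous (fun x => tkl_density Phi x * q x).
Proof. by apply: continuous_mulR; [exact: continuous_tkl|exact: smooth_continuous]. Qed.

Lemma DTKLE : DTKL q Phi = fine (iint (fun x => (tkl_density Phi x * q x)%:E)).
Proof. by rewrite /DTKL integral_Rd_ge0//; exact: tklq_ge0. Qed.

Lemma iint_tklq_ge0 : (0 <= iint (fun x => (tkl_density Phi x * q x)%:E))%E.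
Proof. by apply: iint_ge0 => x; rewrite lee_fin tklq_ge0. Qed.

(** Domination by the two integrable terms of [admissible] plus a multiple of [q]. *)
Lemma iint_tklq_lty : (iint (fun x => (tkl_density Phi x * q x)%:E) < +oo)%E.
Proof.
have [i1 i2] : Defs.integrable (fun x => q x * lap Phi x) /\
    Defs.integrable (fun x => q x * ln (\det (hess Phi x))).
  by case: pq => _ [_ [_ [_ [_ [_ []]]]]].
have cq := smooth_continuous sq.
have cl : continuous (fun x => ln (\det (hess Phi x))).
  by apply: continuous_lnR => [|x]; [exact: continuous_det_hess|exact: posdef_det_gt0].
have c1 : continuous (fun x => `|q x * lap Phi x|).
  move=> x; apply: (@continuous_comp _ _ _ (fun x => q x * lap Phi x) (fun t : R => `|t|)).
    by apply: continuous_mulR => //; exact: continuous_lap.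
  exact: norm_continuous.
have c2 : continuous (fun x => `|q x * ln (\det (hess Phi x))|).
  move=> x; apply: (@continuous_comp _ _ _ (fun x => q x * ln (\det (hess Phi x))) (fun t : R => `|t|)).
    exact: continuous_mulR.
  exact: norm_continuous.
have m1 := continuous_mrV c1; have m2 := continuous_mrV c2.
have c12 : continuous (fun x => `|q x * lap Phi x| + `|q x * ln (\det (hess Phi x))|).
  exact: continuous_addR.
have d0 : 0 <= d%:R :> R by [].
have cdq : continuous (fun x => d%:R * q x).
  by apply: continuous_mulR => // x; exact: cst_continuous.
apply: (@le_lt_trans _ _ (iint (fun x => ((`|q x * lap Phi x| + `|q x * ln (\det (hess Phi x))|) + d%:R * q x)%:E))).
  apply: le_iint.
  - exact/continuous_mrV/continuous_tklq.
  - by apply: continuous_mrV; exact: continuous_addR.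
  - by move=> x; rewrite lee_fin tklq_ge0.
  - move=> x; rewrite lee_fin /tkl_density.
    have -> : (lap Phi x - ln (\det (hess Phi x)) - d%:R) * q x =
      q x * lap Phi x - q x * ln (\det (hess Phi x)) - d%:R * q x by ring.
    have h1 := ler_norm (q x * lap Phi x).
    have h2 := ler_norm (- (q x * ln (\det (hess Phi x)))); rewrite normrN in h2.
    have h3 : 0 <= d%:R * q x by rewrite mulr_ge0// ltW.
    by lra.
under eq_fun do rewrite EFinD.
rewrite iintD//; first last.
- by move=> x; rewrite lee_fin mulr_ge0// ltW.
- exact: continuous_mrV.
- exact: continuous_mrV.
have -> : iint (fun x => (d%:R * q x)%:E) = d%:R%:E.
  under eq_fun do rewrite EFinM.
  rewrite iintZl// ?q1 ?mule1//; first exact: continuous_mrV.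
  by move=> x; rewrite lee_fin ltW.
under eq_fun do rewrite EFinD.
by rewrite iintD// lte_add_pinfty// ?ltry// lte_add_pinfty.
Qed.

(** Since [fine] sends an infinite value to 0, it is this identity that licenses passing between
    [DTKL] and the extended integral. *)
Lemma iint_tklq_fin : iint (fun x => (tkl_density Phi x * q x)%:E) = (DTKL q Phi)%:E.
Proof. by rewrite DTKLE fineK// ge0_fin_numE ?iint_tklq_ge0// iint_tklq_lty. Qed.

End Admissible.

Lemma DTKL_ge0 d (p q Phi : 'rV[R]_d -> R) : admissible p q Phi -> 0 <= DTKL q Phi.
Proof. by move=> pq; rewrite (DTKLE pq) fine_ge0// (iint_tklq_ge0 pq). Qed.

(** The Hessian is the Jacobian of the gradient, so [brenier_unique] suffices to exchange
    potentials. *)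
Lemma DTKL_eq_grad d (q Phi Psi : 'rV[R]_d -> R) :
  grad Phi = grad Psi -> DTKL q Phi = DTKL q Psi.
Proof.
move=> e; have hE : hess Phi = hess Psi by apply/funext => x; rewrite !hessE e.
by rewrite /DTKL /lap hE.
Qed.

Lemma derive_lincomb d (f g : 'rV[R]_d -> R) (a b : R) (x v : 'rV[R]_d) :
  smooth f -> smooth g ->
  'D_v (fun y => a * f y + b * g y) x = a * 'D_v f x + b * 'D_v g x.
Proof.
move=> sf sg.
have df : is_derive x v f ('D_v f x) by apply/derivableP; exact: smooth_derivable.
have dg : is_derive x v g ('D_v g x) by apply/derivableP; exact: smooth_derivable.
by have [_ E] := is_deriveD (is_deriveZ a df) (is_deriveZ b dg); exact: E.
Qed.

Lemma hess_ij d (f : 'rV[R]_d -> R) x i j :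
  hess f x i j = 'D_(ebasis R i) ('D_(ebasis R j) f) x.
Proof. by rewrite mxE. Qed.

Lemma hess_lincomb d (f g : 'rV[R]_d -> R) (a b : R) x : smooth f -> smooth g ->
  hess (fun y => a * f y + b * g y) x = a *: hess f x + b *: hess g x.
Proof.
move=> sf sg; apply/matrixP => i j.
have E (A B : 'M[R]_d) : (a *: A + b *: B) i j = a * A i j + b * B i j by rewrite !mxE.
have sf' := smooth_derive (ebasis R j) sf; have sg' := smooth_derive (ebasis R j) sg.
apply: etrans (hess_ij _ _ _ _) _; apply: etrans _ (esym (E _ _)).
have E2 := derive_lincomb a b x (ebasis R i) sf' sg'.
have E3 : a * hess f x i j + b * hess g x i j =
    a * 'D_(ebasis R i) ('D_(ebasis R j) f) x + b * 'D_(ebasis R i) ('D_(ebasis R j) g) x.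
  by congr (a * _ + b * _); exact: hess_ij.
apply: etrans (etrans E2 (esym E3)).
by congr (derive _ x _); apply/funext => y; exact: derive_lincomb.
Qed.

Lemma DTKL_le_convex d (q p1 p2 pl Phi1 Phi2 : 'rV[R]_d -> R) (l : R) :
  admissible p1 q Phi1 -> admissible p2 q Phi2 -> 0 <= l <= 1 ->
  admissible pl q (fun x => l * Phi1 x + (1 - l) * Phi2 x) ->
  DTKL q (fun x => l * Phi1 x + (1 - l) * Phi2 x)
    <= l * DTKL q Phi1 + (1 - l) * DTKL q Phi2.
Proof.
move=> a1 a2 l01 al; have /andP[l0 l1] := l01.
have l1' : 0 <= 1 - l by rewrite subr_ge0.
have s1 := admissible_smooth a1; have s2 := admissible_smooth a2.
set Phi := fun x => _.
have q0 x : 0 < q x by case: a1 => _ [[_ []]].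
have hE x : hess Phi x = l *: hess Phi1 x + (1 - l) *: hess Phi2 x.
  exact: hess_lincomb.
have e := iint_tklq_fin al; have e1 := iint_tklq_fin a1; have e2 := iint_tklq_fin a2.
have aux (x y z : \bar R) (a b c : R) : x = a%:E -> y = b%:E -> z = c%:E ->
    (x <= l%:E * y + (1 - l)%:E * z)%E -> a <= l * b + (1 - l) * c.
  by move=> -> -> ->; rewrite -!EFinM -EFinD lee_fin.
apply: (aux _ _ _ _ _ _ e e1 e2) => {e e1 e2 aux}.
apply: (le_iint_lincomb (continuous_tklq al) (continuous_tklq a1) (continuous_tklq a2)
  (tklq_ge0 al) (tklq_ge0 a1) (tklq_ge0 a2) l0 l1').
move=> x; rewrite !mulrA -mulrDl ler_wpM2r ?(ltW (q0 x))//.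
have pl_ := admissible_posdef al x; rewrite -/Phi hE in pl_.
rewrite /tkl_density (hE x : hess _ x = _).
exact: (tkl_mx_convex (hess_sym x s1) (hess_sym x s2) (admissible_posdef a1 x)
  (admissible_posdef a2 x) l01 pl_).
Qed.

End Divergence.

(** * Translations *)

Section Translation.
Context {R : realType}.

Lemma smoothD d (f g : 'rV[R]_d -> R) : smooth f -> smooth g -> smooth (fun x => f x + g x).
Proof. by move=> /smoothP sf /smoothP sg; apply/smoothP => k; exact: CkD. Qed.

Lemma smoothM d (f g : 'rV[R]_d -> R) : smooth f -> smooth g -> smooth (fun x => f x * g x).
Proof. by move=> /smoothP sf /smoothP sg; apply/smoothP => k; exact: CkM. Qed.

Lemma smooth_cst d (c : R) : smooth (fun _ : 'rV[R]_d => c).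
Proof. by apply/smoothP => k; exact: Ck_cst. Qed.

Lemma smooth_coord d i : smooth (fun z : 'rV[R]_d => z 0 i).
Proof. by apply/smoothP => k; exact: Ck_coord. Qed.

Lemma smooth_comp m d (f : 'rV[R]_d -> R) (T : 'rV[R]_m -> 'rV[R]_d) :
  smooth f -> (forall i, smooth (fun x => T x 0 i)) -> smooth (fun x => f (T x)).
Proof.
move=> /smoothP sf sT; apply/smoothP => k; apply: (@Ck_comp R k m d f T) => // i.
exact: smooth_Ck.
Qed.

Definition quad d (x : 'rV[R]_d) : R := (\sum_i x 0 i ^+ 2) / 2.

Lemma smooth_quad d : smooth (@quad d).
Proof.
apply/smoothP => k; apply: CkM; last exact: Ck_cst.
apply: Ck_sum => i; rewrite (_ : (fun x => _) = fun x : 'rV[R]_d => x 0 i * x 0 i).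
  by apply: CkM; exact: Ck_coord.
by apply/funext => x; rewrite expr2.
Qed.

Lemma gradlin_ebasis d (a : 'I_d -> R) i : gradlin a (ebasis R i) = a i.
Proof.
rewrite /gradlin (bigD1 i)//= mxE !eqxx mul1r big1 ?addr0// => j ji.
by rewrite mxE (negbTE ji) andbF mul0r.
Qed.

Lemma derive_gradlin d (a : 'I_d -> R) (x v : 'rV[R]_d) : 'D_v (gradlin a) x = gradlin a v.
Proof. by have [_ ->] := is_derive_gradlin a x v. Qed.

Lemma derive_quad d (v : 'rV[R]_d) : 'D_v (@quad d) = gradlin (fun i => v 0 i).
Proof.
apply/funext => x.
have dq : is_diff x (@quad d) (gradlin (fun i => x 0 i)).
  apply: is_diff_eps; first exact: continuous_gradlin.
  move=> e e0.
  have r0 : 0 < e / d.+1%:R by rewrite divr_gt0.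
  apply/nbhs_ballP; exists (e / d.+1%:R) => //= h.
  rewrite -ball_normE /ball_/= sub0r normrN => hr.
  have -> : quad (h + x) - quad x - gradlin (fun i => x 0 i) h = quad h.
    apply: (mulIf (_ : 2 != 0 :> R)) => //.
    rewrite !mulrBl /quad /gradlin !divfK// mulr_suml -!sumrB.
    by apply: eq_bigr => i _; rewrite !mxE; ring.
  have -> : quad h = dotv h h / 2.
    by rewrite /quad dotvE; congr (_ / 2); apply: eq_bigr => i _; rewrite expr2.
  rewrite ger0_norm ?divr_ge0 ?dotvv_ge0//.
  have h1 := dotv_le h h.
  have n0 := normr_ge0 h.
  have d0 : 0 <= d%:R :> R by [].
  have h2 : `|h| * d.+1%:R < e by rewrite -ltr_pdivlMr.
  rewrite -natr1 in h2.
  have h3 : d%:R * (`|h| * `|h|) <= e * `|h|.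
    by rewrite mulrA ler_wpM2r// mulrC; lra.
  have := mulr_ge0 (ltW e0) n0.
  by lra.
by have [df dE] := dq; rewrite deriveE// dE; apply: eq_bigr => i _; rewrite mulrC.
Qed.

Lemma hess_quad d (x : 'rV[R]_d) : hess (@quad d) x = 1%:M.
Proof.
apply/matrixP => i j; rewrite hess_ij derive_quad derive_gradlin gradlin_ebasis.
by rewrite !mxE eqxx.
Qed.

Lemma hess_gradlin d (a : 'I_d -> R) (x : 'rV[R]_d) : hess (gradlin a) x = 0.
Proof.
apply/matrixP => i j; rewrite hess_ij mxE.
rewrite (_ : 'D_(ebasis R j) (gradlin a) = fun=> a j); first exact: derive_cst.
by apply/funext => y; rewrite derive_gradlin gradlin_ebasis.
Qed.

Lemma smooth_gradlin d (a : 'I_d -> R) : smooth (gradlin a).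
Proof. by apply/smoothP => k; exact: Ck_gradlin. Qed.

Section Perturbation.
Variables (d : nat) (f : 'rV[R]_d -> R) (e : R).
Hypothesis sf : smooth f.

Lemma smooth_quadD : smooth (fun x => quad x + e * f x).
Proof.
exact: smoothD (@smooth_quad d) (smoothM (@smooth_cst d e) sf).
Qed.

Lemma quadDE : (fun x => quad x + e * f x) = (fun x => 1 * quad x + e * f x).
Proof. by apply/funext => x; rewrite mul1r. Qed.

Lemma hess_quadD x : hess (fun x => quad x + e * f x) x = 1%:M + e *: hess f x.
Proof.
by rewrite quadDE (hess_lincomb _ _ _ (@smooth_quad d) sf) hess_quad scale1r.
Qed.

Lemma grad_quadD x : grad (fun x => quad x + e * f x) x = x + e *: grad f x.
Proof.
have E (y z : 'rV[R]_d) i : (y + e *: z) 0 i = y 0 i + e * z 0 i by rewrite !mxE.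
apply/rowP => i; rewrite (E x) quadDE.
have gE (g : 'rV[R]_d -> R) : grad g x 0 i = 'D_(ebasis R i) g x by rewrite mxE.
have qE : 'D_(ebasis R i) (@quad d) x = x 0 i.
  have := congr1 (@^~ x) (derive_quad (ebasis R i)) => /= ->.
  rewrite /gradlin (bigD1 i)//= mxE !eqxx mulr1 big1 ?addr0// => j ji.
  by rewrite mxE (negbTE ji) andbF mulr0.
rewrite (gE f) gE (derive_lincomb _ _ _ _ (@smooth_quad d) sf) mul1r qE.
by [].
Qed.

End Perturbation.

Lemma integrable_mass d (q f : 'rV[R]_d -> R) (C : R) : density q -> continuous f ->
  (forall x, `|f x| <= C) -> Defs.integrable (fun x => q x * f x).
Proof.
move=> [sq [q0 q1]] cf fC.
have cq := smooth_continuous sq.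
have C0 : 0 <= C by apply: le_trans (fC 0); exact: normr_ge0.
have cqf : continuous (fun x => `|q x * f x|).
  move=> x; apply: (@continuous_comp _ _ _ (fun x => q x * f x) (fun t : R => `|t|)).
    exact: continuous_mulR.
  exact: norm_continuous.
have h : (iint (fun x => (`|q x * f x|)%:E) <= C%:E * iint (fun x => (q x)%:E) + 0%:E * iint (fun x => (q x)%:E))%E.
  apply: le_iint_lincomb => //; try by move=> x; rewrite ltW.
  move=> x; rewrite mul0r addr0 normrM mulrC (gtr0_norm (q0 x)) ler_wpM2r//.
  exact: ltW.
by apply: le_lt_trans h _; rewrite q1 mul0e adde0 mule1 ltry.
Qed.

Lemma posdef1 d : posdef (1%:M : 'M[R]_d).
Proof. by move=> v v0; rewrite mulmx1; exact: mulmx_tr_gt0. Qed.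

Lemma tkl_mx1 d : tkl_mx (1%:M : 'M[R]_d) = 0.
Proof. by rewrite /tkl_mx mxtrace1 det1 ln1 subr0 subrr. Qed.

Lemma smooth_translation d (c : 'rV[R]_d) : smooth_map (fun x => x + c).
Proof.
move=> i; rewrite (_ : (fun x => _) = fun x : 'rV[R]_d => x 0 i + c 0 i).
  by apply: smoothD; [exact: smooth_coord|exact: smooth_cst].
by apply/funext => x; rewrite mxE.
Qed.

(** The gradient of [|x|^2 / 2 + <c, x>] is the translation by [c]; the factor 1 puts this potential
    in the form handled for perturbations of [quad]. *)
Lemma admissible_translation d (p q : 'rV[R]_d -> R) (c : 'rV[R]_d) :
  density p -> density q -> (forall x, p (x + c) = q x) ->
  admissible p q (fun x => quad x + 1 * gradlin (fun i => c 0 i) x).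
Proof.
move=> dp dq pq; set Phi := fun x => _.
have sg := @smooth_gradlin d (fun i => c 0 i).
have hE x : hess Phi x = 1%:M by rewrite hess_quadD// hess_gradlin scaler0 addr0.
have gE : grad Phi = fun x => x + c.
  apply/funext => x; rewrite grad_quadD// scale1r; congr (_ + _).
  by apply/rowP => i; rewrite mxE derive_gradlin gradlin_ebasis.
split; first exact: dp.
split; first exact: dq.
split; first exact: smooth_quadD.
split; first by move=> x; rewrite hE; exact: posdef1.
split.
  rewrite gE; exists (fun x => x - c); split; first by move=> x; rewrite addrK.
  split; first by move=> x; rewrite subrK.
  by split; exact: smooth_translation.
split; first by move=> x; rewrite hE det1 mulr1 gE.
have lE : lap Phi = fun=> d%:R by apply/funext => x; rewrite /lap hE mxtrace1.
split.
  by rewrite lE; apply: (integrable_mass (C := d%:R)) => // x; [exact: cst_continuous|rewrite normr_nat].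
rewrite (_ : (fun x => _) = fun x => q x * (fun=> 0) x).
  by apply: (integrable_mass (C := 0)) => // x; [exact: cst_continuous|rewrite normr0].
by apply/funext => x; rewrite hE det1 ln1.
Qed.

Lemma DTKL_translation d (p q Phi : 'rV[R]_d -> R) (c : 'rV[R]_d) :
  admissible p q Phi -> (forall x, p (x + c) = q x) -> DTKL q Phi = 0.
Proof.
move=> a pq; have [dp [dq _]] := a.
have a' := admissible_translation dp dq pq.
rewrite (DTKL_eq_grad _ (brenier_unique a a')) (DTKLE a').
have -> : (fun x => (tkl_density (fun x => quad x + 1 * gradlin (fun i => c 0 i) x) x * q x)%:E) =
    fun x : 'rV[R]_d => (0 * q x)%:E.
  apply/funext => x; congr (_ * _)%:E; rewrite /tkl_density hess_quadD; last exact: smooth_gradlin.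
  by rewrite hess_gradlin scaler0 addr0 tkl_mx1.
have [_ [q0 q1]] := dq.
under eq_fun do rewrite EFinM.
rewrite iintZl ?mul0e//; last by move=> x; rewrite lee_fin ltW.
by apply: continuous_mrV; apply: smooth_continuous; case: dq.
Qed.

(** A continuous nonnegative integrand of zero integral vanishes everywhere, so the Hessian is the
    identity and each partial derivative of [Phi] is [x_i] plus its value at 0: [c] is
    [grad Phi 0]. *)
Lemma DTKL_eq0_translation d (p q Phi : 'rV[R]_d -> R) :
  admissible p q Phi -> DTKL q Phi = 0 -> exists c : 'rV[R]_d, forall x, p (x + c) = q x.
Proof.
move=> a D0; have sPhi := admissible_smooth a; have pH := admissible_posdef a.
have q0 x : 0 < q x by case: a => _ [[_ []]].
have ma x : p (grad Phi x) * \det (hess Phi x) = q x.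
  by case: a => _ [_ [_ [_ [_ []]]]].
have I0 := iint_tklq_fin a; rewrite D0 in I0.
have t0 := iint_eq0 (continuous_tklq a) (tklq_ge0 a) I0.
have h1 x : hess Phi x = 1%:M.
  have /eqP := t0 x; rewrite mulf_eq0 (gt_eqF (q0 x)) orbF => /eqP tx.
  have [_] := mxtrace_ln_det (hess_sym x sPhi) (pH x); apply.
  by move: tx; rewrite /tkl_density /tkl_mx; lra.
exists (grad Phi 0) => x; rewrite -ma h1 det1 mulr1; congr p; apply/rowP => i.
have sPi : smooth ('D_(ebasis R i) Phi) by exact: smooth_derive.
have [t _] := @MVT_line R d ('D_(ebasis R i) Phi) 0 x 1 (fun y => @smooth_derivable R d _ y x sPi).
rewrite scale1r add0r mul1r (Ck_deriveE _ _ (smooth_Ck 1 sPi)) => E.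
have E2 : 'D_(ebasis R i) Phi x = x 0 i + 'D_(ebasis R i) Phi 0.
  rewrite -[LHS](subrK ('D_(ebasis R i) Phi 0)) E; congr (_ + _).
  rewrite (bigD1 i)//= -hess_ij h1 mxE eqxx big1; first by rewrite addr0 mulr1.
  by move=> j ji; rewrite -hess_ij h1 mxE (negbTE ji) mulr0.
have gE (g : 'rV[R]_d -> R) y : grad g y 0 i = 'D_(ebasis R i) g y by rewrite mxE.
have aE (y z : 'rV[R]_d) : (y + z) 0 i = y 0 i + z 0 i by rewrite mxE.
by apply: etrans (aE _ _) _; apply: etrans _ (esym (gE _ _)); rewrite E2 gE.
Qed.

End Translation.

(** * Products *)

Section Separability.
Context {R : realType}.

(** The two difference quotients are the same function of the step, hence so are their limits. *)
Lemma derive_comp_lin m d (f : 'rV[R]_d -> R) (L : 'rV[R]_m -> 'rV[R]_d) (v : 'rV[R]_m) :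
  (forall (h : R) x, L (h *: v + x) = h *: L v + L x) ->
  forall x, 'D_v (fun x => f (L x)) x = 'D_(L v) f (L x).
Proof.
move=> Llin x; rewrite /derive.
suff -> : (fun h : R => h^-1 *: (f (L (h *: v + x)) - f (L x))) =
    (fun h : R => h^-1 *: (f (h *: L v + L x) - f (L x))) by [].
by apply/funext => h; rewrite Llin.
Qed.

Section Submx.
Variables d1 d2 : nat.
Implicit Types (f : 'rV[R]_d1 -> R) (g : 'rV[R]_d2 -> R).

Lemma derive_lsubmx f (v z : 'rV[R]_(d1 + d2)) :
  'D_v (fun z => f (lsubmx z)) z = 'D_(lsubmx v) f (lsubmx z).
Proof. by apply: derive_comp_lin => h x; apply/matrixP => i j; rewrite !mxE. Qed.

Lemma derive_rsubmx g (v z : 'rV[R]_(d1 + d2)) :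
  'D_v (fun z => g (rsubmx z)) z = 'D_(rsubmx v) g (rsubmx z).
Proof. by apply: derive_comp_lin => h x; apply/matrixP => i j; rewrite !mxE. Qed.

Lemma lsubmx_ebasis_l (i : 'I_d1) : lsubmx (ebasis R (lshift d2 i)) = ebasis R i.
Proof. by apply/matrixP => k j; rewrite !mxE (inj_eq (@lshift_inj _ _)). Qed.

Lemma lsubmx_ebasis_r (i : 'I_d2) : lsubmx (ebasis R (rshift d1 i)) = 0.
Proof. by apply/matrixP => k j; rewrite !mxE eq_lrshift andbF. Qed.

Lemma rsubmx_ebasis_l (i : 'I_d1) : rsubmx (ebasis R (lshift d2 i)) = 0.
Proof. by apply/matrixP => k j; rewrite !mxE eq_rlshift andbF. Qed.

Lemma rsubmx_ebasis_r (i : 'I_d2) : rsubmx (ebasis R (rshift d1 i)) = ebasis R i.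
Proof. by apply/matrixP => k j; rewrite !mxE (inj_eq (@rshift_inj _ _)). Qed.

Lemma smooth_lsubmx f : smooth f -> smooth (fun z : 'rV[R]_(d1 + d2) => f (lsubmx z)).
Proof.
move=> sf; apply: (smooth_comp sf) => i.
by rewrite (_ : (fun z => _) = fun z : 'rV[R]_(d1 + d2) => z 0 (lshift d2 i));
  [exact: smooth_coord|apply/funext => z; rewrite mxE].
Qed.

Lemma smooth_rsubmx g : smooth g -> smooth (fun z : 'rV[R]_(d1 + d2) => g (rsubmx z)).
Proof.
move=> sg; apply: (smooth_comp sg) => i.
by rewrite (_ : (fun z => _) = fun z : 'rV[R]_(d1 + d2) => z 0 (rshift d1 i));
  [exact: smooth_coord|apply/funext => z; rewrite mxE].
Qed.

Lemma continuous_lsubmx f : continuous f -> continuous (fun z : 'rV[R]_(d1 + d2) => f (lsubmx z)).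
Proof.
move=> cf z; apply: (@continuous_comp _ _ _ (fun z : 'rV[R]_(d1 + d2) => lsubmx z) f); last exact: cf.
apply: continuous_rV => i.
by rewrite (_ : (fun z => _) = fun z : 'rV[R]_(d1 + d2) => z 0 (lshift d2 i));
  [exact: coord_continuous|apply/funext => t; rewrite mxE].
Qed.

Lemma continuous_rsubmx g : continuous g -> continuous (fun z : 'rV[R]_(d1 + d2) => g (rsubmx z)).
Proof.
move=> cg z; apply: (@continuous_comp _ _ _ (fun z : 'rV[R]_(d1 + d2) => rsubmx z) g); last exact: cg.
apply: continuous_rV => i.
by rewrite (_ : (fun z => _) = fun z : 'rV[R]_(d1 + d2) => z 0 (rshift d1 i));
  [exact: coord_continuous|apply/funext => t; rewrite mxE].
Qed.

(* The factors [1] put the sum in the form of [derive_lincomb] and [hess_lincomb]. *)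
Definition sep_sum f g (z : 'rV[R]_(d1 + d2)) : R := 1 * f (lsubmx z) + 1 * g (rsubmx z).

Lemma smooth_sep_sum f g : smooth f -> smooth g -> smooth (sep_sum f g).
Proof.
move=> sf sg.
exact: smoothD (smoothM (@smooth_cst _ _ 1) (smooth_lsubmx sf))
               (smoothM (@smooth_cst _ _ 1) (smooth_rsubmx sg)).
Qed.

Lemma grad_sep_sum f g z : smooth f -> smooth g ->
  grad (sep_sum f g) z = row_mx (grad f (lsubmx z)) (grad g (rsubmx z)).
Proof.
move=> sf sg.
have gE n (h : 'rV[R]_n -> R) y i : grad h y 0 i = 'D_(ebasis R i) h y by rewrite mxE.
have E v : 'D_v (sep_sum f g) z = 'D_(lsubmx v) f (lsubmx z) + 'D_(rsubmx v) g (rsubmx z).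
  rewrite (derive_lincomb _ _ _ _ (smooth_lsubmx sf) (smooth_rsubmx sg)) !mul1r.
  by congr (_ + _); [exact: derive_lsubmx|exact: derive_rsubmx].
apply/rowP => i; apply: etrans (gE _ _ _ _) _; apply: etrans (E _) _.
case: (split_ordP i) => j ->.
  by rewrite lsubmx_ebasis_l rsubmx_ebasis_l derive0 addr0 row_mxEl gE.
by rewrite lsubmx_ebasis_r rsubmx_ebasis_r derive0 add0r row_mxEr gE.
Qed.

(** A basis direction of one factor projects to 0 on the other, so only the diagonal blocks
    survive. *)
Lemma hess_sep_sum f g z : smooth f -> smooth g ->
  hess (sep_sum f g) z = block_mx (hess f (lsubmx z)) 0 0 (hess g (rsubmx z)).
Proof.
move=> sf sg; set F := fun z : 'rV[R]_(d1 + d2) => f (lsubmx z).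
set G := fun z : 'rV[R]_(d1 + d2) => g (rsubmx z).
have hE : hess (sep_sum f g) z = 1 *: hess F z + 1 *: hess G z.
  exact: (@hess_lincomb R (d1 + d2) F G 1 1 z (smooth_lsubmx sf) (smooth_rsubmx sg)).
have E1 i j : hess F z i j =
    'D_(lsubmx (ebasis R i)) ('D_(lsubmx (ebasis R j)) f) (lsubmx z).
  apply: etrans (hess_ij _ _ _ _) _.
  rewrite (_ : 'D_(ebasis R j) (fun z => f (lsubmx z)) = fun z => 'D_(lsubmx (ebasis R j)) f (lsubmx z)).
    exact: derive_lsubmx.
  by apply/funext => y; exact: derive_lsubmx.
have E2 i j : hess G z i j =
    'D_(rsubmx (ebasis R i)) ('D_(rsubmx (ebasis R j)) g) (rsubmx z).
  apply: etrans (hess_ij _ _ _ _) _.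
  rewrite (_ : 'D_(ebasis R j) (fun z => g (rsubmx z)) = fun z => 'D_(rsubmx (ebasis R j)) g (rsubmx z)).
    exact: derive_rsubmx.
  by apply/funext => y; exact: derive_rsubmx.
have D0 n (h : 'rV[R]_n -> R) v x : v = 0 -> 'D_v h x = 0 by move=> ->; exact: derive0.
have DD0 n (h : 'rV[R]_n -> R) v w x : w = 0 -> 'D_v ('D_w h) x = 0.
  move=> ->; rewrite (_ : 'D_0 h = fun=> 0); first exact: derive_cst.
  by apply/funext => y; exact: derive0.
have aE (A B : 'M[R]_(d1 + d2)) i j : (1 *: A + 1 *: B) i j = A i j + B i j.
  by rewrite !scale1r mxE.
apply/matrixP => i j; apply: etrans (congr1 (fun M : 'M[R]_(d1 + d2) => M i j) hE) _.
apply: etrans (aE _ _ _ _) _; apply: etrans (congr2 +%R (E1 i j) (E2 i j)) _.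
clear hE E1 E2.
case: (split_ordP i) => i' ->; case: (split_ordP j) => j' ->.
- rewrite (D0 _ _ _ _ (rsubmx_ebasis_l _)) addr0 !lsubmx_ebasis_l.
  by rewrite block_mxEul hess_ij.
- rewrite (D0 _ _ _ _ (rsubmx_ebasis_l _)) addr0 (DD0 _ _ _ _ _ (lsubmx_ebasis_r _)).
  by rewrite block_mxEur mxE.
- rewrite (D0 _ _ _ _ (lsubmx_ebasis_r _)) add0r (DD0 _ _ _ _ _ (rsubmx_ebasis_l _)).
  by rewrite block_mxEdl mxE.
- rewrite (D0 _ _ _ _ (lsubmx_ebasis_r _)) add0r !rsubmx_ebasis_r.
  by rewrite block_mxEdr hess_ij.
Qed.

Lemma posdef_block (A : 'M[R]_d1) (B : 'M[R]_d2) :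
  posdef A -> posdef B -> posdef (block_mx A 0 0 B).
Proof.
move=> pA pB v v0.
rewrite -[v]hsubmxK mul_row_block !mulmx0 addr0 add0r tr_row_mx mul_row_col mxE.
have nn n (C : 'M[R]_n) (w : 'rV_n) : posdef C -> 0 <= (w *m C *m w^T) 0 0.
  move=> pC; have [->|w0] := eqVneq w 0; first by rewrite !mul0mx mxE.
  exact/ltW/pC.
have [l0|l0] := eqVneq (lsubmx v) 0.
  rewrite ltr_wpDl ?nn ?pB//.
  by apply: contra_neq v0 => r0; rewrite -[v]hsubmxK l0 r0 row_mx0.
by rewrite ltr_wpDr ?nn ?pA.
Qed.

Lemma density_prod (q1 : 'rV[R]_d1 -> R) (q2 : 'rV[R]_d2 -> R) : density q1 -> density q2 ->
  density (fun z => q1 (lsubmx z) * q2 (rsubmx z)).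
Proof.
move=> [s1 [p1 i1]] [s2 [p2 i2]].
split; first exact: smoothM (smooth_lsubmx s1) (smooth_rsubmx s2).
split; first by move=> z; rewrite mulr_gt0.
apply: etrans (iint_prod (smooth_continuous s1) (smooth_continuous s2) _ _) _.
- by move=> x; rewrite ltW.
- by move=> x; rewrite ltW.
- by rewrite i1 i2 mule1.
Qed.

(** The integrand is bounded by [|q1 F1| q2 + q1 |q2 F2|]; each product integrates factor by factor,
    and the factor without [F1] or [F2] has mass 1. *)
Lemma integrable_sep (q1 F1 : 'rV[R]_d1 -> R) (q2 F2 : 'rV[R]_d2 -> R) :
  density q1 -> density q2 -> continuous F1 -> continuous F2 ->
  Defs.integrable (fun x => q1 x * F1 x) -> Defs.integrable (fun x => q2 x * F2 x) ->
  Defs.integrable (fun z => q1 (lsubmx z) * q2 (rsubmx z) * (F1 (lsubmx z) + F2 (rsubmx z))).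
Proof.
move=> [s1 [p1 i1]] [s2 [p2 i2]] c1 c2 I1 I2.
have cq1 := smooth_continuous s1; have cq2 := smooth_continuous s2.
have cn (n : nat) (f : 'rV[R]_n -> R) : continuous f -> continuous (fun x => `|f x|).
  move=> cf x; apply: (@continuous_comp _ _ _ f (fun t : R => `|t|)); first exact: cf.
  exact: norm_continuous.
have cg1 := cn _ _ (continuous_mulR cq1 c1); have cg2 := cn _ _ (continuous_mulR cq2 c2).
have q1p x : 0 <= q1 x by rewrite ltW.
have q2p x : 0 <= q2 x by rewrite ltW.
have h := @le_iint_lincomb R _ _ _ _ 1 1
  (cn _ _ (continuous_mulR (continuous_mulR (continuous_lsubmx cq1) (continuous_rsubmx cq2))
    (continuous_addR (continuous_lsubmx c1) (continuous_rsubmx c2))))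
  (continuous_mulR (continuous_lsubmx cg1) (continuous_rsubmx cq2))
  (continuous_mulR (continuous_lsubmx cq1) (continuous_rsubmx cg2))
  (fun x => normr_ge0 _) (fun x => mulr_ge0 (normr_ge0 _) (q2p _))
  (fun x => mulr_ge0 (q1p _) (normr_ge0 _)) ler01 ler01.
apply: le_lt_trans (h _) _.
  move=> z; rewrite !mul1r; apply: le_trans (_ : _ <= `|q1 (lsubmx z) * F1 (lsubmx z) * q2 (rsubmx z)| +
    `|q1 (lsubmx z) * (q2 (rsubmx z) * F2 (rsubmx z))|) _.
    by apply: le_trans (ler_normD _ _); rewrite le_eqVlt; apply/orP; left; apply/eqP; congr `|_|; ring.
  by rewrite [`|q1 _ * F1 _ * _|]normrM [`|q1 _ * (_ * _)|]normrM (ger0_norm (q1p _)) (ger0_norm (q2p _)).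
rewrite !mul1e.
have -> := iint_prod cg1 cq2 (fun x => normr_ge0 _) q2p.
have -> := iint_prod cq1 cg2 q1p (fun x => normr_ge0 _).
by rewrite i1 i2 mule1 mul1e lte_add_pinfty.
Qed.

End Submx.

Section Product.
Variables (d1 d2 : nat) (p1 q1 Phi1 : 'rV[R]_d1 -> R) (p2 q2 Phi2 : 'rV[R]_d2 -> R).
Hypotheses (a1 : admissible p1 q1 Phi1) (a2 : admissible p2 q2 Phi2).
Let p (z : 'rV[R]_(d1 + d2)) : R := p1 (lsubmx z) * p2 (rsubmx z).
Let q (z : 'rV[R]_(d1 + d2)) : R := q1 (lsubmx z) * q2 (rsubmx z).
Let s1 : smooth Phi1. Proof. exact: admissible_smooth a1. Qed.
Let s2 : smooth Phi2. Proof. exact: admissible_smooth a2. Qed.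

Lemma diffeo_sep_sum : diffeo (grad Phi1) -> diffeo (grad Phi2) -> diffeo (grad (sep_sum Phi1 Phi2)).
Proof.
move=> [S1 [TS1 [ST1 [_ sS1]]]] [S2 [TS2 [ST2 [_ sS2]]]].
have gE z : grad (sep_sum Phi1 Phi2) z = row_mx (grad Phi1 (lsubmx z)) (grad Phi2 (rsubmx z)).
  exact: grad_sep_sum.
exists (fun z => row_mx (S1 (lsubmx z)) (S2 (rsubmx z))).
split; first by move=> z; rewrite gE row_mxKl row_mxKr TS1 TS2 hsubmxK.
split; first by move=> z; rewrite gE row_mxKl row_mxKr ST1 ST2 hsubmxK.
split; first exact/smooth_grad/smooth_sep_sum.
move=> i; case: (split_ordP i) => j ->.
  rewrite (_ : (fun z => _) = fun z : 'rV[R]_(d1 + d2) => (fun x => S1 x 0 j) (lsubmx z)).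
    exact: smooth_lsubmx (sS1 j).
  by apply/funext => z; rewrite row_mxEl.
rewrite (_ : (fun z => _) = fun z : 'rV[R]_(d1 + d2) => (fun x => S2 x 0 j) (rsubmx z)).
  exact: smooth_rsubmx (sS2 j).
by apply/funext => z; rewrite row_mxEr.
Qed.

Let det1 x : 0 < \det (hess Phi1 x).
Proof. exact: posdef_det_gt0 (admissible_posdef a1 x). Qed.
Let det2 x : 0 < \det (hess Phi2 x).
Proof. exact: posdef_det_gt0 (admissible_posdef a2 x). Qed.

Let detE z : \det (hess (sep_sum Phi1 Phi2) z) =
  \det (hess Phi1 (lsubmx z)) * \det (hess Phi2 (rsubmx z)).
Proof. by rewrite hess_sep_sum// det_ublock. Qed.

Let lapE z : lap (sep_sum Phi1 Phi2) z = lap Phi1 (lsubmx z) + lap Phi2 (rsubmx z).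
Proof. by rewrite /lap hess_sep_sum// mxtrace_block. Qed.

Let lnE z : ln (\det (hess (sep_sum Phi1 Phi2) z)) =
  ln (\det (hess Phi1 (lsubmx z))) + ln (\det (hess Phi2 (rsubmx z))).
Proof. by rewrite detE lnM// posrE. Qed.

Lemma admissible_sep_sum : admissible p q (sep_sum Phi1 Phi2).
Proof.
have [dp1 [dq1 [_ [h1 [f1 [m1 [i1 j1]]]]]]] := a1.
have [dp2 [dq2 [_ [h2 [f2 [m2 [i2 j2]]]]]]] := a2.
split; first exact: density_prod.
split; first exact: density_prod.
split; first exact: smooth_sep_sum.
split; first by move=> z; rewrite hess_sep_sum//; exact: posdef_block.
split; first exact: diffeo_sep_sum.
split.
  move=> z; rewrite detE grad_sep_sum// /p /q row_mxKl row_mxKr -m1 -m2.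
  by rewrite mulrACA.
split.
  have := integrable_sep dq1 dq2 (continuous_lap s1) (continuous_lap s2) i1 i2.
  by congr Defs.integrable; apply/funext => z; rewrite lapE.
have := integrable_sep dq1 dq2 (continuous_lnR (continuous_det_hess s1) det1)
  (continuous_lnR (continuous_det_hess s2) det2) j1 j2.
by congr Defs.integrable; apply/funext => z; rewrite lnE.
Qed.

Lemma DTKL_sep_sum : DTKL q (sep_sum Phi1 Phi2) = DTKL q1 Phi1 + DTKL q2 Phi2.
Proof.
have [_ [[sq1 [q10 Q1]] _]] := a1; have [_ [[sq2 [q20 Q2]] _]] := a2.
have cq1 := smooth_continuous sq1; have cq2 := smooth_continuous sq2.
have q1p x : 0 <= q1 x by rewrite ltW.
have q2p x : 0 <= q2 x by rewrite ltW.
have c1 := continuous_tklq a1; have c2 := continuous_tklq a2.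
have n1 := tklq_ge0 a1; have n2 := tklq_ge0 a2.
apply: EFin_inj; rewrite -(iint_tklq_fin admissible_sep_sum).
(* Trace, logarithm of the determinant and dimension are additive over the blocks; weighting by
   [q1 q2] leaves each term with one factor of mass 1. *)
have -> : (fun z => (tkl_density (sep_sum Phi1 Phi2) z * q z)%:E) = fun z =>
   (((tkl_density Phi1 (lsubmx z) * q1 (lsubmx z)) * q2 (rsubmx z))%:E
   + (q1 (lsubmx z) * (tkl_density Phi2 (rsubmx z) * q2 (rsubmx z)))%:E)%E.
  apply/funext => z; rewrite -EFinD; congr EFin.
  rewrite /tkl_density /tkl_mx lnE -!/(lap _ _) lapE natrD /q; ring.
rewrite iintD.
- have -> := iint_prod c1 cq2 n1 q2p; have -> := iint_prod cq1 c2 q1p n2.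
  by rewrite (iint_tklq_fin a1) (iint_tklq_fin a2) Q1 Q2 mule1 mul1e EFinD.
- exact/continuous_mrV/(continuous_mulR (continuous_lsubmx c1) (continuous_rsubmx cq2)).
- exact/continuous_mrV/(continuous_mulR (continuous_lsubmx cq1) (continuous_rsubmx c2)).
- by move=> z; rewrite lee_fin mulr_ge0.
- by move=> z; rewrite lee_fin mulr_ge0.
Qed.

End Product.

End Separability.

(** * Perturbations of the identity *)

Section HessianMetric.
Context {R : realType}.

Lemma smoothV d (f : 'rV[R]_d -> R) : smooth f -> (forall x, f x != 0) ->
  smooth (fun x => (f x)^-1).
Proof. by move=> sf f0; apply/smoothP => k; apply: CkV => //; exact: smooth_Ck. Qed.

Lemma smooth_det d n (M : 'rV[R]_d -> 'M[R]_n) : (forall i j, smooth (fun x => M x i j)) ->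
  smooth (fun x => \det (M x)).
Proof. by move=> sM; apply/smoothP => k; apply: Ck_det => i j; exact: smooth_Ck. Qed.

Lemma continuous_compact_support_bounded d (f : 'rV[R]_d -> R) :
  continuous f -> compact_support f -> exists2 K : R, 0 <= K & forall x, `|f x| <= K.
Proof.
move=> cf [M fM].
have cB : compact [set x : 'rV[R]_d | `|x| <= M].
  apply: bounded_closed_compact.
    by exists M; split; [exact: num_real|move=> N MN x /le_trans; apply; exact: ltW].
  have := @closed_comp _ _ (fun x : 'rV[R]_d => `|x|) [set t | t <= M] _ (@closed_le R M).
  by apply=> x _; exact: norm_continuous.
have [N [_ hN]] := compact_bounded (continuous_compact (continuous_subspaceT cf) cB).
exists (Num.max 0 (N + 1)); first by rewrite le_max lexx.
move=> x; rewrite le_max; have [xM|Mx] := leP `|x| M; last by rewrite fM// normr0 lexx.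
by apply/orP; right; apply: (hN (N + 1)); [rewrite ltrDl|exists x].
Qed.

Lemma compact_support_derive d (f : 'rV[R]_d -> R) v :
  compact_support f -> compact_support ('D_v f).
Proof.
move=> [M fM]; exists M => x Mx.
rewrite -(derive_cst (0 : R) x v); apply: near_eq_derive.
have : \forall y \near x, M < `|y|.
  exact: (@norm_continuous _ _ x [set t | M < t] (lt_nbhsr Mx)).
by apply: filterS => y; exact: fM.
Qed.

Lemma hess_bounded d (f : 'rV[R]_d -> R) : smooth f -> compact_support f ->
  exists2 K : R, 0 <= K & forall x i j, `|hess f x i j| <= K.
Proof.
move=> sf cf.
have h (ij : 'I_d * 'I_d) : exists K : R, 0 <= K /\ forall x, `|hess f x ij.1 ij.2| <= K.
  have [] := @continuous_compact_support_bounded d (fun x => hess f x ij.1 ij.2).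
  - exact: continuous_hess.
  - by rewrite hess_coord; do 2 apply: compact_support_derive.
  - by move=> K K0 hK; exists K.
have [K hK] := choice h.
exists (\sum_ij K ij); first by apply: sumr_ge0 => ij _; case: (hK ij).
move=> x i j; rewrite (bigD1 (i, j))//= ler_wpDr//.
  by apply: sumr_ge0 => ij _; case: (hK ij).
by case: (hK (i, j)) => _; apply.
Qed.

(** Each term [v_j B_ji v_i] is at most [b (v_j^2 + v_i^2) / 2] in absolute value; summing over both
    indices produces the factor [d]. *)
Lemma dotv_mulmx_le d (B : 'M[R]_d) (b : R) (v : 'rV[R]_d) :
  (forall i j, `|B i j| <= b) -> `|dotv (v *m B) v| <= d%:R * b * dotv v v.
Proof.
move=> hB.
have nE (t : R) : `|t| * `|t| = t ^+ 2 by rewrite -expr2 real_normK ?num_real.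
have step i j : `|v 0 j * B j i * v 0 i| <= b * ((v 0 j ^+ 2 + v 0 i ^+ 2) / 2).
  rewrite !normrM mulrAC [X in X <= _]mulrC.
  have b0 : 0 <= b by apply: le_trans (hB j i).
  apply: ler_pM => //.
  have := sqr_ge0 (`|v 0 j| - `|v 0 i|); rewrite -(nE (v 0 j)) -(nE (v 0 i)); lra.
rewrite dotvE; under eq_bigr do rewrite mxE mulr_suml.
apply: le_trans (ler_norm_sum _ _ _) _.
apply: le_trans (ler_sum _ (fun i _ => ler_norm_sum _ _ _)) _.
apply: le_trans (ler_sum _ (fun i _ => ler_sum _ (fun j _ => step i j))) _.
under eq_bigr do rewrite -mulr_sumr -mulr_suml big_split/= sumr_const card_ord -[_ *+ d]mulr_natl.
rewrite -mulr_sumr -mulr_suml big_split/= -mulr_sumr sumr_const card_ord -[_ *+ d]mulr_natl.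
rewrite dotvE (eq_bigr (fun i => v 0 i ^+ 2)) => [|i _]; last by rewrite expr2.
by rewrite le_eqVlt; apply/orP; left; apply/eqP; field.
Qed.

Lemma mxtrace_sqr_ge0 d (A : 'M[R]_d) : A^T = A -> 0 <= \tr (A *m A).
Proof.
move=> AT; apply: sumr_ge0 => i _; rewrite mxE; apply: sumr_ge0 => j _.
by rewrite -{2}AT mxE -expr2 sqr_ge0.
Qed.

Lemma continuous_mxtrace_sqr d (A : 'rV[R]_d -> 'M[R]_d) :
  (forall i j, continuous (fun x => A x i j)) -> continuous (fun x => \tr (A x *m A x)).
Proof.
move=> cA; apply: continuous_sumR => i.
rewrite (_ : (fun x => _) = fun x => \sum_j A x i j * A x j i).
  by apply: continuous_sumR => j; exact: continuous_mulR.
by apply/funext => x; rewrite mxE.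
Qed.

Lemma iint_bounded_density d (q u : 'rV[R]_d -> R) (C : R) : density q -> continuous u ->
  (forall x, 0 <= u x <= C) ->
  iint (fun x => (u x * q x)%:E) = (integral_Rd (fun x => u x * q x))%:E.
Proof.
move=> [sq [q0 q1]] cu uC; have cq := smooth_continuous sq.
have u0 x : 0 <= u x by have /andP[] := uC x.
have q0' x : 0 <= q x by rewrite ltW.
have uq0 x : 0 <= u x * q x by rewrite mulr_ge0.
have C0 : 0 <= C by have /andP[/le_trans] := uC 0; apply.
rewrite integral_Rd_ge0// fineK// ge0_fin_numE ?iint_ge0//.
have h := @le_iint_lincomb R d (fun x => u x * q x) q q C 0 (continuous_mulR cu cq) cq cq
  uq0 q0' q0' C0 (lexx 0).
apply: le_lt_trans (h _) _; last by rewrite q1 mul0e adde0 mule1 ltry.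
by move=> x; rewrite mul0r addr0 ler_wpM2r//; have /andP[] := uC x.
Qed.

Lemma mxtrace_sqr_le d (A : 'M[R]_d) (b : R) : (forall i j, `|A i j| <= b) ->
  `|\tr (A *m A)| <= d%:R * (d%:R * (b * b)).
Proof. by move=> hA; apply: mxtrace_entries_le; exact: mulmx_entries_le. Qed.

(** * Potentials with Hessian close to the identity *)

Section NearIdentity.
Variables (d : nat) (p q Psi : 'rV[R]_d -> R) (B : 'rV[R]_d -> 'M[R]_d) (C b : R).
Hypotheses (dq : density q) (sPsi : smooth Psi).
Hypothesis hE : forall x, hess Psi x = 1%:M + B x.
Hypothesis B_le : forall x i j, `|B x i j| <= b.
Hypotheses (b_ge0 : 0 <= b) (C0 : 0 <= C) (db : d%:R * b <= 1 / 2).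
Hypothesis expandB : forall x, 0 < \det (1%:M + B x) /\
  `|\tr (B x) - ln (\det (1%:M + B x)) - \tr (B x *m B x) / 2| <= C * b ^+ 3.

Let det_gt0 x : 0 < \det (hess Psi x). Proof. by rewrite hE; case: (expandB x). Qed.

Lemma tkl_density_near_id x : `|tkl_density Psi x - 1 / 2 * \tr (B x *m B x)| <= C * b ^+ 3.
Proof.
have [_] := expandB x; rewrite /tkl_density /tkl_mx hE mxtraceD mxtrace1.
set t := \tr (B x); set l := ln _; set s := \tr _.
by rewrite (_ : t - l - s / 2 = d%:R + t - l - d%:R - 1 / 2 * s)//; ring.
Qed.

(** The condition [d b <= 1/2] limits the deviation from the form of the identity to one half; this
    is the origin of the monotonicity constant 1/2 below. *)
Lemma coercive_near_id x v : 1 / 2 * dotv v v <= dotv (v *m hess Psi x) v.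
Proof.
rewrite hE mulmxDr mulmx1 dotvDl.
have := dotv_mulmx_le v (B_le x); rewrite ler_norml => /andP[h _].
have : d%:R * b * dotv v v <= 1 / 2 * dotv v v by rewrite ler_wpM2r// dotvv_ge0.
by lra.
Qed.

Let posdef_hess x : posdef (hess Psi x).
Proof. by apply: (@coercive_posdef _ _ _ (1 / 2)) => //; exact: coercive_near_id. Qed.

Let dT x : is_diff x (grad Psi) (mulmxr (hess Psi x)).
Proof. exact: is_diff_grad. Qed.

Let mT : strongly_monotone (1 / 2) (grad Psi).
Proof. exact: (@monotone_le R d (grad Psi) (hess Psi) (1 / 2) dT coercive_near_id). Qed.

Let bijT : exists S, [/\ cancel (grad Psi) S, cancel S (grad Psi) & smooth_map S].
Proof.
have h2 : 0 < 1 / 2 :> R by [].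
have [S [TS ST cS]] := strongly_monotone_bij h2 (is_diff_continuous dT) mT.
exists S; split; [exact: TS|exact: ST|].
apply: (@smooth_inverse R d (grad Psi) S (smooth_grad sPsi) _ ST cS).
by move=> x; rewrite -hessE; exact: lt0r_neq0.
Qed.

Lemma diffeo_near_id : diffeo (grad Psi).
Proof.
have [S [TS ST sS]] := bijT.
exact: (ex_intro _ S (conj TS (conj ST (conj (smooth_grad sPsi) sS)))).
Qed.

Hypothesis pT : forall x, p (grad Psi x) * \det (hess Psi x) = q x.

(** [p] is known only through its values on the image of [grad Psi]. Inverting that map expresses
    [p] as [q] divided by the determinant, both taken along the inverse [S], whence smoothness and
    positivity; the mass is preserved by the change of variables. *)
Lemma density_near_id : density p.
Proof.
have [sq [q0 q1]] := dq; have [S [TS ST sS]] := bijT.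
have dn x : \det (hess Psi x) != 0 by exact: lt0r_neq0.
have pE : p = fun y => q (S y) * (\det (hess Psi (S y)))^-1.
  by apply/funext => y; rewrite -pT ST mulfK.
have sp : smooth p.
  have sd := smooth_det (fun i j => @smooth_hess R d Psi i j sPsi).
  by rewrite pE; exact: smooth_comp (smoothM sq (smoothV sd dn)) sS.
have p0 x : 0 < p x by rewrite pE mulr_gt0// invr_gt0.
split; first exact: sp.
split; first exact: p0.
have h2 : 0 < 1 / 2 :> R by [].
rewrite -q1 -(change_of_variables h2 dT (fun i j => continuous_hess sPsi) mT (smooth_continuous sp)).
  by congr iint; apply/funext => x; rewrite pT.
by move=> x; rewrite ltW.
Qed.

Lemma admissible_near_id : admissible p q Psi.
Proof.
split; first exact: density_near_id.
split; first exact: dq.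
split; first exact: sPsi.
split; first exact: posdef_hess.
split; first exact: diffeo_near_id.
split; first exact: pT.
have trB x : `|\tr (B x)| <= d%:R * b by apply: mxtrace_entries_le.
split.
  apply: (@integrable_mass _ _ _ _ (d%:R + d%:R * b)) => //; first exact: continuous_lap.
  move=> x; rewrite /lap hE mxtraceD mxtrace1.
  by apply: le_trans (ler_normD _ _) _; rewrite normr_nat lerD2l.
(* The expansion bounds the logarithm by [tr B], [tr (B B)] and the cubic remainder. *)
apply: (@integrable_mass _ _ q (fun x => ln (\det (hess Psi x)))
  (d%:R * b + d%:R * (d%:R * (b * b)) + C * b ^+ 3) dq).
  exact: continuous_lnR (continuous_det_hess sPsi) det_gt0.
move=> x; have [_] := expandB x; rewrite hE.
have := trB x; have := mxtrace_sqr_le (B_le x).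
set s := \tr (B x *m B x); set t := \tr _; set l := ln _.
rewrite !ler_norml => /andP[? ?] /andP[? ?] /andP[? ?].
by apply/andP; split; lra.
Qed.

Lemma DTKL_near_id :
  `|DTKL q Psi - 1 / 2 * integral_Rd (fun x => \tr (B x *m B x) * q x)| <= C * b ^+ 3.
Proof.
have a := admissible_near_id; have [sq [q0 q1]] := dq.
have cq := smooth_continuous sq.
have ct := continuous_tklq a; have t0 := tklq_ge0 a.
pose v x := \tr (B x *m B x).
have cv : continuous v.
  apply: continuous_mxtrace_sqr => i j.
  rewrite (_ : (fun x => _) = fun x => hess Psi x i j - (1%:M : 'M[R]_d) i j).
    by apply: continuous_subR; [exact: continuous_hess|move=> x; exact: cst_continuous].
  by apply/funext => x; rewrite hE [(1%:M + B x) i j]mxE [_ + B x i j]addrC addrK.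
have v0 x : 0 <= v x.
  apply: mxtrace_sqr_ge0; apply: (addrI 1%:M).
  by rewrite -[in RHS]hE -(hess_sym x sPsi) hE linearD/= trmx1.
have vb x : 0 <= v x <= d%:R * (d%:R * (b * b)).
  by rewrite v0 (le_trans (ler_norm _))// mxtrace_sqr_le.
set u := fun x => v x * q x.
have uU : iint (fun x => (u x)%:E) = (integral_Rd u)%:E := iint_bounded_density dq cv vb.
have cu : continuous u by exact: continuous_mulR.
have q0' x : 0 <= q x by rewrite ltW.
have u0 x : 0 <= u x by rewrite mulr_ge0.
have Cb0 : 0 <= C * b ^+ 3 by rewrite mulr_ge0// exprn_ge0.
have h20 : 0 <= 1 / 2 :> R by [].
have tD := iint_tklq_fin a.
have h1 := @le_iint_lincomb R d (fun x => tkl_density Psi x * q x) u q (1 / 2) (C * b ^+ 3)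
  ct cu cq t0 u0 q0' h20 Cb0.
(* [le_iint_lincomb] takes nonnegative coefficients, so the lower bound on [DTKL] is stated as an
   upper bound on [u], multiplied by 2. *)
have h2 := @le_iint_lincomb R d u (fun x => tkl_density Psi x * q x) q
  2 (2 * (C * b ^+ 3)) cu ct cq u0 t0 q0' ltac:(by []) ltac:(by rewrite mulr_ge0).
have key x : `|tkl_density Psi x * q x - 1 / 2 * u x| <= C * b ^+ 3 * q x.
  rewrite /u mulrA -mulrBl normrM (ger0_norm (q0' x)) ler_wpM2r//.
  exact: tkl_density_near_id.
move: h1 h2; rewrite tD uU q1.
rewrite !mule1 -!EFinM -!EFinD !lee_fin => h1 h2.
have k1 x : tkl_density Psi x * q x <= 1 / 2 * u x + C * b ^+ 3 * q x.
  by move: (key x); move: (tkl_density _ _) (u x) => t w; rewrite ler_norml => /andP[_]; lra.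
have k2 x : u x <= 2 * (tkl_density Psi x * q x) + 2 * (C * b ^+ 3) * q x.
  by move: (key x); move: (tkl_density _ _) (u x) => t w; rewrite ler_norml => /andP[]; lra.
have {}h1 := h1 k1; have {}h2 := h2 k2.
move: h1 h2; move: (DTKL _ _) (integral_Rd _) => D U h1 h2.
by rewrite ler_norml; apply/andP; split; lra.
Qed.

End NearIdentity.

Lemma near0_small (K b0 : R) (d : nat) : 0 <= K -> 0 < b0 ->
  \forall e \near (0 : R), `|e| * K <= b0 /\ d%:R * (`|e| * K) <= 1 / 2.
Proof.
move=> K0 b00.
have h (c a : R) : 0 <= c -> 0 < a -> \forall e \near (0 : R), `|e| * c <= a.
  move=> c0 a0; have r0 : 0 < a / (c + 1) by rewrite divr_gt0// ltr_wpDl.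
  apply/nbhs_ballP; exists (a / (c + 1)) => //= e.
  rewrite -ball_normE /ball_/= sub0r normrN ltr_pdivlMr ?ltr_wpDl// => ea.
  by apply/ltW/(le_lt_trans _ ea); rewrite ler_wpM2l// lerDl.
have h1 := h K b0 K0 b00.
have h2 := h (d%:R * K) (1 / 2) (mulr_ge0 (ler0n _ _) K0) ltac:(by []).
by apply: filterS2 h1 h2 => e e1 e2; split=> //; rewrite mulrCA.
Qed.

Section Expansion.
Variables (d : nat) (q Phi : 'rV[R]_d -> R) (qe : R -> 'rV[R]_d -> R).
Hypotheses (dq : density q) (sPhi : smooth Phi) (cPhi : compact_support Phi).
Hypothesis push : \forall e \near (0 : R),
  forall x, qe e (x + e *: grad Phi x) * \det (1%:M + e *: hess Phi x) = q x.

(** The remainder at [B = e hess Phi] is cubic in [e], uniformly in [x] because compact support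
    bounds the Hessian entries by some [K]; integration against [q], of mass 1, preserves the bound.
    Hence the constant [C K^3]. *)
Lemma near_identity_expansion : exists2 C : R, 0 <= C & \forall e \near (0 : R),
  admissible (qe e) q (fun x => quad x + e * Phi x) /\
  `|DTKL q (fun x => quad x + e * Phi x)
    - e ^+ 2 / 2 * integral_Rd (fun x => \tr (hess Phi x *m hess Phi x) * q x)| <= C * `|e| ^+ 3.
Proof.
have [K K0 hK] := hess_bounded sPhi cPhi.
have [C [b0 [C0 b00 expand]]] := @mxtrace_ln_det_expand R d.
exists (C * K ^+ 3); first by rewrite mulr_ge0// exprn_ge0.
apply: filterS2 (near0_small d K0 b00) push => e [eb0 ed] pT.
set Psi := fun x => _.
have sPsi : smooth Psi by exact: smooth_quadD.
have hE x : hess Psi x = 1%:M + e *: hess Phi x by exact: hess_quadD.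
have b_ge0 : 0 <= `|e| * K by rewrite mulr_ge0.
have B_le x i j : `|(e *: hess Phi x) i j| <= `|e| * K.
  by rewrite [(e *: hess Phi x) i j]mxE normrM ler_wpM2l.
have BT x : (e *: hess Phi x)^T = e *: hess Phi x by rewrite linearZ/= hess_sym.
have eB x := expand _ _ (BT x) (B_le x) (introT andP (conj b_ge0 eb0)).
have pT' x : qe e (grad Psi x) * \det (hess Psi x) = q x.
  by rewrite hE -pT; congr (qe e _ * _); exact: grad_quadD.
have a := admissible_near_id dq sPsi hE B_le ed eB pT'.
split; first exact: a.
have D := DTKL_near_id dq sPsi hE B_le b_ge0 C0 ed eB pT'.
pose u x := \tr (hess Phi x *m hess Phi x).
have cu : continuous u by apply: continuous_mxtrace_sqr => i j; exact: continuous_hess.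
have u0 x : 0 <= u x by apply: mxtrace_sqr_ge0; exact: hess_sym.
have ub x : 0 <= u x <= d%:R * (d%:R * (K * K)).
  by rewrite u0 (le_trans (ler_norm _))// mxtrace_sqr_le.
have uU := iint_bounded_density dq cu ub.
have e20 := sqr_ge0 e.
have cv : continuous (fun x => e ^+ 2 * u x).
  by apply: continuous_mulR => // x; exact: cst_continuous.
have vb x : 0 <= e ^+ 2 * u x <= e ^+ 2 * (d%:R * (d%:R * (K * K))).
  by have /andP[? ?] := ub x; rewrite mulr_ge0// ler_wpM2l.
have vV := iint_bounded_density dq cv vb.
have cq : continuous q by apply: smooth_continuous; case: dq.
have q0 x : 0 <= q x by apply: ltW; case: dq => _ [].
have iv : integral_Rd (fun x => e ^+ 2 * u x * q x) = e ^+ 2 * integral_Rd (fun x => u x * q x).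
  apply: EFin_inj; rewrite -vV EFinM -uU -iintZl//.
  - by congr iint; apply/funext => x; rewrite -EFinM mulrA.
  - exact/continuous_mrV/continuous_mulR.
  - by move=> x; rewrite lee_fin mulr_ge0.
have vE : (fun x => \tr ((e *: hess Phi x) *m (e *: hess Phi x)) * q x) =
    (fun x => e ^+ 2 * u x * q x).
  by apply/funext => x; rewrite -scalemxAl -scalemxAr scalerA mxtraceZ expr2.
move: D; rewrite vE iv exprMn -/u; move: (DTKL _ _) (integral_Rd _) => D U.
rewrite mulrA [1 / 2 * _]mulrC mulrA mulr1.
by rewrite [_ ^+ 3 * K ^+ 3]mulrC mulrA.
Qed.

Lemma hessian_metric_limit :
  (fun e : R => (DTKL q (fun x => quad x + e * Phi x)
     - e ^+ 2 / 2 * integral_Rd (fun x => \tr (hess Phi x *m hess Phi x) * q x)) / e ^+ 2)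
  @ (0 : R)^' --> (0 : R).
Proof.
have [C C0 hC] := near_identity_expansion.
apply/cvgr0Pnorm_lt => eps eps0.
(* After division by [e^2] the remainder is at most [C |e|]; [C + 1] avoids a zero denominator. *)
have r0 : 0 < eps / (C + 1) by rewrite divr_gt0// ltr_wpDl.
have hC' : \forall e \near (0 : R)^', _ := nbhs_dnbhs hC.
have hr : \forall e \near (0 : R)^', `|e| < eps / (C + 1).
  apply: nbhs_dnbhs; apply/nbhs_ballP; exists (eps / (C + 1)) => //= e.
  by rewrite -ball_normE /ball_/= sub0r normrN.
have h0 : \forall e \near (0 : R)^', e != 0 by exact: nbhs_dnbhs_neq.
apply: filterS3 hC' hr h0 => e [_ De] er e0; move: De; set X := DTKL _ _ - _ => De.
have en : 0 < `|e| by rewrite normr_gt0.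
rewrite normrM normfV normrX ltr_pdivrMr ?exprn_gt0//; apply: le_lt_trans De _.
rewrite exprS mulrA ltr_pM2r ?exprn_gt0//.
move: er; rewrite ltr_pdivlMr ?ltr_wpDl// => er; nra.
Qed.

End Expansion.
End HessianMetric.

Theorem mainTheorem9 (R : realType) :
  (* (i) nonnegativity *)
  (forall (d : nat) (p q Phi : 'rV[R]_d -> R),
     admissible p q Phi ->
     0 <= DTKL q Phi /\
     (DTKL q Phi = 0 <-> exists c : 'rV[R]_d, forall x, p (x + c) = q x)) /\
  (* (ii) separability *)
  (forall (d1 d2 : nat) (p1 q1 Phi1 : 'rV[R]_d1 -> R)
          (p2 q2 Phi2 : 'rV[R]_d2 -> R) (p q : 'rV[R]_(d1 + d2) -> R),
     admissible p1 q1 Phi1 -> admissible p2 q2 Phi2 ->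
     (forall z, p z = p1 (lsubmx z) * p2 (rsubmx z)) ->
     (forall z, q z = q1 (lsubmx z) * q2 (rsubmx z)) ->
     (exists Phi, admissible p q Phi) /\
     (forall Phi, admissible p q Phi ->
        DTKL q Phi = DTKL q1 Phi1 + DTKL q2 Phi2)) /\
  (* (iii) Hessian metric *)
  (forall (d : nat) (q Phi : 'rV[R]_d -> R) (qe : R -> 'rV[R]_d -> R),
     density q -> smooth Phi -> compact_support Phi ->
     (\forall e \near (0 : R),
        forall x, qe e (x + e *: grad Phi x) *
                  \det (1%:M + e *: hess Phi x) = q x) ->
     let Psi := fun (e : R) (x : 'rV[R]_d) =>
                  (\sum_i x 0 i ^+ 2) / 2 + e * Phi x in
     (\forall e \near (0 : R), admissible (qe e) q (Psi e)) /\
     ((fun e : R => (DTKL q (Psi e)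
          - e ^+ 2 / 2 * integral_Rd (fun x => \tr (hess Phi x *m hess Phi x) * q x))
          / e ^+ 2) @ (0 : R)^' --> (0 : R))) /\
  (* (iv) transport convexity *)
  (forall (d : nat) (q p1 p2 pl Phi1 Phi2 : 'rV[R]_d -> R) (l : R),
     density q ->
     admissible p1 q Phi1 -> admissible p2 q Phi2 ->
     0 <= l <= 1 ->
     admissible pl q (fun x => l * Phi1 x + (1 - l) * Phi2 x) ->
     DTKL q (fun x => l * Phi1 x + (1 - l) * Phi2 x)
       <= l * DTKL q Phi1 + (1 - l) * DTKL q Phi2).
Proof.
split; [|split; [|split]].
- move=> d p q Phi a; split; first exact: DTKL_ge0 a.
  split; first exact: DTKL_eq0_translation a.
  by move=> [c]; exact: DTKL_translation a.
- move=> d1 d2 p1 q1 Phi1 p2 q2 Phi2 p q a1 a2 pE qE.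
  have {pE}-> : p = fun z => p1 (lsubmx z) * p2 (rsubmx z) by apply/funext.
  have {qE}-> : q = fun z => q1 (lsubmx z) * q2 (rsubmx z) by apply/funext.
  have a0 := admissible_sep_sum a1 a2.
  split; first by exists (sep_sum Phi1 Phi2).
  move=> Phi a; rewrite -(DTKL_sep_sum a1 a2).
  exact: DTKL_eq_grad (brenier_unique a a0).
- move=> d q Phi qe dq sPhi cPhi push Psi; split.
    have [C _] := near_identity_expansion dq sPhi cPhi push.
    by apply: filterS => e [].
  exact: hessian_metric_limit dq sPhi cPhi push.
- move=> d q p1 p2 pl Phi1 Phi2 l dq; exact: DTKL_le_convex.
Qed.
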